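(* Let $h$ be a positive integer and let $p\neq 2$ be a prime. Over $\overline{\mathbb{F}}_p$, the $p$-rank of the curve $y^{\frac{p^h-1}{2}} = x^{\frac{p^h-1}{2}} + 1$ is $$\frac{(p+1)^h(p^h+3)}{2^{h+2}}-\frac{3(p^h-1)}{2},$$ and the $p$-rank of the curve $y^{\frac{p^h-1}{2}} = x^{p^h-1} + 1$ is $$\frac{(p+1)^h(p^h+1)}{2^{h+1}} - 2(p^h-1).$$
   Context: A ''curve'' given by an affine equation over $\overline{\mathbb{F}}_p$ means the nonsingular, projective, irreducible curve whose function field is defined by that equation. The $p$-rank $\gamma(\mathcal{X})$ of a curve $\mathcal{X}$ with Jacobian $J$ is the integer such that $J[p](\overline{\mathbb{F}}_p)\cong(\mathbb{Z}/p\mathbb{Z})^{\gamma(\mathcal{X})}$; a curve of genus $0$ has $p$-rank $0$. *)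

(* Defs.v *)
From HB Require Import structures.
From mathcomp Require Import all_boot all_order all_algebra.
From mathcomp Require Import boolp.
From mathcomp.multinomials Require Import freeg.

Set Implicit Arguments.
Unset Strict Implicit.
Unset Printing Implicit Defensive.

Import Order.TTheory GRing.Theory Num.Theory.
Local Open Scope ring_scope.

(* The curve with function field K over the algebraically closed field k is   *)
(* handled through K: its points are the places of K / k, and the group of    *)
(* points J(k) of its Jacobian is the group of divisor classes of degree 0.   *)

(* A place is given by its normalized discrete valuation.  The value of the   *)
(* valuation at 0, which should be +oo, is the dummy 0; fixing it makes a     *)
(* place determined by its valuation on K^*.                                  *)
Record place (k K : fieldType) (iota : {rmorphism k -> K}) := Place {
  ord :> K -> int;
  ord_zero : ord 0 = 0;
  ord_mul : forall f g, f != 0 -> g != 0 -> ord (f * g) = ord f + ord g;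
  ord_add : forall f g, f != 0 -> g != 0 -> f + g != 0 ->
    Num.min (ord f) (ord g) <= ord (f + g);
  ord_const : forall c, c != 0 -> ord (iota c) = 0;
  ord_uniformizer : exists t, ord t = 1
}.

HB.instance Definition _ (k K : fieldType) (iota : {rmorphism k -> K}) :=
  gen_eqMixin (place iota).
HB.instance Definition _ (k K : fieldType) (iota : {rmorphism k -> K}) :=
  gen_choiceMixin (place iota).

Section Jacobian.
Variables (k K : fieldType) (iota : {rmorphism k -> K}).

(* As k is algebraically closed, every place has degree 1, so the degree of a *)
(* divisor is the sum of its coefficients.                                    *)
Definition degree0 : {pred {freeg place iota}} := [pred D | deg D == 0].

Fact degree0_zmod_closed : zmod_closed degree0.
Proof.
split=> [|D E]; first by rewrite inE deg0.
by rewrite !inE degB => /eqP-> /eqP->; rewrite subrr.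
Qed.
HB.instance Definition _ :=
  GRing.isZmodClosed.Build {freeg place iota} degree0 degree0_zmod_closed.

Record divisor0 := Divisor0 {
  divisor :> {freeg place iota};
  divisor_degree0 : divisor \in degree0
}.
HB.instance Definition _ := [isSub for divisor].
HB.instance Definition _ := [Choice of divisor0 by <:].
HB.instance Definition _ := [SubChoice_isSubZmodule of divisor0 by <:].

Definition is_div (D : {freeg place iota}) (f : K) : Prop :=
  f != 0 /\ forall P : place iota, coeff P D = ord P f.

Definition principal : {pred divisor0} :=
  [pred D : divisor0 | `[< exists f, is_div D f >]].

Lemma ord_one (P : place iota) : ord P 1 = 0.
Proof. by rewrite -(rmorph1 iota) ord_const ?oner_neq0. Qed.

Fact principal_zmod_closed : zmod_closed principal.
Proof.
split=> [|D E]; rewrite !inE.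
  apply/asboolP; exists 1; split=> [|P]; first exact: oner_neq0.
  by rewrite -[divisor 0]/(val (0 : divisor0)) !raddf0 ord_one.
move=> /asboolP[f [f0 fD]] /asboolP[g [g0 gE]]; apply/asboolP.
exists (f / g); split=> [|P]; first by rewrite mulf_neq0 ?invr_eq0.
have gV0 : g^-1 != 0 by rewrite invr_eq0.
rewrite -[divisor _]/(val (D - E)) !raddfB /= fD gE ord_mul //; congr (_ + _).
by apply/esym/eqP; rewrite -addr_eq0 -ord_mul // mulVf // ord_one.
Qed.
HB.instance Definition _ :=
  GRing.isZmodClosed.Build divisor0 principal principal_zmod_closed.

Definition jacobian : zmodType := Quotient.quot principal.

End Jacobian.

Section Torsion.
Variables (A : zmodType) (n : nat).

Definition ntorsion : {pred A} := [pred a | a *+ n == 0].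

Fact ntorsion_zmod_closed : zmod_closed ntorsion.
Proof.
split=> [|a b]; rewrite !inE ?mul0rn //.
by rewrite mulrnBl => /eqP-> /eqP->; rewrite subrr.
Qed.
HB.instance Definition _ :=
  GRing.isZmodClosed.Build A ntorsion ntorsion_zmod_closed.

Record torsion := Torsion {
  torsion_val :> A;
  torsionP : torsion_val \in ntorsion
}.
HB.instance Definition _ := [isSub for torsion_val].
HB.instance Definition _ := [Choice of torsion by <:].
HB.instance Definition _ := [SubChoice_isSubZmodule of torsion by <:].

End Torsion.

(* F(x, y), where {poly {poly k}} stands for k[X][Y]: the coefficients of F   *)
(* are polynomials in the first coordinate X.                                 *)
Definition eval2 (k K : fieldType) (iota : {rmorphism k -> K}) (x y : K)
    (F : {poly {poly k}}) : K :=
  (map_poly (horner_eval x \o map_poly iota) F).[y].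

(* K is the field of fractions of k[X, Y] / (F), with x and y the classes of  *)
(* X and Y; since K is a field, this entails that (F) is prime.               *)
Definition is_function_field (k K : fieldType) (iota : {rmorphism k -> K})
    (x y : K) (F : {poly {poly k}}) : Prop :=
  (forall G, eval2 iota x y G = 0 <-> exists H, G = H * F) /\
  (forall z, exists G H,
     eval2 iota x y H != 0 /\ z = eval2 iota x y G / eval2 iota x y H).

(* The p-rank of the curve with affine equation F(x, y) = 0.  The function    *)
(* field is unique up to isomorphism; the first component of the conjunction  *)
(* says that it exists, that is, that the equation does define a curve.       *)
Definition has_p_rank (k : fieldType) (p : nat) (F : {poly {poly k}})
    (r : nat) : Prop :=
  (exists (K : fieldType) (iota : {rmorphism k -> K}) (x y : K),
     is_function_field iota x y F) /\
  (forall (K : fieldType) (iota : {rmorphism k -> K}) (x y : K),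
     is_function_field iota x y F ->
     exists phi : {additive torsion (jacobian iota) p -> 'rV['F_p]_r},
       bijective phi).

(* y ^ n - (x ^ m + 1) *)
Definition fermat_eq (k : fieldType) (n m : nat) : {poly {poly k}} :=
  'X^n - ('X^m + 1)%:P.

(* Main.v *)
Require Import Defs.
From mathcomp Require Import all_boot all_order all_algebra.
From HB Require Import structures.
From mathcomp Require Import separable cyclic falgebra fieldext generic_quotient.
From mathcomp Require Import boolp.
From mathcomp.multinomials Require Import freeg.
From mathcomp Require Import ring lra zify.

(** Put N = (p^h - 1) / 2, and let M = c N be the exponent of x, with c = 1 or 2;
    then p^h = 2 N + 1 = d M + 1 for d = 2 / c.  Over k of characteristic p, a
    divisor class killed by p is the class of some E with p E = div f.  The
    differential df/f has then no pole, since the order of f is everywhere a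
    multiple of p; it determines the class, and it is fixed by the Cartier
    operator C.  Conversely a regular differential fixed by C is df/f for some f,
    whose divisor is a multiple of p.  So J[p] has as many elements as there are
    regular differentials fixed by C ([log_class], [card_torsion]).

    On the curve y^N = x^M + 1 the regular differentials have the basis
    x^(i-1) y^(-s) dx, for 0 < i < c s and s < N ([regular_coords],
    [regular_monomial]).  Let l and m be the last base p digits of E = d i and
    n = 2 s; then p divides i + l M and s + m N, and x^(i-1) y^(-s) is a p-th power
    times x^(p-1-l M) (1 + x^M)^m.  Hence C maps the differential of index (i, s)
    to that of index (i / p mod M, s / p mod N), times the binomial coefficient m
    over l ([cartier_monomial]).  Since p^h - 1 = d M = 2 N, the
    map on the indices rotates the h digits of E and of n.  The orbit of a
    monomial avoids 0 exactly when E is dominated by n digit by digit; on the span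
    of these r monomials, C u = u is a cyclic system of equations
    a_m = mu_m a_(f m)^p, which has p^r solutions by separability
    ([card_frob_system]), and the other monomials do not occur in the solutions.
    Therefore J[p] is isomorphic to F_p^r.

    It remains to count the pairs 0 < E < n < p^h - 1 with d | E, 2 | n and E
    dominated by n ([card_good_pair]).  As p is odd, the parity of a number is
    that of the sum of its digits, so that the sums over dominated pairs of the
    signs (-1)^n and (-1)^E are h-th powers of sums over single digits: p (p+1)/2
    for the trivial signs, (p+1)/2 for the others.

    The function field K is used through its generators x, y over k.  At a point
    (a, b) of the affine curve the local ring has an explicit uniformizer, which
    gives existence and uniqueness of the place centered there
    ([centered_exists], [centered_uniq]); the places at infinity are those of the
    coordinates 1/x and y/x^c, which satisfy the same equation ([chart_inv]).
    The Cartier operator is defined by the expansion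
    z = w_0^p + w_1^p x + ... + w_(p-1)^p x^(p-1): it maps z dx to w_(p-1) dx.
    That its fixed points are the logarithmic differentials
    ([cartier_fixP]) follows from Jacobson's formula for (D + u)^p, where
    D = d/dx satisfies D^p = 0 and D^(p-1) z = - w_(p-1)^p. *)

Set Implicit Arguments.
Unset Strict Implicit.
Unset Printing Implicit Defensive.

Import Order.TTheory GRing.Theory Num.Theory.

(** * Digits in base p *)
Section Digits.
Variable p : nat.
Hypothesis p_gt0 : 0 < p.

(** The last of the h digits of n becomes the first one; this is the division
    by p modulo p^h - 1. *)
Definition rot_digits h n := n %% p * p ^ h.-1 + n %/ p.

(** For p prime and E and n below p^h, this says that the binomial coefficient
    C(n, E) is prime to p. *)
Fixpoint dominated h E n :=
  if h is h'.+1 then (E %% p <= n %% p) && dominated h' (E %/ p) (n %/ p) else true.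

Lemma dominatedP h E n :
  reflect (forall t, t < h -> (E %/ p ^ t) %% p <= (n %/ p ^ t) %% p) (dominated h E n).
Proof.
elim: h E n => [|h IH] E n /=; first by constructor.
apply: (iffP andP) => [[d0 /IH d1] [|t]| d].
- by rewrite expn0 !divn1.
- by rewrite ltnS expnS !divnMA => /d1.
split; first by have := d 0 isT; rewrite expn0 !divn1.
by apply/IH => t th; rewrite -!divnMA -expnS; exact: d.
Qed.

Lemma rot_digitsP h n : 0 < h -> p * rot_digits h n = n + n %% p * (p ^ h - 1).
Proof.
case: h => // h _; rewrite /rot_digits /= mulnDr mulnCA -expnS mulnBr muln1.
rewrite {3}(divn_eq n p) [_ * p]mulnC.
have : n %% p <= n %% p * p ^ h.+1 by rewrite leq_pmulr // expn_gt0 p_gt0.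
by move: (_ * p ^ _) (p * _); lia.
Qed.

Lemma iter_rot_digits h t n : t <= h -> n < p ^ h ->
  iter t (rot_digits h) n = n %/ p ^ t + (n %% p ^ t) * p ^ (h - t).
Proof.
move=> + nh; elim: t => [|t IH] th; first by rewrite expn0 divn1 modn1 addn0.
rewrite iterS IH ?(ltnW th) // /rot_digits.
have -> : h - t = (h - t.+1).+1 by lia.
set e := h - t.+1; set a := n %/ p ^ t; set b := n %% p ^ t.
have pt : 0 < p ^ t by rewrite expn_gt0 p_gt0.
have -> : n %/ p ^ t.+1 = a %/ p by rewrite expnSr divnMA.
have -> : n %% p ^ t.+1 = a %% p * p ^ t + b.
  rewrite [in LHS](divn_eq n (p ^ t)) -/a -/b {1}(divn_eq a p) mulnDl -mulnA -expnS.
  rewrite -addnA modnMDl modn_small //.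
  apply: (@leq_trans ((a %% p).+1 * p ^ t)).
    by rewrite mulSn addnC ltn_add2r ltn_mod.
  by rewrite expnS leq_mul2r ltn_mod p_gt0 orbT.
rewrite [a + _]addnC expnSr mulnA divnMDl // modnMDl mulnDl -mulnA -expnD.
rewrite (_ : t + e = h.-1); last by rewrite /e; lia.
by rewrite addnA addnC.
Qed.

Lemma iter_rot_digits_full h n : n < p ^ h -> iter h (rot_digits h) n = n.
Proof.
by move=> nh; rewrite iter_rot_digits // subnn expn0 muln1 divn_small ?modn_small.
Qed.

Lemma rot_digits_lt h n : 0 < h -> n < p ^ h -> rot_digits h n < p ^ h.
Proof.
case: h => // h _ nh; rewrite /rot_digits /=.
have : n %/ p < p ^ h by rewrite ltn_divLR // -expnSr.
have : (n %% p).+1 * p ^ h <= p ^ h.+1 by rewrite expnS leq_mul2r ltn_mod p_gt0 orbT.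
by rewrite mulSn => le1 lt1; apply: leq_trans le1; rewrite addnC ltn_add2r.
Qed.

Lemma rot_digits_inj h n n' : 0 < h -> n < p ^ h -> n' < p ^ h ->
  rot_digits h n = rot_digits h n' -> n = n'.
Proof.
move=> h0 nh nh' e; rewrite -(iter_rot_digits_full nh) -(iter_rot_digits_full nh').
by have := congr1 (iter h.-1 (rot_digits h)) e; rewrite -!iterSr prednK.
Qed.

Lemma iter_rot_digits_mod h t n : t < h -> n < p ^ h ->
  iter t (rot_digits h) n %% p = (n %/ p ^ t) %% p.
Proof.
move=> th nh; rewrite iter_rot_digits ?(ltnW th) // -(subnSK th) expnSr mulnA addnC.
by rewrite modnMDl.
Qed.

Lemma dominated_iter h E n : E < p ^ h -> n < p ^ h ->
  reflect (forall t, t < h -> iter t (rot_digits h) E %% p <= iter t (rot_digits h) n %% p)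
    (dominated h E n).
Proof.
move=> Eh nh; apply: (iffP (dominatedP h E n)) => d t th.
  by rewrite !iter_rot_digits_mod ?d.
by rewrite -!(iter_rot_digits_mod th) ?d.
Qed.

Lemma dominated_leq h E n : E < p ^ h -> dominated h E n -> E <= n.
Proof.
elim: h E n => [|h IH] E n /=; first by rewrite ltnS leqn0 => /eqP->.
rewrite expnSr -ltn_divLR // => /IH H /andP[d0 /H d1].
rewrite (divn_eq E p) (divn_eq n p); apply: leq_add => //.
by rewrite leq_mul2r d1 orbT.
Qed.

Lemma dominated0 h n : dominated h 0 n.
Proof. by apply/dominatedP => t _; rewrite div0n mod0n. Qed.

Lemma dominated_refl h n : dominated h n n.
Proof. exact/dominatedP. Qed.

Lemma dominated_max h E : dominated h E (p ^ h).-1.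
Proof.
elim: h E => // h IH E /=.
have ph : 0 < p ^ h by rewrite expn_gt0 p_gt0.
have -> : (p ^ h.+1).-1 = (p ^ h).-1 * p + p.-1.
  by rewrite expnSr -{1}(prednK ph) mulSn; lia.
have p1 : p.-1 < p by rewrite prednK.
rewrite modnMDl divnMDl // (divn_small p1) addn0 (modn_small p1).
by rewrite IH andbT -ltnS prednK // ltn_mod.
Qed.

End Digits.

(** * Counting dominated pairs *)
Section Count.
Local Open Scope ring_scope.
Variable p : nat.
Hypotheses (p_gt0 : (0 < p)%N) (p_odd : odd p).

Lemma sum_digits (F : nat -> rat) m :
  \sum_(n < m * p) F n = \sum_(b < m) \sum_(a < p) F (b * p + a)%N.
Proof.
elim: m => [|m IH]; first by rewrite mul0n !big_ord0.
rewrite big_ord_recr /= -IH -(big_mkord xpredT F) mulSn addnC.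
rewrite (big_cat_nat (n := (m * p)%N)) ?leq_addr //= big_mkord; congr (_ + _).
by rewrite -{1}[(m * p)%N]add0n big_addn addKn big_mkord; apply: eq_bigr => i _; rewrite addnC.
Qed.

Definition dominated_sum h (a b : rat) :=
  \sum_(n < p ^ h) \sum_(E < p ^ h) (dominated p h E n)%:R * (a ^+ n * b ^+ E).

Let signX (a : rat) n m : a ^+ 2 = 1 -> a ^+ (n * p + m) = a ^+ n * a ^+ m.
Proof.
move=> a2; rewrite exprD mulnC exprM; congr (_ ^+ _ * _).
by rewrite -[p]odd_double_half p_odd add1n exprS -mul2n exprM a2 expr1n mulr1.
Qed.

(** Domination is a condition on each digit, and a sign character of n is the
    product of the same character of its digits since p is odd. *)
Lemma dominated_sumE h a b : a ^+ 2 = 1 -> b ^+ 2 = 1 ->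
  dominated_sum h a b = (\sum_(n < p) a ^+ n * \sum_(E < n.+1) b ^+ E) ^+ h.
Proof.
move=> a2 b2; pose G n := \sum_(E < p) (E <= n)%:R * (a ^+ n * b ^+ E).
have -> : \sum_(n < p) a ^+ n * \sum_(E < n.+1) b ^+ E = \sum_(n < p) G n.
  apply: eq_bigr => n _; rewrite (big_ord_widen p (fun E => b ^+ E)) // big_mkcond mulr_sumr.
  by apply: eq_bigr => E _; rewrite ltnS; case: leqP => _; rewrite ?mul1r ?mul0r ?mulr0.
elim: h => [|h IH].
  by rewrite /dominated_sum expn0 !big_ord_recl !big_ord0 /= !expr0 !mulr1 !addr0.
pose T n E := (dominated p h.+1 E n)%:R * (a ^+ n * b ^+ E).
rewrite exprS -IH /dominated_sum expnSr (sum_digits (fun n => \sum_(E < p ^ h * p) T n E)).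
rewrite big_distrlr exchange_big /=.
apply: eq_bigr => n _; apply: eq_bigr => m _; rewrite (sum_digits (T _)) /T /=.
rewrite big_distrlr exchange_big /=; apply: eq_bigr => E _; apply: eq_bigr => F _.
rewrite !modnMDl !divnMDl // !(modn_small (ltn_ord _)) !(divn_small (ltn_ord _)) !addn0.
by rewrite !signX // -mulnb natrM; ring.
Qed.

(** For nontrivial signs, the digit 0 contributes 1 and so does each of the pairs
    of consecutive digits after it. *)
Lemma digit_sums (a b : rat) : (a, b) \in [:: (1, 1); (-1, 1); (1, -1); (-1, -1)] ->
  \sum_(n < p) a ^+ n * \sum_(E < n.+1) b ^+ E =
  (if (a == 1) && (b == 1) then p%:R else 1) * (p%:R + 1) / 2.
Proof.
have -> : p = (p./2).*2.+1 by rewrite -[LHS]odd_double_half p_odd.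
move: p./2 => m.
have even1 (c : rat) n : \sum_(E < n.*2.+1) c ^+ E = 1 + \sum_(E < n) (c ^+ E.*2.+1 + c ^+ E.*2.+2).
  elim: n => [|n IH]; first by rewrite big_ord_recl !big_ord0 expr0.
  by rewrite doubleS 2!big_ord_recr [in RHS]big_ord_recr /= IH !addrA.
have sm1 n : \sum_(E < n.*2.+1) (-1) ^+ E = 1 :> rat.
  rewrite even1 big1 ?addr0 // => E _.
  by rewrite !exprS -mul2n exprM sqrrN !expr1n; ring.
have sm2 n : \sum_(E < n.*2.+2) (-1) ^+ E = 0 :> rat.
  by rewrite big_ord_recr /= sm1 exprS -mul2n exprM sqrrN !expr1n; ring.
have s1 n : \sum_(E < n) 1 ^+ E = n%:R :> rat.
  by under eq_bigr do rewrite expr1n; rewrite sumr_const card_ord.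
have split (c d : rat) : \sum_(n < m.*2.+1) c ^+ n * \sum_(E < n.+1) d ^+ E =
  1 + \sum_(n < m) (c ^+ n.*2.+1 * \sum_(E < n.*2.+2) d ^+ E
                  + c ^+ n.*2.+2 * \sum_(E < n.+1.*2.+1) d ^+ E).
  elim: m => [|l IH]; first by rewrite !big_ord_recl !big_ord0 /= !expr0; ring.
  by rewrite doubleS 2!big_ord_recr IH [in RHS]big_ord_recr /= doubleS !addrA.
have signs n : (-1) ^+ n.*2.+1 = -1 :> rat /\ (-1) ^+ n.*2.+2 = 1 :> rat.
  by rewrite !exprS -mul2n exprM sqrrN !expr1n; split; ring.
rewrite !inE => /or4P[] /eqP[-> ->]; rewrite split.
- rewrite eqxx /=; under eq_bigr do rewrite !expr1n !s1 !mul1r.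
  elim: m {split} => [|l IH]; first by rewrite big_ord0 double0; field.
  by rewrite big_ord_recr /= addrA IH !doubleS -!muln2 -!natr1 !natrM; field.
- rewrite (_ : 1 == 1 = true) // (_ : -1 == 1 :> rat = false) // andFb.
  under eq_bigr do rewrite (signs _).1 (signs _).2 !s1.
  rewrite (eq_bigr (fun=> 1)) => [|n _]; last by rewrite doubleS -[_.+3%:R]natr1; ring.
  by rewrite sumr_const card_ord -muln2 -natr1 natrM; field.
- rewrite (_ : 1 == 1 = true) // (_ : -1 == 1 :> rat = false) // andbF.
  under eq_bigr do rewrite !expr1n sm1 sm2.
  rewrite (eq_bigr (fun=> 1)) => [|n _]; last by ring.
  by rewrite sumr_const card_ord -muln2 -natr1 natrM; field.
- rewrite (_ : -1 == 1 :> rat = false) // andFb.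
  under eq_bigr do rewrite (signs _).1 (signs _).2 sm1 sm2.
  rewrite (eq_bigr (fun=> 1)) => [|n _]; last by ring.
  by rewrite sumr_const card_ord -muln2 -natr1 natrM; field.
Qed.

(** The pairs of digit strings that index the monomial differentials on which
    the Cartier operator is invertible, for the curve with d M = p^h - 1 *)
Definition good_pair d h E n :=
  [&& d %| E, 2 %| n, dominated p h E n, 0 < E, E < n & n < (p ^ h).-1]%N.

Definition good_count d h := (\sum_(n < p ^ h) \sum_(E < p ^ h) good_pair d h E n)%N.

Variable h : nat.
Hypotheses (p_gt2 : (2 < p)%N) (h_gt0 : (0 < h)%N).
Let q := (p ^ h)%N.

Let q_odd : odd q. Proof. by rewrite oddX p_odd orbT. Qed.
Let q_gt2 : (2 < q)%N.
Proof. by apply: (leq_trans p_gt2); rewrite -{1}(expn1 p) leq_exp2l // ltnW. Qed.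

(** The boundary terms: an even n with 0 < n < p^h - 1 dominates two more
    numbers, 0 and n, while 0 dominates itself only and p^h - 1, all of whose
    digits are p - 1, dominates every E. *)
Lemma good_countE d : (d %| 2)%N ->
  (\sum_(n < q) \sum_(E < q) ([&& d %| E, 2 %| n & dominated p h E n] : nat) =
  good_count d h + (q - 2) + \sum_(E < q) (d %| E))%N.
Proof.
move=> d2; rewrite /good_count -/q.
have q1 : q = q.-1.+1 by rewrite prednK // expn_gt0 p_gt0.
have row (n : nat) : (n < q)%N -> (\sum_(E < q) ([&& d %| E, 2 %| n & dominated p h E n] : nat) =
  \sum_(E < q) (good_pair d h E n : nat)
  + (if n == 0 then 1 else if n == q.-1 then \sum_(E < q) (d %| E) else (2 %| n) * 2))%N.
  move=> nq; have [->|n0] := eqVneq n 0%N.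
    rewrite [X in (_ = X + _)%N]big1 ?add0n => [|E _]; last by rewrite /good_pair ltn0 !andbF.
    have q0 : (0 < q)%N by rewrite q1.
    rewrite (bigD1 (Ordinal q0)) //= dvdn0 dominated0 big1 // => E E0.
    case: dominated (@dominated_leq p p_gt0 h E 0 (ltn_ord E)); rewrite ?andbF // => /(_ isT).
    by rewrite leqn0 => /eqP e; case/eqP: E0; apply: val_inj.
  have [->|n1] := eqVneq n q.-1.
    rewrite [X in (_ = X + _)%N]big1 ?add0n => [|E _]; last by rewrite /good_pair ltnn !andbF.
    apply: eq_bigr => E _; rewrite dominated_max // andbT.
    suff -> : (2 %| q.-1)%N by rewrite andbT.
    by rewrite dvdn2 -[~~ _]/(odd q.-1.+1) -q1 q_odd.
  have [n2|n2] := boolP (2 %| n)%N; last first.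
    by rewrite !big1 // => E _; rewrite /good_pair ?(negPf n2) ?andbF.
  have delta m : (m < q)%N -> (\sum_(E < q) ((E == m :> nat) : nat) = 1)%N.
    move=> mq; rewrite (bigD1 (Ordinal mq)) //= eqxx big1 // => E.
    by rewrite -val_eqE /= => /negPf->.
  have -> : (true * 2 = \sum_(E < q) ((E == 0 :> nat) : nat) + \sum_(E < q) ((E == n :> nat) : nat))%N.
    by rewrite !delta // q1.
  rewrite -!big_split; apply: eq_bigr => E _ /=; rewrite /good_pair n2 /=.
  have [E0|E0] := eqVneq (E : nat) 0%N.
    by rewrite E0 dvdn0 dominated0 [0%N == n]eq_sym (negPf n0).
  have [En|En] := eqVneq (E : nat) n.
    by rewrite En ltnn !andbF dominated_refl (dvdn_trans d2 n2).
  have -> : (n < q.-1)%N by rewrite ltn_neqAle n1 -ltnS -q1.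
  rewrite lt0n E0 andbT ltn_neqAle En /= !addn0.
  by case: dominated (@dominated_leq p p_gt0 h E n (ltn_ord E)) => [->|]; rewrite ?andbF ?andbT.
rewrite (eq_bigr _ (fun (n : 'I_q) _ => row n (ltn_ord n))) big_split -addnA; congr (_ + _)%N.
have [m qE] : exists m, q = m.*2.+3.
  exists (q - 3)./2; have := odd_double_half (q - 3).
  by rewrite oddB // q_odd add0n => ->; move: q_gt2; lia.
pose rest n := (if n == 0 then 1 else if n == q.-1 then \sum_(E < q) (d %| E) else (2 %| n) * 2)%N.
rewrite -/(\sum_(n < q) rest n)%N.
have -> : (\sum_(n < q) rest n = \sum_(n < m.*2.+3) rest n)%N by rewrite qE.
rewrite big_ord_recr big_ord_recl /=; congr (_ + _)%N; last first.
  by rewrite /rest /= qE eqxx.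
rewrite (eq_bigr (fun i : 'I_(m.*2.+1) => (2 %| i.+1) * 2)%N) => [|i _]; last first.
  by rewrite /rest /= /bump /= add1n qE /= eqSS ltn_eqF.
rewrite /rest eqxx qE subn2 /= add1n; congr _.+1.
elim: m {qE} => [|m IH]; first by rewrite big_ord_recl big_ord0.
by rewrite doubleS 2!big_ord_recr /= IH !dvdn2 /= !negbK odd_double addn0 addn2.
Qed.

Lemma count_dvdn2 : (\sum_(E < q) (2 %| E : nat) = q./2.+1)%N.
Proof.
have H m : (\sum_(E < m.*2.+1) (2 %| E : nat) = m.+1)%N.
  elim: m => [|m IH]; first by rewrite big_ord_recl big_ord0.
  by rewrite doubleS 2!big_ord_recr /= IH !dvdn2 /= !negbK odd_double addn0 addn1.
by have := H q./2; rewrite (_ : q./2.*2.+1 = q) // -[RHS]odd_double_half q_odd.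
Qed.

(** The conditions of divisibility by 2 are detected by averaging over the signs
    a^n b^E with a, b = 1 or -1, as d is 1 or 2. *)
Lemma card_good_pair d : d = 1%N \/ d = 2%N ->
  (good_count d h)%:R =
  if d == 1%N then ((p%:R + 1) ^+ h * (p%:R ^+ h + 1)) / 2 ^+ (h + 1) - 2 * (p%:R ^+ h - 1)
  else ((p%:R + 1) ^+ h * (p%:R ^+ h + 3)) / 2 ^+ (h + 2)
            - 3 * (p%:R ^+ h - 1) / 2 :> rat.
Proof.
move=> d12.
have parity n : ((2 %| n) : nat)%:R = (1 + (-1) ^+ n) / 2 :> rat.
  by rewrite dvdn2 -signr_odd; case: odd => /=; rewrite ?expr1 ?expr0 ?mulr1n; field.
have ones : (1 : rat) ^+ 2 = 1 /\ (-1 : rat) ^+ 2 = 1 by split; ring.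
have S a b : (a, b) \in [:: (1, 1); (-1, 1); (1, -1); (-1, -1)] -> dominated_sum h a b =
  ((if (a == 1) && (b == 1) then p%:R else 1) * (p%:R + 1) / 2) ^+ h.
  move=> ab; rewrite dominated_sumE ?digit_sums //.
    by move: ab; rewrite !inE => /or4P[] /eqP[ea eb]; rewrite ?ea ?eb ?ones.1 ?ones.2.
  by move: ab; rewrite !inE => /or4P[] /eqP[ea eb]; rewrite ?ea ?eb ?ones.1 ?ones.2.
have Hq : q%:R = p%:R ^+ h :> rat by rewrite natrX.
have p2 : (2 : rat) ^+ h != 0 by rewrite expf_neq0.
have q2 : (q./2)%:R = (q%:R - 1) / 2 :> rat.
  by rewrite -[in RHS](odd_double_half q) q_odd add1n -muln2 -natr1 natrM; field.
have sE : ((q - 2)%:R : rat) = q%:R - 2 by rewrite natrB // ltnW.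
have one1 : (-1 == 1 :> rat) = false by [].
case: d12 => -> /=.
  have := congr1 (fun n => n%:R : rat) (good_countE (dvd1n 2)).
  have -> : (\sum_(E < q) (1 %| E))%N = q by rewrite (eq_bigr (fun=> 1%N)) ?sum1_card ?card_ord // => E _; rewrite dvd1n.
  rewrite !natrD sE natr_sum.
  have -> : \sum_(n < q) (\sum_(E < q) [&& 1 %| E, 2 %| n & dominated p h E n])%N%:R
     = (dominated_sum h 1 1 + dominated_sum h (-1) 1) / 2.
    rewrite -big_split mulr_suml; apply: eq_bigr => n _; rewrite natr_sum -big_split mulr_suml.
    apply: eq_bigr => E _ /=; rewrite dvd1n /= -mulnb natrM parity !expr1n; ring.
  rewrite !S ?inE ?eqxx ?orbT // one1 /= => e.
  rewrite -[LHS](addrK (q%:R - 2 + q%:R)) addrA -e Hq addn1 !mul1r !expr_div_n exprMn exprS.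
  by field; exact: p2.
have := congr1 (fun n => n%:R : rat) (good_countE (dvdnn 2)).
rewrite count_dvdn2 -[q./2.+1]addn1 !natrD sE q2 natr_sum.
have -> : \sum_(n < q) (\sum_(E < q) [&& 2 %| E, 2 %| n & dominated p h E n])%N%:R
   = (dominated_sum h 1 1 + dominated_sum h (-1) 1 + dominated_sum h 1 (-1) + dominated_sum h (-1) (-1)) / 4.
  rewrite -!big_split mulr_suml; apply: eq_bigr => n _; rewrite natr_sum -!big_split mulr_suml.
  by apply: eq_bigr => E _ /=; rewrite -!mulnb !natrM !parity !expr1n; field.
rewrite !S ?inE ?eqxx ?orbT // one1 /= => e.
rewrite -[LHS](addrK (q%:R - 2 + ((q%:R - 1) / 2 + 1))) addrA -e Hq addn2 !mul1r !expr_div_n exprMn !exprS.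
by field; exact: p2.
Qed.

End Count.

Local Open Scope ring_scope.

(** * Roots of separable polynomials *)

Lemma separable_roots (k : closedFieldType) (q : {poly k}) : q != 0 ->
  coprimep q q^`() ->
  exists s : seq k, [/\ uniq s, size s = (size q).-1, forall z, (z \in s) = root q z &
    q = lead_coef q *: \prod_(z <- s) ('X - z%:P)].
Proof.
move=> q0 sep; have [s qE] := closed_field_poly_normal q; exists s.
have lq : lead_coef q != 0 by rewrite lead_coef_eq0.
split=> //.
- rewrite -separable_prod_XsubC separable_poly.unlock.
  by move: sep; rewrite {1 2}qE derivZ coprimepZl // coprimepZr.
- by rewrite {1}qE size_scale // size_prod_XsubC.
- by move=> z; rewrite [in RHS]qE rootE hornerZ mulf_eq0 (negPf lq) /= -rootE root_prod_XsubC.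
Qed.

Lemma nth_roots (k : closedFieldType) (n : nat) (c : k) : n%:R != 0 :> k -> c != 0 ->
  exists s : seq k, [/\ uniq s, size s = n, forall z, (z \in s) = (z ^+ n == c) &
    'X^n - c%:P = \prod_(z <- s) ('X - z%:P)].
Proof.
move=> n0 c0; have n_gt0 : (0 < n)%N by rewrite lt0n; apply: contraNneq n0 => ->.
have sq : size ('X^n - c%:P) = n.+1 by rewrite size_XnsubC.
have q0 : 'X^n - c%:P != 0 :> {poly k} by rewrite -size_poly_gt0 sq.
have [|s [us ss rs qE]] := @separable_roots k ('X^n - c%:P) q0.
  rewrite derivB derivXn derivC subr0 -scaler_nat coprimepZr //.
  apply: coprimep_expr; rewrite coprimepX rootE !hornerE expr0n gtn_eqF //.
  by rewrite add0r oppr_eq0.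
exists s; split=> //; first by rewrite ss sq.
  by move=> z; rewrite rs rootE !hornerE subr_eq0.
rewrite {1}qE.
suff -> : lead_coef ('X^n - c%:P) = 1 by rewrite scale1r.
by rewrite lead_coefE sq coefB coefXn coefC eqxx gtn_eqF // subr0.
Qed.

Lemma frobenius_fixed (k : closedFieldType) (p e : nat) (mu : k) :
  p \in [pchar k] -> (0 < e)%N -> mu != 0 ->
  exists s : seq k, [/\ uniq s, size s = (p ^ e)%N &
    forall z, (z \in s) = (z == mu * z ^+ (p ^ e))].
Proof.
move=> chp e0 mu0; have p_gt1 := prime_gt1 (pcharf_prime chp).
have pe : (1 < p ^ e)%N by rewrite -{1}(exp1n e) ltn_exp2r.
pose q : {poly k} := mu *: 'X^(p ^ e) - 'X.
have sq : size q = (p ^ e).+1.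
  by rewrite size_polyDl ?size_scale ?size_polyXn // size_polyN size_polyX.
have q0 : q != 0 by rewrite -size_poly_gt0 sq.
have [|s [us ss rs _]] := @separable_roots k q q0.
  rewrite derivB derivZ derivXn derivX -mulr_natr -polyC_natr.
  have -> : (p ^ e)%:R = 0 :> k.
    by apply/eqP; rewrite -(dvdn_pcharf chp) dvdn_exp.
  rewrite mulr0 scaler0 sub0r -scaleN1r coprimepZr ?oppr_eq0 ?oner_eq0 //.
  exact: coprimep1.
exists s; split=> //; first by rewrite ss sq.
by move=> z; rewrite rs rootE !hornerE subr_eq0 eq_sym.
Qed.

(** * Counting the solutions of a cyclic Frobenius system *)
Section FrobeniusSystem.
Variables (k : closedFieldType) (p : nat) (T : finType).
Hypothesis chp : p \in [pchar k].

Definition frob_system (A : seq T) (f : T -> T) (e : T -> nat) (mu : T -> k)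
  (c : {ffun T -> k}) :=
  (forall m, m \in A -> c m = mu m * c (f m) ^+ (p ^ e m)) /\
  (forall m, m \notin A -> c m = 0).

(** A system that permutes its unknowns has as many solutions as if each
    equation were z = mu z^(p^e), which has p^e solutions by separability.  An
    unknown m with f m != m is eliminated by substitution, which adds the
    exponent of m to that of its predecessor; this is why the exponents are
    allowed to vary. *)
Lemma card_frob_system A f e mu :
  uniq A -> {in A, forall m, f m \in A} -> {in A &, injective f} ->
  {in A, forall m, (0 < e m)%N} -> {in A, forall m, mu m != 0} ->
  exists s : seq {ffun T -> k}, [/\ uniq s, size s = (p ^ (\sum_(m <- A) e m))%N &
    forall c, c \in s <-> frob_system A f e mu c].
Proof.
elim: A f e mu => [|m A IH] f e mu /=.
  move=> _ _ _ _ _; exists [:: [ffun=> 0]]; split=> //; first by rewrite big_nil.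
  move=> c; rewrite inE; split=> [/eqP-> | [_ c0]].
    by split=> // m _; rewrite ffunE.
  by apply/eqP/ffunP => m; rewrite ffunE c0.
case/andP=> mA uA fA finj e_gt0 mu0.
have mm : m \in m :: A by rewrite inE eqxx.
have inA x : x \in A -> x \in m :: A by rewrite inE orbC => ->.
have nem x : x \in A -> x != m by move=> xA; apply: contraNneq mA => <-.
have [fm|fm] := eqVneq (f m) m.
  have fA' x : x \in A -> f x \in A.
    move=> xA; have := fA _ (inA _ xA); rewrite inE => /orP[/eqP e1|//].
    by case/eqP: (nem _ xA); apply: (finj) => //; [exact: inA | rewrite fm].
  have [|||s [us ss solS]] := IH f e mu uA fA'.
  - by move=> x y xA yA; apply: finj; exact: inA.
  - by move=> x xA; apply: e_gt0; exact: inA.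
  - by move=> x xA; apply: mu0; exact: inA.
  have [rs [urs srs mrs]] := frobenius_fixed chp (e_gt0 m mm) (mu0 m mm).
  pose upd (c : {ffun T -> k}) z := [ffun x => if x == m then z else c x].
  exists [seq upd c z | c <- s, z <- rs]; split.
  - apply: allpairs_uniq => // -[c z] [c' z'] /=.
    move=> /allpairsP[[c1 z1] /= [c1s _ [-> ->]]] /allpairsP[[c2 z2] /= [c2s _ [-> ->]]] eq_upd.
    have ez : z1 = z2 by have /ffunP/(_ m) := eq_upd; rewrite !ffunE eqxx.
    congr (_, _) => //; apply/ffunP => x.
    have [->|xm] := eqVneq x m; last by have /ffunP/(_ x) := eq_upd; rewrite !ffunE (negPf xm).
    by rewrite (proj2 ((solS c1).1 c1s)) // (proj2 ((solS c2).1 c2s)).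
  - by rewrite size_allpairs ss srs big_cons expnD mulnC.
  move=> c; split.
    move=> /allpairsP[[c1 z] /= [/solS[c1A c10] zr ->]].
    split=> x; rewrite inE !ffunE.
      have [-> _|xm /= xA] := eqVneq x m.
        by move: zr; rewrite mrs fm eqxx => /eqP.
      by rewrite (negPf (nem _ (fA' _ xA))) c1A.
    by rewrite negb_or => /andP[/negPf-> /c10].
  move=> [cA c0]; apply/allpairsP; exists ([ffun x => if x == m then 0 else c x], c m).
  split=> /=.
  - apply/solS; split=> x xA; rewrite !ffunE.
      by rewrite (negPf (nem _ xA)) (negPf (nem _ (fA' _ xA))) cA // inA.
    by case: eqVneq => // xm; rewrite c0 // inE negb_or xm.
  - by rewrite mrs -{3}fm -cA.
  - by apply/ffunP => x; rewrite !ffunE; case: eqVneq => // ->.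
have fmA : f m \in A by have := fA _ mm; rewrite inE (negPf fm).
pose f' x := if f x == m then f m else f x.
pose e' x := (e x + (f x == m) * e m)%N.
pose mu' x := if f x == m then mu x * mu m ^+ (p ^ e x) else mu x.
have fA' x : x \in A -> f' x \in A.
  move=> xA; rewrite /f'; case: eqVneq => // fx.
  by have := fA _ (inA _ xA); rewrite inE (negPf fx).
have [|||s [us ss solS]] := IH f' e' mu' uA fA'.
- move=> x y xA yA; rewrite /f'.
  case: eqVneq => fx; case: eqVneq => fy.
  + by move=> _; apply: finj; rewrite ?inA // fx fy.
  + move/finj => -/(_ mm (inA _ yA)) ym; by case/eqP: (nem _ yA).
  + move/finj => -/(_ (inA _ xA) mm) xm; by case/eqP: (nem _ xA).
  + by apply: finj; exact: inA.
- by move=> x xA; rewrite addn_gt0 e_gt0 ?inA.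
- move=> x xA; rewrite /mu'; case: (f x == m); last by rewrite mu0 ?inA.
  by apply: mulf_neq0; [|apply: expf_neq0]; apply: mu0 => //; exact: inA.
(* The exponent e m is added to exactly one other, as f permutes m :: A. *)
have se : (\sum_(x <- A) e' x = \sum_(x <- m :: A) e x)%N.
  rewrite big_cons big_split /= addnC; congr (_ + _)%N.
  rewrite -big_distrl /= -[RHS]mul1n; congr (_ * _)%N.
  have : perm_eq (map f (m :: A)) (m :: A).
    apply: uniq_perm; rewrite ?map_inj_in_uniq //= ?mA //.
    move=> x; have := uniq_min_size (s1 := map f (m :: A)) (s2 := m :: A).
    rewrite map_inj_in_uniq //= mA uA size_map => /(_ isT).
    case=> // y /= yA; have /mapP[x' x'A ->] : y \in map f (m :: A) by [].
    exact: fA.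
  move/permP/(_ (pred1 m)); rewrite /= (negPf fm) eqxx add0n count_map.
  rewrite (count_memPn mA) addn0 => H; rewrite -[RHS]H -sum1_count [RHS]big_mkcond.
  by apply: eq_bigr => x _ /=; case: (f x == m).
pose ext (c : {ffun T -> k}) := [ffun x => if x == m then mu m * c (f m) ^+ (p ^ e m) else c x].
exists (map ext s); split.
- rewrite map_inj_in_uniq // => c1 c2 /solS[_ c1A] /solS[_ c2A] /ffunP eq_ext.
  apply/ffunP => x; have [->|xm] := eqVneq x m; first by rewrite c1A ?c2A.
  by have := eq_ext x; rewrite !ffunE (negPf xm).
- by rewrite size_map ss se.
move=> c; split.
  move=> /mapP[c1 /solS[c1A c10] ->]; split=> x; rewrite inE !ffunE.
    have [-> _|xm /= xA] := eqVneq x m; first by rewrite (negPf fm).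
    rewrite c1A // /mu' /f' /e'; case: eqVneq => [fx|fx] /=; last by rewrite mul0n addn0.
    by rewrite mul1n exprMn -exprM -expnD addnC mulrA.
  by rewrite negb_or => /andP[/negPf-> /c10].
move=> [cA c0]; apply/mapP; exists [ffun x => if x == m then 0 else c x].
  apply/solS; split=> x xA; rewrite !ffunE.
    rewrite (negPf (nem _ xA)) (negPf (nem _ (fA' _ xA))) cA ?inA //.
    rewrite /mu' /f' /e'; case: eqVneq => [fx|fx] /=; last by rewrite mul0n addn0.
    by rewrite fx cA // mul1n exprMn -exprM -expnD addnC mulrA.
  by case: eqVneq => // xm; rewrite c0 // inE negb_or xm.
apply/ffunP => x; rewrite !ffunE (negPf fm).
by have [->|//] := eqVneq x m; exact: cA.
Qed.

End FrobeniusSystem.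

(** * Elementary abelian groups *)

(** A group of exponent p and order p^r is isomorphic to F_p^r: a linear
    injection of F_p^n extends to F_p^(n+1) as long as it misses an element. *)
Lemma elementary_abelian (p r : nat) (A : zmodType) (s : seq A) : prime p ->
  (forall a : A, a *+ p = 0) -> uniq s -> size s = (p ^ r)%N -> (forall a, a \in s) ->
  exists phi : {additive A -> 'rV['F_p]_r}, bijective phi.
Proof.
move=> p_pr pA us ss As.
have natA (a : A) n : a *+ (n %% p) = a *+ n.
  by rewrite [in RHS](divn_eq n p) mulrnDr mulnC mulrnA pA mul0rn add0r.
have natF (a : A) n : a *+ (n %% (Zp_trunc (pdiv p)).+2) = a *+ n.
  by rewrite Fp_cast // natA.
have ext n : (n <= r)%N -> exists2 psi : 'rV['F_p]_n -> A,
    {morph psi : u v / u + v} & injective psi.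
  elim: n => [_|n IH nr].
    exists (fun=> 0) => [u v|u v _]; first by rewrite addr0.
    by apply/matrixP => i [].
  have [psi psiD psi_inj] := IH (ltnW nr).
  have [a Na] : exists a, a \notin codom psi.
    apply: contrapT => /forallNP H.
    have : (size s <= size (codom psi))%N.
      by apply: uniq_leq_size => // x _; have /negP := H x; rewrite negbK.
    rewrite ss size_codom card_mx mul1n card_Fp // leqNgt ltn_exp2l //.
      by rewrite nr.
    exact: prime_gt1.
  have psi0 : psi 0 = 0 by apply: (addrI (psi 0)); rewrite -psiD !addr0.
  have psiN u : psi (- u) = - psi u.
    by apply/eqP; rewrite -addr_eq0 -psiD addNr psi0.
  (* Send the new basis vector to an element a missed by psi. *)
  pose psi' (v : 'rV['F_p]_(1 + n)) := psi (rsubmx v) + a *+ (v 0 0 : nat).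
  have psi'D : {morph psi' : u v / u + v}.
    move=> u v; rewrite /psi' linearD psiD addrACA -mulrnDr; congr (_ + _).
    by rewrite !mxE /= natF.
  exists psi' => // u v /eqP; rewrite -subr_eq0 => /eqP uv.
  apply/eqP; rewrite -subr_eq0; apply/eqP; move: uv.
  have -> : psi' u - psi' v = psi' (u - v).
    by apply/eqP; rewrite subr_eq -psi'D subrK.
  move: (u - v) => {u}v; pose w := rsubmx (v : 'rV_(1 + n)).
  rewrite /psi' -/w => e0.
  have [v0|v0] := eqVneq (v 0 0) 0.
    move: e0; rewrite v0 mulr0n addr0 -psi0 => /psi_inj rv.
    apply/rowP => i; rewrite mxE; case: (split_ordP (i : 'I_(1 + n))) => j ->.
      by rewrite ord1 -[RHS]v0; congr (v _ _); apply: val_inj.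
    by have /rowP/(_ j) := rv; rewrite !mxE.
  (* A relation with v 0 0 != 0 would put a in the image of psi. *)
  case/negP: Na; apply/codomP; exists (- w *+ ((v 0 0)^-1 : 'F_p)).
  have psiMn u m : psi (u *+ m) = psi u *+ m.
    by elim: m => [|m IHm]; rewrite ?mulr0n // !mulrS psiD IHm.
  have -> : psi (- w *+ ((v 0 0)^-1 : 'F_p)) = a *+ ((v 0 0 * (v 0 0)^-1)%R : 'F_p).
    rewrite psiMn psiN /= natF mulrnA; congr (_ *+ _).
    by apply/eqP; rewrite eq_sym -addr_eq0 addrC e0.
  by rewrite mulfV //= natF mulr1n.
have [psi psiD psi_inj] := ext r (leqnn r).
have surj a : exists u, psi u = a.
  have : a \in codom psi.
    have := uniq_min_size (s1 := codom psi) (s2 := s).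
    case=> [|x _||_ ->]; [by rewrite map_inj_uniq ?enum_uniq|exact: As| |exact: As].
    by rewrite ss size_codom card_mx mul1n card_Fp.
  by case/codomP => u ->; exists u.
have [phi phiK] := choice surj.
have psiK : cancel psi phi by move=> u; apply: psi_inj.
have phiB : zmod_morphism phi.
  move=> a b; apply: psi_inj; apply/eqP; rewrite phiK subr_eq.
  by rewrite -[X in _ == _ + X]phiK -psiD subrK phiK.
pose phiM := GRing.isZmodMorphism.Build _ _ phi phiB.
pose phiA : {additive A -> 'rV['F_p]_r} := HB.pack phi phiM.
by exists phiA; exists psi.
Qed.

(** * Valuations *)
Section Valuation.
Variables (k K : fieldType) (iota : {rmorphism k -> K}).
Implicit Types (P : place iota) (z w : K) (n m : int).

Lemma place_eq P P' : (forall z, P z = P' z) -> P = P'.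
Proof.
case: P P' => o z m a c u [o' z' m' a' c' u'] /= /funext e.
by rewrite {o}e in z m a c u *; congr Place; exact: Prop_irrelevance.
Qed.

Lemma ord_1 P : P 1 = 0.
Proof. exact: ord_one. Qed.

Lemma ordV P z : P z^-1 = - P z.
Proof.
have [->|z0] := eqVneq z 0; first by rewrite invr0 ord_zero oppr0.
by apply/eqP; rewrite -addr_eq0 -ord_mul ?invr_eq0 // mulVf // ord_1.
Qed.

Lemma ordX P z (n : nat) : P (z ^+ n) = P z *+ n.
Proof.
have [->|z0] := eqVneq z 0.
  by case: n => [|n]; [rewrite expr0 ord_1 | rewrite exprS mul0r ord_zero mul0rn].
elim: n => [|n IH]; first by rewrite expr0 ord_1 mulr0n.
by rewrite exprS ord_mul ?expf_neq0 // IH mulrS.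
Qed.

Lemma ordXz P z n : P (z ^ n) = P z * n.
Proof.
case: n => n; first by rewrite -exprnP ordX -mulr_natr natz.
by rewrite NegzE -exprnN ordV ordX mulrN -mulr_natr natz.
Qed.

Lemma ord_div P z w : z != 0 -> w != 0 -> P (z / w) = P z - P w.
Proof. by move=> z0 w0; rewrite ord_mul ?invr_eq0 // ordV. Qed.

Lemma ordN P z : P (- z) = P z.
Proof.
have [->|z0] := eqVneq z 0; first by rewrite oppr0.
rewrite -mulN1r ord_mul ?oppr_eq0 ?oner_neq0 //.
have -> : -1 = iota (-1) :> K by rewrite rmorphN1.
by rewrite ord_const ?oppr_eq0 ?oner_neq0 // add0r.
Qed.

(** [reg P n z] says that the order of z at P is at least n, with the order of
    0 read as infinite; [ord] itself has a dummy value at 0. *)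
Definition reg P n z := (z == 0) || (n <= P z).

Lemma reg0 P n : reg P n 0.
Proof. by rewrite /reg eqxx. Qed.

Lemma regE P n z : z != 0 -> reg P n z = (n <= P z).
Proof. by rewrite /reg => /negPf->. Qed.

Lemma reg_le P n m z : m <= n -> reg P n z -> reg P m z.
Proof.
by move=> le_mn /orP[z0|/(le_trans le_mn) H]; rewrite /reg ?z0 ?H ?orbT.
Qed.

Lemma regN P n z : reg P n (- z) = reg P n z.
Proof. by rewrite /reg oppr_eq0 ordN. Qed.

Lemma regD P n z w : reg P n z -> reg P n w -> reg P n (z + w).
Proof.
have [->|z0] := eqVneq z 0; first by rewrite add0r.
have [->|w0] := eqVneq w 0; first by rewrite addr0.
rewrite (regE _ _ z0) (regE _ _ w0) => Hz Hw; rewrite /reg; have [//|/= zw0] := eqVneq (z + w) 0.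
by apply: le_trans (ord_add P z0 w0 zw0); rewrite le_min Hz Hw.
Qed.

Lemma regB P n z w : reg P n z -> reg P n w -> reg P n (z - w).
Proof. by move=> Hz Hw; rewrite regD ?regN. Qed.

Lemma regM P n m z w : reg P n z -> reg P m w -> reg P (n + m) (z * w).
Proof.
have [->|z0] := eqVneq z 0; first by rewrite mul0r => *; exact: reg0.
have [->|w0] := eqVneq w 0; first by rewrite mulr0 => *; exact: reg0.
rewrite !regE ?mulf_neq0 // ord_mul //; exact: lerD.
Qed.

Lemma reg0M P z w : reg P 0 z -> reg P 0 w -> reg P 0 (z * w).
Proof. by move=> Hz Hw; rewrite -[0]addr0; exact: regM. Qed.

Lemma reg_sum P n (I : Type) (r : seq I) (Q : pred I) (F : I -> K) :
  (forall i, Q i -> reg P n (F i)) -> reg P n (\sum_(i <- r | Q i) F i).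
Proof. by move=> H; apply: (big_ind (fun z => reg P n z)) => // [|z w]; [exact: reg0 | exact: regD]. Qed.

Lemma reg_iota P (c : k) : reg P 0 (iota c).
Proof.
have [->|c0] := eqVneq c 0; first by rewrite rmorph0 reg0.
by rewrite /reg ord_const // lexx orbT.
Qed.

Lemma regX P n z (m : nat) : reg P n z -> reg P (n *+ m) (z ^+ m).
Proof.
move=> Hz; elim: m => [|m IH]; first by rewrite expr0 mulr0n -(rmorph1 iota) reg_iota.
by rewrite exprS mulrS regM.
Qed.

Lemma reg0X P z (m : nat) : reg P 0 z -> reg P 0 (z ^+ m).
Proof. by move=> /(@regX P 0 z m); rewrite mul0rn. Qed.

Lemma reg1 P : reg P 0 1.
Proof. by rewrite -(rmorph1 iota) reg_iota. Qed.

Lemma reg_nat P n z (m : nat) : reg P n z -> reg P n (z *+ m).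
Proof.
move=> Hz; elim: m => [|m IH]; first by rewrite mulr0n reg0.
by rewrite mulrS regD.
Qed.

(** Adding a term of higher order does not change the order. *)
Lemma ord_dominant P z w : z != 0 -> reg P (P z + 1) w ->
  z + w != 0 /\ P (z + w) = P z.
Proof.
move=> z0 Hw.
have Nr : ~~ reg P (P z + 1) (z + w).
  apply/negP => /regB /(_ Hw); rewrite addrK regE //.
  by move: (P z) => n; lia.
have zw0 : z + w != 0 by apply: contraNneq Nr => ->; rewrite reg0.
split=> //; move: Nr; rewrite regE // => Nr.
have : reg P (P z) (z + w).
  by apply: regD; [rewrite regE | apply: reg_le Hw; lia].
by rewrite regE //; move: (P z) (P _) Nr => n m; lia.
Qed.

Lemma ord_unit P (c : k) w : c != 0 -> reg P 1 (w - iota c) ->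
  w != 0 /\ P w = 0.
Proof.
move=> c0 Hw; have := @ord_dominant P (iota c) (w - iota c).
rewrite fmorph_eq0 ord_const // addrCA subrr addr0 add0r.
by apply.
Qed.

Lemma const_reg1 P (c : k) : reg P 1 (iota c) -> c = 0.
Proof.
by move=> H; apply: contraTeq H => c0; rewrite regE ?fmorph_eq0 // ord_const.
Qed.

End Valuation.

(** * Sums of terms of distinct orders *)
Lemma eq_residue (p a b : nat) (x y : int) : (a < p)%N -> (b < p)%N ->
  x *+ p + a%:Z = y *+ p + b%:Z -> a = b.
Proof.
rewrite -mulr_natr -[y *+ p]mulr_natr natz => la lb e.
have e1 : a%:Z - b%:Z = (y - x) * p%:Z.
  by rewrite mulrBl; apply/eqP; rewrite subr_eq addrAC -e addrAC subrr add0r.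
have e2 : `|a%:Z - b%:Z|%N = (`|y - x| * p)%N by rewrite e1 abszM.
have lt_abs : (`|a%:Z - b%:Z|%N < p)%N by lia.
have : `|a%:Z - b%:Z|%N = 0%N.
  by move: lt_abs; rewrite e2; case: `|y - x|%N => // n; rewrite mulSn ltnNge leq_addr.
by move/eqP; rewrite absz_eq0 subr_eq0 eqz_nat => /eqP.
Qed.

Section PowerBasis.
Variables (k K : fieldType) (iota : {rmorphism k -> K}) (p : nat).
Variables (P : place iota) (t : K) (f : nat -> K).
Hypotheses (p_gt0 : (0 < p)%N) (ord_t : P t = 1).

Let z := \sum_(i < p) f i ^+ p * t ^+ i.

Let t0 : t != 0.
Proof. by apply: contra_eq_neq ord_t => ->; rewrite ord_zero. Qed.

Let ord_term i : f i != 0 -> P (f i ^+ p * t ^+ i) = P (f i) *+ p + i%:Z.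
Proof. by move=> fi; rewrite ord_mul ?expf_neq0 // !ordX ord_t natz. Qed.

(** The orders of the nonzero terms are distinct modulo p, hence the sum has
    the least of them as its order. *)
Lemma power_basis_min (i0 : 'I_p) : f i0 != 0 -> z != 0 /\ exists2 i : 'I_p, f i != 0 &
  P z = P (f i) *+ p + i%:Z /\ forall j : 'I_p, reg P (P z) (f j ^+ p * t ^+ j) /\
  (j != i -> reg P (P z + 1) (f j ^+ p * t ^+ j)).
Proof.
move=> fi0; pose o (i : 'I_p) := P (f i) *+ p + i%:Z.
have [i fi min_i] := @Order.TotalTheory.arg_minP _ _ _ i0 (fun i : 'I_p => f i != 0) o fi0.
have Hj (j : 'I_p) : j != i -> reg P (o i + 1) (f j ^+ p * t ^+ j).
  move=> ji; have [fj|fj] := eqVneq (f j) 0.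
    by rewrite fj expr0n gtn_eqF // mul0r reg0.
  rewrite regE ?mulf_neq0 ?expf_neq0 // ord_term //.
  have := min_i j fj; rewrite /o le_eqVlt => /orP[/eqP e|]; last first.
    by move: (P (f i) *+ p) (P (f j) *+ p) => a b; lia.
  case/eqP: ji; apply: val_inj; apply: (eq_residue (ltn_ord j) (ltn_ord i)).
  exact: esym e.
have zE : z = f i ^+ p * t ^+ i + \sum_(j < p | j != i) f j ^+ p * t ^+ j.
  by rewrite /z (bigD1 i).
have ti : f i ^+ p * t ^+ i != 0 by rewrite mulf_neq0 ?expf_neq0.
have ri : reg P (P (f i ^+ p * t ^+ i) + 1) (\sum_(j < p | j != i) f j ^+ p * t ^+ j).
  by rewrite ord_term //; apply: reg_sum => j ji; exact: Hj.
have [z0 oi] := ord_dominant ti ri; rewrite -zE ord_term // in z0 oi.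
split=> //; exists i => //; split=> // j; rewrite oi; split; last exact: Hj.
have [->|ji] := eqVneq j i; last by apply: reg_le (Hj j ji); rewrite lerDl.
by rewrite regE // ord_term.
Qed.

Let coord_neq0 : z != 0 -> exists i : 'I_p, f i != 0.
Proof.
move=> z0; apply: contrapT => /forallNP H; case/eqP: z0; rewrite /z big1 // => i _.
by have /negP := H i; rewrite negbK => /eqP->; rewrite expr0n gtn_eqF // mul0r.
Qed.

Let dz := \sum_(i < p) (f i ^+ p * t ^+ i.-1) *+ i.

Let dterm i n : reg P n (f i ^+ p * t ^+ i) ->
  reg P (n - 1) ((f i ^+ p * t ^+ i.-1) *+ i).
Proof.
case: i => [|i] H; first by rewrite mulr0n reg0.
apply: reg_nat => /=.
have -> : f i.+1 ^+ p * t ^+ i = (f i.+1 ^+ p * t ^+ i.+1) * t^-1.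
  by rewrite exprSr mulrA mulfK.
by apply: regM => //; rewrite regE ?invr_eq0 // ordV ord_t.
Qed.

(** Differentiating with respect to a uniformizer kills the leading term when
    the order is a multiple of p. *)
Lemma reg_deriv : z != 0 -> (p %| P z)%Z -> reg P (P z) dz.
Proof.
move=> z0 pz; have [i0 /power_basis_min[_ [i fi [oz H]]]] := coord_neq0 z0.
have i_0 : nat_of_ord i = 0%N.
  move: pz; rewrite oz -mulr_natr natz rpredDl ?dvdz_mull // dvdzE /=.
  by case: (nat_of_ord i) (ltn_ord i) => // n ltn /dvdn_leq -/(_ isT); rewrite leqNgt ltn.
apply: reg_sum => j _; have [ji|ji] := eqVneq j i.
  by rewrite ji i_0 mulr0n reg0.
rewrite -[P z](addrK 1); apply: dterm; exact: (H j).2.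
Qed.

(** Otherwise the leading term survives and the order drops by exactly one. *)
Lemma ord_deriv : p \in [pchar K] -> z != 0 -> ~~ (p %| P z)%Z ->
  dz != 0 /\ P dz = P z - 1.
Proof.
move=> chp z0 pz; have [i1 /power_basis_min[_ [i fi [oz H]]]] := coord_neq0 z0.
have i0 : (0 < i)%N.
  rewrite lt0n; apply: contra pz => /eqP i0.
  by rewrite oz i0 addr0 -mulr_natr natz dvdz_mull.
have iK : i%:R != 0 :> K.
  rewrite -(dvdn_pcharf chp); apply/negP => /(dvdn_leq i0).
  by rewrite leqNgt ltn_ord.
rewrite /dz (bigD1 i) //=.
have eti : (f i ^+ p * t ^+ i.-1) *+ i = i%:R * (f i ^+ p * t ^+ i.-1) by rewrite mulr_natl.
have ti : (f i ^+ p * t ^+ i.-1) *+ i != 0 by rewrite eti !mulf_neq0 ?expf_neq0.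
have oti : P ((f i ^+ p * t ^+ i.-1) *+ i) = P z - 1.
  rewrite eti ord_mul ?mulf_neq0 ?expf_neq0 //.
  have -> : P i%:R = 0.
    by rewrite -(rmorph_nat iota) ord_const // -(fmorph_eq0 iota) rmorph_nat.
  rewrite add0r ord_mul ?expf_neq0 // !ordX ord_t natz oz.
  by move: i0 (P (f i) *+ p) => i0 a; lia.
rewrite -oti; apply: ord_dominant => //.
apply: reg_sum => j ji; rewrite oti subrK -[P z](addrK 1).
by apply: dterm; exact: (H j).2.
Qed.

End PowerBasis.

(** * Derivations in characteristic p *)

Definition derivation (K : pzRingType) (D : K -> K) :=
  {morph D : z w / z + w} /\ forall z w, D (z * w) = D z * w + z * D w.

Section Derivation.
Variables (K : fieldType) (D : K -> K).
Hypothesis HD : derivation D.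
Let DD := HD.1.
Let DM := HD.2.

Lemma der0 : D 0 = 0.
Proof. by apply: (addrI (D 0)); rewrite -DD !addr0. Qed.

Lemma der1 : D 1 = 0.
Proof. by apply: (addrI (D 1)); rewrite addr0 -{3}[1]mulr1 DM mulr1 mul1r. Qed.

Lemma derN z : D (- z) = - D z.
Proof. by apply/eqP; rewrite -addr_eq0 -DD addNr der0. Qed.

Lemma der_sum (I : Type) (r : seq I) (Q : pred I) (F : I -> K) :
  D (\sum_(i <- r | Q i) F i) = \sum_(i <- r | Q i) D (F i).
Proof. exact: (big_morph D DD der0). Qed.

Lemma derX z n : D (z ^+ n) = (z ^+ n.-1 * D z) *+ n.
Proof.
case: n => [|n]; first by rewrite expr0 der1 mulr0n.
elim: n => [|n IH]; first by rewrite expr1 expr0 mul1r.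
by rewrite exprS DM IH /= mulrnAr mulrA -exprS [D z * _]mulrC -mulrS.
Qed.

Lemma derV z : z != 0 -> D z^-1 = - (D z / z ^+ 2).
Proof.
move=> z0; have := DM z z^-1; rewrite mulfV // der1.
move/esym/eqP; rewrite addrC addr_eq0 => /eqP e.
by apply: (mulfI z0); rewrite e; field.
Qed.

Variable p : nat.
Hypothesis chp : p \in [pchar K].

Lemma der_pth z : D (z ^+ p) = 0.
Proof. by rewrite derX -mulr_natr (pcharf0 chp) mulr0. Qed.

Lemma der_expansion (t : K) (w : nat -> K) :
  D (\sum_(i < p) w i ^+ p * t ^+ i) =
  (\sum_(i < p) (w i ^+ p * t ^+ i.-1) *+ i) * D t.
Proof.
rewrite der_sum big_distrl; apply: eq_bigr => i _ /=.
by rewrite DM der_pth mul0r add0r derX mulrnAr mulrA -mulrnAl.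
Qed.

End Derivation.

(** * Powers of a twisted derivation *)
Section Bell.
Variables (R : comNzRingType) (D : {additive R -> R}).
Hypothesis DM : forall z w, D (z * w) = D z * w + z * D w.

(** The value of [bell u n] at a constant l is (D + l u)^n applied to 1. *)
Fixpoint bell (u : R) (n : nat) : {poly R} :=
  if n is n'.+1 then map_poly D (bell u n') + u%:P * 'X * bell u n' else 1.

Lemma bell1 u n : (bell u n).[1] = iter n (fun z => D z + u * z) 1.
Proof.
elim: n => [|n IH] /=; first by rewrite hornerE.
rewrite -IH !hornerE; congr (_ + _).
rewrite -[map_poly D _]/(\poly_(i < _) _) horner_poly horner_coef raddf_sum.
by apply: eq_bigr => i _; rewrite !expr1n !mulr1.
Qed.

Let mapD_mulC c q :
  map_poly D (c%:P * q) = (D c)%:P * q + c%:P * map_poly D q.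
Proof. by apply/polyP => i; rewrite coefD coef_map !coefCM coef_map DM. Qed.

Let mapD_deriv q : (map_poly D q)^`() = map_poly D q^`().
Proof. by apply/polyP => i; rewrite coef_deriv !coef_map coef_deriv raddfMn. Qed.

Lemma deriv_bell u n : (bell u n)^`() =
  \sum_(i < n) ((iter i D u)%:P * bell u (n - i.+1)) *+ 'C(n, i.+1).
Proof.
elim: n => [|n IH]; first by rewrite big_ord0 /= derivC.
rewrite /= derivD mapD_deriv IH derivM derivM derivC derivX mul0r add0r mulr1.
rewrite raddf_sum IH mulr_sumr.
pose T i := (iter i D u)%:P * bell u (n - i).
have -> : \sum_(i < n) map_poly D (((iter i D u)%:P * bell u (n - i.+1)) *+ 'C(n, i.+1))
  + (u%:P * bell u n + \sum_(i < n) u%:P * 'X * (((iter i D u)%:P * bell u (n - i.+1)) *+ 'C(n, i.+1)))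
  = u%:P * bell u n + \sum_(i < n) (T i.+1 *+ 'C(n, i.+1)) + \sum_(i < n) T i *+ 'C(n, i.+1).
  rewrite addrCA -addrA -!big_split /=; congr (_ + _); apply: eq_bigr => i _.
  rewrite raddfMn /= mapD_mulC /T.
  have -> : (n - i)%N = (n - i.+1).+1 by rewrite subnSK.
  rewrite [bell u _.+1]/= mulrnAr -!mulrnDl -addrA mulrDr.
  by congr ((_ + (_ + _)) *+ _); exact: mulrCA.
have -> : u%:P * bell u n + \sum_(i < n) T i.+1 *+ 'C(n, i.+1) = \sum_(i < n.+1) T i *+ 'C(n, i).
  by rewrite big_ord_recl /= bin0 mulr1n /T subn0.
have -> : \sum_(i < n) T i *+ 'C(n, i.+1) = \sum_(i < n.+1) T i *+ 'C(n, i.+1).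
  by rewrite big_ord_recr /= (bin_small (ltnSn n)) mulr0n addr0.
rewrite -big_split; apply: eq_bigr => i _ /=.
by rewrite subSS binS mulrnDr addrC.
Qed.

Lemma size_bell u n : (size (bell u n) <= n.+1)%N /\ (bell u n)`_n = u ^+ n.
Proof.
elim: n => [|n [IHs IHc]]; first by rewrite /= size_poly1 coef1.
have sD : (size (map_poly D (bell u n)) <= n.+1)%N by apply: leq_trans (size_poly _ _) _.
split=> /=.
  apply: leq_trans (size_polyD _ _) _; rewrite geq_max (leq_trans sD) //=.
  rewrite -mulrA (leq_trans (size_polyMleq _ _)) //.
  have : (size (u%:P) <= 1)%N by rewrite size_polyC; case: (_ != _).
  have : (size ('X * bell u n)%R <= n.+2)%N.
    by rewrite mulrC (leq_trans (size_polyMleq _ _)) // size_polyX; lia.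
  by lia.
by rewrite coefD nth_default // add0r -mulrA coefCM coefXM /= IHc exprS.
Qed.

Lemma bell0 u n : (bell u n.+1)`_0 = 0.
Proof.
elim: n => [|n IH].
  rewrite /= mulr1 coefD coefCM coefX mulr0 addr0 coef_map coef1 /=.
  by apply: (addrI (D 1)); rewrite addr0 -{3}[1]mulr1 DM mulr1 mul1r.
rewrite -/(bell u n.+2) [bell u n.+2]/= -/(bell u n.+1).
by rewrite coefD coef_map IH raddf0 add0r -mulrA coefCM coefXM mulr0.
Qed.

(** In characteristic p, (D + u)^p and D^p + u^p differ by the multiplication
    by D^(p-1) u.  It is proved for D + l u with l an indeterminate: the
    derivative of [bell u p] with respect to l is constant, as its other terms
    carry binomial coefficients divisible by p, and in degree 1 < i < p this
    forces the coefficients of [bell u p] to vanish. *)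
Lemma iter_twisted (p : nat) u : p \in [pchar R] ->
  (forall n, (n%:R == 0 :> R) = false -> forall z : R, z *+ n = 0 -> z = 0) ->
  iter p (fun z => D z + u * z) 1 = iter p.-1 D u + u ^+ p.
Proof.
move=> chp reg_nat; have p_pr := pcharf_prime chp; have p_gt1 := prime_gt1 p_pr.
have dB : (bell u p)^`() = (iter p.-1 D u)%:P.
  rewrite deriv_bell; case: p chp p_pr p_gt1 => // p chp p_pr p_gt1.
  rewrite big_ord_recr /= binn mulr1n subnn mulr1 big1 ?add0r // => i _.
  have : (p.+1 %| 'C(p.+1, i.+1))%N by apply: prime_dvd_bin; rewrite //= ltnS ltn_ord.
  rewrite (dvdn_pcharf chp) => /eqP e.
  by rewrite -mulr_natr -polyC_natr e mulr0.
have [sB cB] := size_bell u p.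
have Bi i : (1 < i < p)%N -> (bell u p)`_i = 0.
  case: i => // i /andP[i1 ip].
  have : (bell u p)^`()`_i = 0 by rewrite dB coefC gtn_eqF.
  rewrite coef_deriv; apply: reg_nat; rewrite -(dvdn_pcharf chp).
  by apply/negP => /dvdn_leq -/(_ isT); rewrite leqNgt ip.
have B1 : (bell u p)`_1 = iter p.-1 D u.
  by rewrite -[LHS]mulr1n -[LHS](coef_deriv _ 0) dB coefC.
rewrite -bell1 (horner_coef_wide _ sB).
case: p chp p_pr p_gt1 {dB} sB cB Bi B1 => [|[|p]] // chp p_pr p_gt1 sB cB Bi B1.
have B0 := bell0 u p.+1; move: (bell u p.+2) sB cB Bi B1 B0 => B sB cB Bi B1 B0.
rewrite big_ord_recr big_ord_recl big_ord_recl /= !expr1n !mulr1 B0 add0r.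
rewrite [X in _ + X + _]big1 ?addr0; first by rewrite -cB; congr (_ + _); exact: B1.
by move=> i _; rewrite /bump /= !add1n Bi ?mul0r // !ltnS ltn_ord.
Qed.

End Bell.

(** * The Cartier operator *)
Section PBasis.
Variables (K : fieldType) (p : nat) (x : K).
Hypothesis chp : p \in [pchar K].
Hypothesis spanx : forall z, exists w : nat -> K, z = \sum_(i < p) w i ^+ p * x ^+ i.
Hypothesis freex : forall w : nat -> K,
  \sum_(i < p) w i ^+ p * x ^+ i = 0 -> forall i, (i < p)%N -> w i = 0.

Let p_pr : prime p := pcharf_prime chp.
Let p_gt0 : (0 < p)%N := prime_gt0 p_pr.

Lemma exprDp (a b : K) : (a + b) ^+ p = a ^+ p + b ^+ p.
Proof. by rewrite -!(pFrobenius_autE chp) rmorphD. Qed.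

Lemma exprBp (a b : K) : (a - b) ^+ p = a ^+ p - b ^+ p.
Proof. by rewrite -!(pFrobenius_autE chp) rmorphB. Qed.

Lemma expIp (a b : K) : a ^+ p = b ^+ p -> a = b.
Proof.
move/eqP; rewrite -subr_eq0 -exprBp expf_eq0 subr_eq0 => /andP[_ /eqP //].
Qed.

(** The coordinates of z in the basis 1, x, ..., x^(p-1) of K over K^p, given by
    their p-th roots *)
Definition pcoord z : nat -> K := sval (cid (spanx z)).

Lemma pcoordP z : z = \sum_(i < p) pcoord z i ^+ p * x ^+ i.
Proof. exact: svalP (cid (spanx z)). Qed.

Lemma pcoord_uniq z (w : nat -> K) : z = \sum_(i < p) w i ^+ p * x ^+ i ->
  forall i, (i < p)%N -> pcoord z i = w i.
Proof.
move=> e i ip; apply/eqP; rewrite -subr_eq0.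
rewrite (freex (w := fun i => pcoord z i - w i) _ ip) //.
rewrite -[RHS](subrr z) [X in X - _]pcoordP [X in _ - X]e -sumrB.
by apply: eq_bigr => j _; rewrite exprBp mulrBl.
Qed.

Lemma pcoordD z z' i : (i < p)%N -> pcoord (z + z') i = pcoord z i + pcoord z' i.
Proof.
move=> ip; apply: (pcoord_uniq (w := fun i => pcoord z i + pcoord z' i)) => //.
rewrite {1}[z]pcoordP {1}[z']pcoordP -big_split; apply: eq_bigr => j _.
by rewrite exprDp mulrDl.
Qed.

Lemma pcoord_monom w n i : (i < p)%N ->
  pcoord (w ^+ p * x ^+ n) i = if i == (n %% p)%N then w * x ^+ (n %/ p) else 0.
Proof.
move=> ip; pose f i := if i == (n %% p)%N then w * x ^+ (n %/ p) else 0.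
apply: (pcoord_uniq (w := f)) => //.
have np : (n %% p < p)%N by rewrite ltn_mod.
rewrite (bigD1 (Ordinal np)) //= big1 ?addr0 => [|j ji].
  by rewrite /f eqxx exprMn -exprM -mulrA -exprD -divn_eq.
by rewrite /f (negPf (ji : (j != n %% p :> nat)%N)) expr0n gtn_eqF // mul0r.
Qed.

(** Differentiation with respect to x *)
Definition pder z := \sum_(i < p) (pcoord z i ^+ p * x ^+ i.-1) *+ i.

(** The coordinate of index p - 1: as z dx is the sum of the differentials
    w_i^p x^i dx, and those of index i < p - 1 are exact, this is the Cartier
    operator written on the functions z instead of the differentials z dx. *)
Definition cartier z := pcoord z p.-1.

Let p1p : (p.-1 < p)%N. Proof. by rewrite prednK. Qed.

Lemma pderD : {morph pder : z w / z + w}.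
Proof.
move=> z w; rewrite /pder -big_split; apply: eq_bigr => i _ /=.
by rewrite pcoordD // exprDp mulrDl mulrnDl.
Qed.

Lemma pder0 : pder 0 = 0.
Proof. by apply: (addrI (pder 0)); rewrite -pderD !addr0. Qed.

Lemma pder_sum (I : Type) (r : seq I) (Q : pred I) (F : I -> K) :
  pder (\sum_(i <- r | Q i) F i) = \sum_(i <- r | Q i) pder (F i).
Proof. exact: (big_morph _ pderD pder0). Qed.

Lemma pder_zmod_morphism : zmod_morphism pder.
Proof.
move=> z w; rewrite pderD; congr (_ + _); apply/eqP.
by rewrite -addr_eq0 -pderD addNr pder0.
Qed.
HB.instance Definition _ := GRing.isZmodMorphism.Build K K pder pder_zmod_morphism.

Lemma pder_monom w n : pder (w ^+ p * x ^+ n) = (w ^+ p * x ^+ n.-1) *+ n.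
Proof.
have np : (n %% p < p)%N by rewrite ltn_mod.
rewrite /pder (bigD1 (Ordinal np)) //= big1 ?addr0 => [|j ji]; last first.
  by rewrite pcoord_monom // (negPf (ji : (j != n %% p :> nat)%N)) expr0n gtn_eqF // mul0r mul0rn.
rewrite pcoord_monom // eqxx exprMn -exprM -mulrA -exprD.
have -> : forall z : K, z *+ n = z *+ (n %% p).
  move=> z; rewrite {1}(divn_eq n p) mulrnDr mulnC mulrnA mulrnAC -[in RHS](add0r (z *+ _)).
  by congr (_ + _); rewrite -mulr_natr (pcharf0 chp) mulr0.
have [->|n0] := posnP (n %% p)%N; first by rewrite !mulr0n.
congr (_ * _ ^+ _ *+ _); rewrite [in RHS](divn_eq n p).
by rewrite -(prednK n0) addnS.
Qed.

Lemma pder_derivation : derivation pder.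
Proof.
split=> [|z w]; first exact: pderD.
rewrite [z]pcoordP [w]pcoordP.
move: (pcoord z) (pcoord w) => a b.
rewrite big_distrlr /= !pder_sum.
rewrite [X in _ = X * _ + _](_ : _ = \sum_(i < p) (a i ^+ p * x ^+ i.-1) *+ i); last first.
  by apply: eq_bigr => i _; rewrite pder_monom.
rewrite [X in _ = _ + _ * X](_ : _ = \sum_(i < p) (b i ^+ p * x ^+ i.-1) *+ i); last first.
  by apply: eq_bigr => i _; rewrite pder_monom.
rewrite !big_distrlr /= -big_split /=; apply: eq_bigr => i _.
rewrite pder_sum -big_split; apply: eq_bigr => j _ /=.
rewrite mulrACA -exprMn -exprD pder_monom mulrnAl mulrnAr mulrnDr.
rewrite mulrACA [in X in _ = _ + X]mulrACA -!exprMn -!exprD.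
congr (_ + _).
  by case: (nat_of_ord i) => [|i']; rewrite ?mulr0n ?addSn.
by case: (nat_of_ord j) => [|j']; rewrite ?mulr0n ?addnS.
Qed.

Lemma pder_x : pder x = 1.
Proof.
by have := pder_monom 1 1; rewrite expr1n !mul1r expr1 expr0 mulr1n.
Qed.

Lemma iter_pder n z :
  iter n pder z = \sum_(i < p) (pcoord z i ^+ p * x ^+ (i - n)) *+ (i ^_ n).
Proof.
elim: n => [|n IH]; first by rewrite [LHS]pcoordP; apply: eq_bigr => i _; rewrite subn0 ffactn0.
rewrite iterS IH pder_sum; apply: eq_bigr => i _.
by rewrite raddfMn /= pder_monom ffactnSr mulnC mulrnA subnS.
Qed.

(** The factor is (p - 1)! and equals - 1 by Wilson's theorem. *)
Lemma iter_pder_pred z : iter p.-1 pder z = - cartier z ^+ p.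
Proof.
rewrite iter_pder (bigD1 (Ordinal p1p)) //= big1 ?addr0 => [|i ip].
  rewrite subnn expr0 mulr1 ffactnn -mulr_natr -mulrN1; congr (_ * _).
  apply/eqP; rewrite -subr_eq0 opprK natr1 -(dvdn_pcharf chp).
  by rewrite -Wilson ?prime_gt1.
rewrite ffact_small ?mulr0n // ltn_neqAle -ltnS prednK // ltn_ord andbT.
exact: ip.
Qed.

Lemma iter_pder_p z : iter p pder z = 0.
Proof. by rewrite iter_pder big1 // => i _; rewrite ffact_small ?mulr0n. Qed.

Lemma cartierD z w : cartier (z + w) = cartier z + cartier w.
Proof. exact: pcoordD. Qed.

Lemma cartier0 : cartier 0 = 0.
Proof. by apply: (addrI (cartier 0)); rewrite -cartierD !addr0. Qed.

Lemma cartier_sum (I : Type) (r : seq I) (Q : pred I) (F : I -> K) :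
  cartier (\sum_(i <- r | Q i) F i) = \sum_(i <- r | Q i) cartier (F i).
Proof. exact: (big_morph _ cartierD cartier0). Qed.

Lemma cartierM w z : cartier (w ^+ p * z) = w * cartier z.
Proof.
apply: (pcoord_uniq (w := fun i => w * pcoord z i)) => //.
rewrite {1}[z]pcoordP mulr_sumr; apply: eq_bigr => i _.
by rewrite exprMn mulrA.
Qed.

Lemma cartier_monom n :
  cartier (x ^+ n) = if (n %% p == p.-1)%N then x ^+ (n %/ p) else 0.
Proof.
have := pcoord_monom 1 n p1p; rewrite expr1n !mul1r eq_sym; exact.
Qed.

(** A function with zero derivative has only its coordinate of index 0. *)
Lemma pder_eq0 z : pder z = 0 -> exists w, z = w ^+ p.
Proof.
move=> dz; exists (pcoord z 0); rewrite {1}[z]pcoordP.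
pose w i := if (i.+1 < p)%N then pcoord z i.+1 *+ i.+1 else 0.
have w0 : forall i, (i < p)%N -> w i = 0.
  apply: freex; rewrite -[RHS]dz /pder -(prednK p_gt0).
  rewrite big_ord_recr big_ord_recl /= mulr0n add0r.
  rewrite /w prednK // ltnn expr0n gtn_eqF // mul0r addr0.
  apply: eq_bigr => i _; rewrite /bump /= add1n.
  have ip : (i.+1 < p)%N by rewrite -ltn_predRL.
  rewrite ip -[pcoord z i.+1 *+ _]mulr_natr exprMn -[in RHS]mulr_natr -(pFrobenius_autE chp i.+1%:R).
  by rewrite rmorph_nat mulrAC.
rewrite -(prednK p_gt0) big_ord_recl /= prednK // expr0 mulr1 big1 ?addr0 //.
move=> i _; rewrite /bump /= add1n.
have ip : (i.+1 < p)%N by rewrite -ltn_predRL.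
have /eqP := w0 i (ltnW ip); rewrite /w ip -mulr_natr mulf_eq0 -(dvdn_pcharf chp).
rewrite gtnNdvd // orbF => /eqP->.
by rewrite expr0n gtn_eqF // mul0r.
Qed.

(** The fixed points of the Cartier operator are the logarithmic derivatives.
    If u = D f / f then (D + u)^n maps 1 to D^n f / f, which is 0 for n = p.
    Conversely, if (D - u)^p kills 1, let f be the last nonzero element of the
    orbit of 1 under D - u. *)
Lemma cartier_fixP u : cartier u = u <-> exists2 f, f != 0 & pder f = u * f.
Proof.
have [DD DM] := pder_derivation.
have nat0 n : (n%:R == 0 :> K) = false -> forall z : K, z *+ n = 0 -> z = 0.
  by move=> n0 z /eqP; rewrite -mulr_natr mulf_eq0 n0 orbF => /eqP.
have it v : iter p (fun z => pder z + v * z) 1 = v ^+ p - cartier v ^+ p.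
  by rewrite (iter_twisted DM) // iter_pder_pred addrC.
split=> [uC | [f f0 fD]]; last first.
  apply: expIp; apply/eqP; rewrite eq_sym -subr_eq0 -it; apply/eqP.
  have H n : iter n (fun z => pder z + u * z) 1 = iter n pder f / f.
    elim: n => [|n IH]; first by rewrite /= divff.
    rewrite iterS IH iterS DM (derV pder_derivation) // fD.
    by field; exact: f0.
  by rewrite H iter_pder_p mul0r.
have CN : cartier (- u) = - u.
  by apply/eqP; rewrite -addr_eq0 -{2}uC -cartierD addNr cartier0.
have ex0 : exists n, iter n (fun z => pder z + - u * z) 1 == 0.
  by exists p; rewrite it CN subrr.
case: (ex_minnP ex0) => -[|n]; first by rewrite /= oner_eq0.
rewrite iterS => /eqP H min_n.
exists (iter n (fun z => pder z + - u * z) 1).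
  by apply/negP => /min_n; rewrite ltnn.
by move/eqP: H; rewrite mulNr subr_eq0 => /eqP.
Qed.

End PBasis.

(** * Evaluation of polynomials on the curve *)
Section Eval.
Variables (k K : fieldType) (iota : {rmorphism k -> K}) (x y : K).

Definition eval1 (g : {poly k}) : K := (map_poly iota g).[x].

Let phi1 : {rmorphism {poly k} -> K} := horner_eval x \o map_poly iota.
Let phi2 : {rmorphism {poly {poly k}} -> K} := horner_eval y \o map_poly phi1.
Local Notation ev := (eval2 iota x y).

Lemma eval1D f g : eval1 (f + g) = eval1 f + eval1 g. Proof. exact: rmorphD phi1 f g. Qed.
Lemma eval1B f g : eval1 (f - g) = eval1 f - eval1 g. Proof. exact: rmorphB phi1 f g. Qed.
Lemma eval1M f g : eval1 (f * g) = eval1 f * eval1 g. Proof. exact: rmorphM phi1 f g. Qed.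
Lemma eval1Xn f n : eval1 (f ^+ n) = eval1 f ^+ n. Proof. exact: rmorphXn phi1 n f. Qed.
Lemma eval1_0 : eval1 0 = 0. Proof. exact: rmorph0 phi1. Qed.
Lemma eval1_1 : eval1 1 = 1. Proof. exact: rmorph1 phi1. Qed.
Lemma eval1C a : eval1 a%:P = iota a. Proof. by rewrite /eval1 map_polyC hornerC. Qed.
Lemma eval1X : eval1 'X = x. Proof. by rewrite /eval1 map_polyX hornerX. Qed.
Lemma eval1_XsubC a : eval1 ('X - a%:P) = x - iota a.
Proof. by rewrite eval1B eval1X eval1C. Qed.
Lemma eval1Z a g : eval1 (a *: g) = iota a * eval1 g.
Proof. by rewrite -mul_polyC eval1M eval1C. Qed.
Lemma eval1_sum (I : Type) (r : seq I) (Q : pred I) (F : I -> {poly k}) :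
  eval1 (\sum_(i <- r | Q i) F i) = \sum_(i <- r | Q i) eval1 (F i).
Proof. exact: raddf_sum phi1 _ _ _ _. Qed.
Lemma eval1_prod (I : Type) (r : seq I) (F : I -> {poly k}) :
  eval1 (\prod_(i <- r) F i) = \prod_(i <- r) eval1 (F i).
Proof. exact: rmorph_prod phi1 _ _ _ _. Qed.
Lemma eval1_coef (g : {poly k}) n : (size g <= n)%N -> eval1 g = \sum_(i < n) iota g`_i * x ^+ i.
Proof.
move=> sg; rewrite /eval1 (horner_coef_wide _ (leq_trans (size_poly _ _) sg)).
by apply: eq_bigr => i _; rewrite coef_map.
Qed.

Lemma eval2D F G : ev (F + G) = ev F + ev G. Proof. exact: rmorphD phi2 F G. Qed.
Lemma eval2B F G : ev (F - G) = ev F - ev G. Proof. exact: rmorphB phi2 F G. Qed.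
Lemma eval2M F G : ev (F * G) = ev F * ev G. Proof. exact: rmorphM phi2 F G. Qed.
Lemma eval2Xn F n : ev (F ^+ n) = ev F ^+ n. Proof. exact: rmorphXn phi2 n F. Qed.
Lemma eval2_0 : ev 0 = 0. Proof. exact: rmorph0 phi2. Qed.
Lemma eval2_1 : ev 1 = 1. Proof. exact: rmorph1 phi2. Qed.
Lemma eval2C g : ev g%:P = eval1 g.
Proof. by rewrite /eval2 map_polyC hornerC. Qed.
Lemma eval2X : ev 'X = y. Proof. by rewrite /eval2 map_polyX hornerX. Qed.
Lemma eval2CC a : ev a%:P%:P = iota a. Proof. by rewrite eval2C eval1C. Qed.
Lemma eval2_sum (I : Type) (r : seq I) (Q : pred I) (F : I -> {poly {poly k}}) :
  ev (\sum_(i <- r | Q i) F i) = \sum_(i <- r | Q i) ev (F i).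
Proof. exact: raddf_sum phi2 _ _ _ _. Qed.
Lemma eval2_coef (G : {poly {poly k}}) n : (size G <= n)%N -> ev G = \sum_(j < n) eval1 G`_j * y ^+ j.
Proof.
move=> sG; rewrite /eval2 (horner_coef_wide _ (leq_trans (size_poly _ _) sG)).
by apply: eq_bigr => i _; rewrite coef_map.
Qed.

(** The field generated by x and y over the constants *)
Definition fgen z := exists G H, ev H != 0 /\ z = ev G / ev H.

Lemma fgen_ev G : fgen (ev G).
Proof. by exists G, 1; rewrite eval2_1 oner_neq0 divr1. Qed.

Lemma fgen_iota a : fgen (iota a).
Proof. by rewrite -eval2CC; exact: fgen_ev. Qed.

Lemma fgen_x : fgen x.
Proof. by rewrite -eval1X -eval2C; exact: fgen_ev. Qed.

Lemma fgen_y : fgen y.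
Proof. by rewrite -eval2X; exact: fgen_ev. Qed.

Lemma fgenD z w : fgen z -> fgen w -> fgen (z + w).
Proof.
move=> [G [H [H0 ->]]] [G' [H' [H'0 ->]]].
exists (G * H' + G' * H), (H * H').
by rewrite eval2D !eval2M mulf_neq0 //; split=> //; field; rewrite H0 H'0.
Qed.

Lemma fgenM z w : fgen z -> fgen w -> fgen (z * w).
Proof.
move=> [G [H [H0 ->]]] [G' [H' [H'0 ->]]]; exists (G * G'), (H * H').
by rewrite !eval2M mulf_neq0 //; split=> //; field; rewrite H0 H'0.
Qed.

Lemma fgenV z : fgen z -> fgen z^-1.
Proof.
move=> [G [H [H0 ->]]]; have [G0|G0] := eqVneq (ev G) 0.
  by rewrite G0 mul0r invr0 -eval2_0; exact: fgen_ev.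
by exists H, G; split=> //; rewrite invf_div.
Qed.

Lemma fgen_ind (Q : K -> Prop) :
  (forall a, Q (iota a)) -> Q x -> Q y -> (forall z w, Q z -> Q w -> Q (z + w)) ->
  (forall z w, Q z -> Q w -> Q (z * w)) -> (forall z, z != 0 -> Q z -> Q z^-1) ->
  forall z, fgen z -> Q z.
Proof.
move=> Qa Qx Qy QD QM QV.
have QX z n : Q z -> Q (z ^+ n).
  move=> Qz; elim: n => [|n IH]; last by rewrite exprS; exact: QM.
  by rewrite expr0 -(rmorph1 iota).
have Qsum (n : nat) (F : 'I_n -> K) : (forall i, Q (F i)) -> Q (\sum_(i < n) F i).
  by move=> QF; apply: big_ind => //; rewrite -(rmorph0 iota).
have Q1 g : Q (eval1 g).
  by rewrite (eval1_coef (leqnn _)); apply: Qsum => i; apply: QM => //; exact: QX.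
have Q2 G : Q (ev G).
  by rewrite (eval2_coef (leqnn _)); apply: Qsum => i; apply: QM => //; exact: QX.
by move=> z [G [H [H0 ->]]]; apply: QM => //; exact: QV.
Qed.

End Eval.

Lemma fgen_trans (k K : fieldType) (iota : {rmorphism k -> K}) (x y x' y' z : K) :
  fgen iota x' y' x -> fgen iota x' y' y -> fgen iota x y z -> fgen iota x' y' z.
Proof.
move=> fx fy; apply: (fgen_ind (Q := fgen iota x' y')) => //.
- exact: fgen_iota.
- exact: fgenD.
- exact: fgenM.
- by move=> w _; exact: fgenV.
Qed.

(** In both fields the evaluation at the coordinates has the ideal of F as its
    kernel, so that sending x to x' and y to y' is well defined on fractions. *)
Lemma function_field_hom (k K K' : fieldType) (iota : {rmorphism k -> K})
    (iota' : {rmorphism k -> K'}) (x y : K) (x' y' : K') (F : {poly {poly k}}) :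
  is_function_field iota x y F -> is_function_field iota' x' y' F ->
  exists phi : {rmorphism K -> K'},
    [/\ forall a, phi (iota a) = iota' a, phi x = x' & phi y = y'].
Proof.
move=> [ker gen] [ker' _].
pose ev := eval2 iota x y; pose ev' := eval2 iota' x' y'.
have ev0 G : (ev G == 0) = (ev' G == 0).
  by apply/eqP/eqP => [/ker/ker'|/ker'/ker].
have /choice[gh ghP] : forall z, exists GH : {poly {poly k}} * {poly {poly k}},
    ev GH.2 != 0 /\ z = ev GH.1 / ev GH.2.
  by move=> z; have [G [H GH]] := gen z; exists (G, H).
pose phi z := ev' (gh z).1 / ev' (gh z).2.
have phiE G H : ev H != 0 -> phi (ev G / ev H) = ev' G / ev' H.
  move=> H0; have [H'0 e] := ghP (ev G / ev H); rewrite /phi.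
  move: (gh _).1 (gh _).2 H'0 e => G' H' H'0 /eqP.
  rewrite eqr_div // -subr_eq0 -!eval2M -eval2B -/(ev _) ev0 /ev' eval2B !eval2M subr_eq0 -/ev'.
  move=> /eqP e; apply/eqP; rewrite eq_sym eqr_div -?ev0 //; exact/eqP.
have phi_ev G : phi (ev G) = ev' G.
  by have := @phiE G 1; rewrite /ev /ev' !eval2_1 !divr1 => ->; rewrite ?oner_neq0.
have phiB : zmod_morphism phi.
  move=> z w; have [G [H [H0 ->]]] := gen z; have [G' [H' [H'0 ->]]] := gen w.
  rewrite -/ev in H0 H'0 *.
  have -> : ev G / ev H - ev G' / ev H' = ev (G * H' - G' * H) / ev (H * H').
    by rewrite /ev eval2B !eval2M -/ev; field; rewrite H0 H'0.
  rewrite !phiE // /ev ?eval2M ?mulf_neq0 // /ev' eval2B !eval2M -/ev'.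
  by field; rewrite -!ev0 H0 H'0.
have phiM : monoid_morphism phi.
  split; first by rewrite -(eval2_1 iota x y) phi_ev /ev' eval2_1.
  move=> z w; have [G [H [H0 ->]]] := gen z; have [G' [H' [H'0 ->]]] := gen w.
  rewrite -/ev in H0 H'0 *.
  have -> : ev G / ev H * (ev G' / ev H') = ev (G * G') / ev (H * H').
    by rewrite /ev !eval2M -/ev; field; rewrite H0 H'0.
  rewrite !phiE // /ev ?eval2M ?mulf_neq0 // /ev' !eval2M -/ev'.
  by field; rewrite -!ev0 H0 H'0.
pose mA := GRing.isZmodMorphism.Build _ _ phi phiB.
pose mM := GRing.isMonoidMorphism.Build _ _ phi phiM.
pose phiR : {rmorphism K -> K'} := HB.pack phi mA mM.
exists phiR; split=> [a||].
- by rewrite -(eval2CC _ x y) [LHS]phi_ev /ev' eval2CC.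
- by rewrite -{1}(eval1X iota x) -(eval2C _ _ y) [LHS]phi_ev /ev' eval2C eval1X.
- by rewrite -{1}(eval2X iota x y) [LHS]phi_ev /ev' eval2X.
Qed.

(** * Function fields of y^N = x^(cN) + 1 *)
Section Chart.
Variables (k : closedFieldType) (N c : nat).
Local Notation M := (c * N)%N.
Hypothesis Nk : N%:R != 0 :> k.
Hypothesis Mk : M%:R != 0 :> k.

Let N_gt0 : (0 < N)%N.
Proof. by rewrite lt0n; apply: contraNneq Nk => ->. Qed.
Let M_gt0 : (0 < M)%N.
Proof. by rewrite lt0n; apply: contraNneq Mk => ->. Qed.

Section Field.
Variables (K : fieldType) (iota : {rmorphism k -> K}).

(** A pair of functions that presents K as the function field of the curve; in
    this form the condition is easily checked for (1/x, y/x^c). *)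
Definition chart (x y : K) := [/\ y ^+ N = x ^+ M + 1,
  forall C : nat -> {poly k}, \sum_(j < N) eval1 iota x (C j) * y ^+ j = 0 ->
    forall j, (j < N)%N -> C j = 0 &
  forall z, fgen iota x y z].

Lemma size_fermat_eq : size (fermat_eq k N M) = N.+1 /\ fermat_eq k N M \is monic.
Proof.
rewrite /fermat_eq; have s : (size (('X^M + 1)%:P : {poly {poly k}}) < N.+1)%N.
  by rewrite (leq_ltn_trans (size_polyC_leq1 _)).
split; first by rewrite size_polyDl size_polyXn // size_polyN.
by rewrite monicE lead_coefDl ?lead_coefXn // size_polyN size_polyXn.
Qed.

Lemma eval2_fermat_eq (x y : K) : eval2 iota x y (fermat_eq k N M) = y ^+ N - (x ^+ M + 1).
Proof. by rewrite eval2B eval2Xn eval2X eval2C eval1D eval1Xn eval1X eval1_1. Qed.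

Lemma eval2_reduce (x y : K) G : y ^+ N = x ^+ M + 1 ->
  exists2 Rm : {poly {poly k}}, (size Rm <= N)%N &
    (exists Q, G = Q * fermat_eq k N M + Rm) /\
    eval2 iota x y G = \sum_(j < N) eval1 iota x Rm`_j * y ^+ j.
Proof.
move=> yN; have [sF mF] := size_fermat_eq.
exists (Pdiv.Ring.rmodp G (fermat_eq k N M)).
  by rewrite -ltnS -sF Pdiv.Ring.ltn_rmodpN0 // monic_neq0.
have sR : (size (Pdiv.Ring.rmodp G (fermat_eq k N M)) <= N)%N.
  by rewrite -ltnS -sF Pdiv.Ring.ltn_rmodpN0 // monic_neq0.
split; first by exists (Pdiv.Ring.rdivp G (fermat_eq k N M)); exact: Pdiv.RingMonic.rdivp_eq.
rewrite {1}(Pdiv.RingMonic.rdivp_eq mF G) eval2D eval2M eval2_fermat_eq yN subrr mulr0 add0r.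
exact: eval2_coef.
Qed.

(** F is monic of degree N in Y, so every polynomial is congruent modulo F to a
    unique one of degree less than N in Y. *)
Lemma chartP (x y : K) : is_function_field iota x y (fermat_eq k N M) <-> chart x y.
Proof.
have [sF mF] := size_fermat_eq; split=> [[ker gen] | [yN free gen]].
  have yN : y ^+ N = x ^+ M + 1.
    by apply/eqP; rewrite -subr_eq0 -eval2_fermat_eq; apply/eqP/ker; exists 1; rewrite mul1r.
  split=> // C C0 j jN.
  have sC : (size (\poly_(j < N) C j) <= N)%N by exact: size_poly.
  have : eval2 iota x y (\poly_(j < N) C j) = 0.
    by rewrite (eval2_coef _ _ _ sC) -[RHS]C0; apply: eq_bigr => i _; rewrite coef_poly ltn_ord.
  move/ker => [H HE]; have [H0|H0] := eqVneq H 0.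
    by move/polyP/(_ j): HE; rewrite H0 mul0r coef_poly jN coef0.
  move: sC; rewrite HE size_Mmonic // sF addnS leqNgt.
  by rewrite -size_poly_gt0 in H0; rewrite -(prednK H0) addSn /= addnC leq_addr.
split=> [G|//]; split=> [G0 | [H ->]]; last first.
  by rewrite eval2M eval2_fermat_eq yN subrr mulr0.
have [Rm sR [[Q GE] evG]] := eval2_reduce G yN.
suff R0 : Rm = 0 by exists Q; rewrite GE R0 addr0.
apply/polyP => j; rewrite coef0; have [jN|jN] := ltnP j N.
  by apply: (free (fun j => Rm`_j)) => //; rewrite -evG G0.
by rewrite nth_default // (leq_trans sR).
Qed.

Section Coordinates.
Variables x y : K.
Hypothesis Hxy : chart x y.
Local Notation ev := (eval2 iota x y).
Local Notation ev1 := (eval1 iota x).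

Lemma chart_eq : y ^+ N = x ^+ M + 1. Proof. by case: Hxy. Qed.
Lemma chart_gen z : fgen iota x y z. Proof. by case: Hxy. Qed.

Lemma eval1_eq0 g : (ev1 g == 0) = (g == 0).
Proof.
apply/eqP/eqP => [g0|->]; last exact: eval1_0.
have [_ free _] := Hxy; have := free (fun j => if j == 0%N then g else 0).
move/(_ _ 0%N N_gt0); apply.
rewrite (bigD1 (Ordinal N_gt0)) //= g0 mul0r add0r big1 // => j.
by rewrite -val_eqE /= => /negPf->; rewrite eval1_0 mul0r.
Qed.

Lemma x_not_const a : x - iota a != 0.
Proof. by rewrite -eval1_XsubC eval1_eq0 polyXsubC_eq0. Qed.

Lemma x_neq0 : x != 0.
Proof. by have := x_not_const 0; rewrite rmorph0 subr0. Qed.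

Lemma y_neq0 : y != 0.
Proof.
have : y ^+ N != 0; last by rewrite expf_eq0 N_gt0.
have -> : y ^+ N = ev1 ('X^M - (-1)%:P).
  by rewrite chart_eq eval1B eval1Xn eval1X eval1C rmorphN1 opprK.
by rewrite eval1_eq0 -size_poly_gt0 size_XnsubC.
Qed.

Lemma chart_ind (Q : K -> Prop) :
  (forall a, Q (iota a)) -> Q x -> Q y -> (forall z w, Q z -> Q w -> Q (z + w)) ->
  (forall z w, Q z -> Q w -> Q (z * w)) -> (forall z, z != 0 -> Q z -> Q z^-1) ->
  forall z, Q z.
Proof. by move=> *; apply: (fgen_ind (iota := iota) (x := x) (y := y)) => //; exact: chart_gen. Qed.

Lemma chart_twist zeta : zeta ^+ N = 1 -> chart x (iota zeta * y).
Proof.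
move=> zN; have z0 : zeta != 0.
  by apply: contra_eq_neq zN => ->; rewrite expr0n gtn_eqF // eq_sym oner_neq0.
have [yN free gen] := Hxy; split.
- by rewrite exprMn -rmorphXn zN rmorph1 mul1r.
- move=> C C0 j jN.
  have := free (fun j => zeta ^+ j *: C j) _ j jN.
  have /[swap]/[apply]/eqP : \sum_(j0 < N) eval1 iota x (zeta ^+ j0 *: C j0) * y ^+ j0 = 0.
    by rewrite -[RHS]C0; apply: eq_bigr => i _; rewrite eval1Z exprMn rmorphXn mulrA [_ * eval1 _ _ _]mulrC.
  by rewrite scaler_eq0 expf_eq0 (negPf z0) andbF => /eqP.
- move=> z; apply: fgen_trans (gen z); first exact: fgen_x.
  have yE : iota zeta^-1 * (iota zeta * y) = y by rewrite fmorphV mulKf // fmorph_eq0.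
  rewrite -[X in fgen _ _ _ X]yE.
  by apply: fgenM; [exact: fgen_iota | exact: fgen_y].
Qed.

Lemma twist_exists zeta : zeta ^+ N = 1 -> exists sigma : {rmorphism K -> K},
  [/\ forall a, sigma (iota a) = iota a, sigma x = x & sigma y = iota zeta * y].
Proof.
move=> zN; apply: (function_field_hom (F := fermat_eq k N M)); apply/chartP => //.
exact: chart_twist.
Qed.

End Coordinates.

(** * The action of the roots of unity on y *)
Section Twist.
Variables (x y : K) (zeta : k) (sigma : {rmorphism K -> K}).
Hypotheses (Hxy : chart x y) (zeta_prim : N.-primitive_root zeta).
Hypothesis sigma_iota : forall a, sigma (iota a) = iota a.
Hypothesis sigma_x : sigma x = x.
Hypothesis sigma_y : sigma y = iota zeta * y.
Local Notation ev := (eval2 iota x y).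
Local Notation ev1 := (eval1 iota x).

Let z0 : zeta != 0.
Proof.
apply: contra_eq_neq (prim_expr_order zeta_prim) => ->.
by rewrite expr0n gtn_eqF // eq_sym oner_neq0.
Qed.

Lemma sigma_ev1 g : sigma (ev1 g) = ev1 g.
Proof.
rewrite (eval1_coef _ _ (leqnn _)) raddf_sum; apply: eq_bigr => i _ /=.
by rewrite rmorphM rmorphXn sigma_iota sigma_x.
Qed.

Lemma iter_sigma_iota i a : iter i sigma (iota a) = iota a.
Proof. by elim: i => //= i ->. Qed.

Lemma iter_sigma_ev1 i g : iter i sigma (ev1 g) = ev1 g.
Proof. by elim: i => //= i ->; rewrite sigma_ev1. Qed.

Lemma iter_sigmaM i z w : iter i sigma (z * w) = iter i sigma z * iter i sigma w.
Proof. by elim: i => //= i ->; rewrite rmorphM. Qed.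

Lemma iter_sigmaD i z w : iter i sigma (z + w) = iter i sigma z + iter i sigma w.
Proof. by elim: i => //= i ->; rewrite rmorphD. Qed.

Lemma iter_sigma_eigen i (j : nat) z : sigma z = iota (zeta ^+ j) * z ->
  iter i sigma z = iota (zeta ^+ (i * j)) * z.
Proof.
move=> e; elim: i => [|i IH]; first by rewrite mul0n expr0 rmorph1 mul1r.
by rewrite iterS IH rmorphM sigma_iota e mulrA -rmorphM -exprD mulSn addnC.
Qed.

Lemma iter_sigma_N z : iter N sigma z = z.
Proof.
elim/(chart_ind Hxy): z => [a||| z w| z w| z].
- exact: iter_sigma_iota.
- by rewrite -(eval1X iota x) iter_sigma_ev1.
- by rewrite (iter_sigma_eigen _ (j := 1)) // muln1 prim_expr_order // rmorph1 mul1r.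
- by rewrite iter_sigmaD => -> ->.
- by rewrite iter_sigmaM => -> ->.
- move=> w0 e; apply: (mulfI w0); rewrite -{1}e -iter_sigmaM !mulfV //.
  by rewrite -(rmorph1 iota) iter_sigma_iota.
Qed.

Lemma sum_prim (i : nat) : (i < N)%N ->
  \sum_(j < N) (zeta ^- i) ^+ j = if i == 0%N then N%:R else 0 :> k.
Proof.
move=> iN; case: eqVneq => [->|i0].
  rewrite (eq_bigr (fun=> 1)) ?sumr_const ?card_ord // => j _.
  by rewrite expr0 invr1; exact: expr1n.
apply: (@mulfI _ (zeta ^- i - 1)).
  rewrite subr_eq0 -[1]invr1 (inj_eq invr_inj) -(prim_order_dvd zeta_prim).
  by rewrite gtnNdvd // lt0n.
by rewrite -subrX1 mulr0 exprVn -exprM mulnC exprM (prim_expr_order zeta_prim) expr1n invr1 subrr.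
Qed.

(** The projection to the eigenspace of sigma for the eigenvalue zeta^j *)
Definition eigen_part (j : nat) z :=
  iota N%:R^-1 * \sum_(i < N) iota ((zeta ^- j) ^+ i) * iter i sigma z.

Lemma sum_eigen_part z : \sum_(j < N) eigen_part j z = z.
Proof.
rewrite -mulr_sumr exchange_big /=.
rewrite (eq_bigr (fun i : 'I_N => (if i == 0%N :> nat then iota N%:R else 0) * iter i sigma z)).
  rewrite (bigD1 (Ordinal N_gt0)) //= big1 ?addr0 => [|i].
    by rewrite mulrA -rmorphM mulVf // rmorph1 mul1r.
  by rewrite -val_eqE /= => /negPf->; rewrite mul0r.
move=> i _; rewrite -mulr_suml -rmorph_sum.
rewrite (eq_bigr (fun j : 'I_N => (zeta ^- i) ^+ j)) => [|j _]; last first.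
  by rewrite !exprVn -!exprM mulnC.
by rewrite sum_prim //; case: eqP; rewrite ?rmorph0.
Qed.

Lemma sigma_eigen_part j z : sigma (eigen_part j z) = iota (zeta ^+ j) * eigen_part j z.
Proof.
rewrite /eigen_part rmorphM sigma_iota mulrCA; congr (_ * _).
pose w i := iota ((zeta ^- j) ^+ i) * iter i sigma z.
have wN : w N = w 0%N.
  rewrite /w iter_sigma_N expr0 exprVn -exprM mulnC exprM.
  by rewrite (prim_expr_order zeta_prim) expr1n invr1.
have shift : \sum_(i < N) w i.+1 = \sum_(i < N) w i.
  apply: (addrI (w 0%N)); rewrite -[RHS]addrC -[X in _ = _ + X]wN.
  by rewrite -(@big_ord_recr _ _ _ _ (fun i => w i)) big_ord_recl.
rewrite raddf_sum -[X in _ * X]shift mulr_sumr; apply: eq_bigr => i _ /=.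
rewrite rmorphM sigma_iota /w mulrA -rmorphM; congr (iota _ * _).
by rewrite exprS mulrA mulfV ?mul1r // expf_neq0.
Qed.

Lemma eigen_part_eigen i j z : (i < N)%N -> (j < N)%N -> sigma z = iota (zeta ^+ i) * z ->
  eigen_part j z = if i == j then z else 0.
Proof.
move=> iN jN e.
have compE l : eigen_part l z = iota (N%:R^-1 * \sum_(m < N) (zeta ^+ i / zeta ^+ l) ^+ m) * z.
  rewrite /eigen_part rmorphM -mulrA rmorph_sum mulr_suml; congr (_ * _); apply: eq_bigr => m _.
  by rewrite (iter_sigma_eigen _ e) mulrA -rmorphM mulnC exprM -exprMn [zeta ^- l * _]mulrC.
rewrite compE; case: eqVneq => [->|ij].
  rewrite mulfV ?expf_neq0 //; under eq_bigr do rewrite expr1n.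
  by rewrite sumr_const card_ord mulVf // rmorph1 mul1r.
have -> : \sum_(m < N) (zeta ^+ i / zeta ^+ j) ^+ m = 0; last by rewrite mulr0 rmorph0 mul0r.
apply: (@mulfI _ (zeta ^+ i / zeta ^+ j - 1)).
  rewrite subr_eq0; apply: contraNneq ij => e1.
  have /eqP : zeta ^+ i = zeta ^+ j by rewrite -[RHS]mul1r -e1 divfK // expf_neq0.
  by rewrite (eq_prim_root_expr zeta_prim) !modn_small.
rewrite -subrX1 mulr0 exprMn exprVn -!exprM ![(_ * N)%N]mulnC !exprM.
by rewrite (prim_expr_order zeta_prim) !expr1n divr1 subrr.
Qed.

Lemma eigen_partD j z w : eigen_part j (z + w) = eigen_part j z + eigen_part j w.
Proof.
rewrite /eigen_part -mulrDr -big_split; congr (_ * _); apply: eq_bigr => i _.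
by rewrite iter_sigmaD mulrDr.
Qed.

Lemma eigen_part0 j : eigen_part j 0 = 0.
Proof. by apply: (addrI (eigen_part j 0)); rewrite -eigen_partD !addr0. Qed.

Lemma eigen_part_sum j (n : nat) (F : nat -> K) :
  eigen_part j (\sum_(i < n) F i) = \sum_(i < n) eigen_part j (F i).
Proof. exact: (big_morph _ (eigen_partD j) (eigen_part0 j)). Qed.

Lemma eigen_sum j (F : nat -> K) : (j < N)%N ->
  (forall i, (i < N)%N -> sigma (F i) = iota (zeta ^+ i) * F i) ->
  eigen_part j (\sum_(i < N) F i) = F j.
Proof.
move=> jN HF; rewrite eigen_part_sum (bigD1 (Ordinal jN)) //= big1 ?addr0.
  by rewrite (eigen_part_eigen _ _ (HF j jN)) ?eqxx.
by move=> i; rewrite -val_eqE /= => /negPf ij; rewrite (eigen_part_eigen _ _ (HF i (ltn_ord i))) ?ij.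
Qed.

(** The norm to k(x), as a product of conjugates *)
Definition norm z := \prod_(i < N) iter i sigma z.

Lemma sigma_norm z : sigma (norm z) = norm z.
Proof.
have [->|w0] := eqVneq z 0.
  by rewrite /norm (bigD1 (Ordinal N_gt0)) //= mul0r rmorph0.
pose w i := iter i sigma z.
rewrite rmorph_prod -[LHS]/(\prod_(i < N) w i.+1); apply: (mulfI w0).
rewrite -[z in LHS]/(w 0%N) -(@big_ord_recl _ _ _ _ (fun i => w i)) big_ord_recr mulrC.
by rewrite /= /w iter_sigma_N.
Qed.

Lemma sigma_ev G : exists G', sigma (ev G) = ev G'.
Proof.
exists (\poly_(j < size G) (zeta ^+ j *: G`_j)).
rewrite (eval2_coef _ _ _ (size_poly _ _)) (eval2_coef _ _ _ (leqnn _)) raddf_sum.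
apply: eq_bigr => i _ /=; rewrite coef_poly ltn_ord eval1Z rmorphM rmorphXn sigma_ev1 sigma_y.
by rewrite exprMn rmorphXn; ring.
Qed.

(** Only the term in y^0 of a polynomial function is fixed by sigma. *)
Lemma fixed_ev G : sigma (ev G) = ev G -> exists g, ev G = ev1 g.
Proof.
move=> fG; have [Rm sR [_ GE]] := eval2_reduce G (chart_eq Hxy).
exists Rm`_0; rewrite GE; have := @eigen_sum 0%N (fun j => ev1 Rm`_j * y ^+ j) N_gt0.
rewrite expr0 mulr1 => <- => [|i iN]; last first.
  by rewrite rmorphM sigma_ev1 rmorphXn sigma_y exprMn -rmorphXn mulrCA.
by rewrite -GE (@eigen_part_eigen 0%N) // expr0 rmorph1 mul1r.
Qed.

(** The other conjugates of a polynomial function multiply it into k[x]. *)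
Lemma norm_ev G : ev G != 0 -> exists G' g, [/\ ev G * ev G' = ev1 g, g != 0 & norm (ev G) = ev1 g].
Proof.
move=> G0.
have itG i : exists G', iter i sigma (ev G) = ev G'.
  by elim: i => [|i [G' IH]]; [exists G | rewrite iterS IH; exact: sigma_ev].
have [Gs HG] := choice itG.
have nE : norm (ev G) = ev (\prod_(i < N) Gs i).
  by rewrite /norm; elim/big_ind2: _ => [|a a' b b' -> ->|i _]; rewrite ?eval2_1 ?eval2M ?HG.
have n0 : norm (ev G) != 0.
  apply/prodf_neq0 => i _; elim: (nat_of_ord i) => // m IH.
  by rewrite iterS fmorph_eq0.
have [g gE] : exists g, norm (ev G) = ev1 g.
  by rewrite nE; apply: fixed_ev; rewrite -nE sigma_norm.
exists (\prod_(i < N.-1) Gs i.+1), g; split=> //.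
  have recl n (F : nat -> K) : (0 < n)%N -> \prod_(i < n) F i = F 0%N * \prod_(i < n.-1) F i.+1.
    by case: n => // n _; exact: big_ord_recl.
  rewrite -gE /norm recl //=; congr (_ * _).
  by elim/big_ind2: _ => [|a a' b b' <- <-|i _]; rewrite ?eval2_1 ?eval2M // -HG.
by rewrite -(eval1_eq0 Hxy) -gE.
Qed.

(** Write z with a denominator in k[x]; its numerator is then fixed too. *)
Lemma sigma_fixed z : sigma z = z -> exists g h, h != 0 /\ z = ev1 g / ev1 h.
Proof.
have [G [H [H0 ->]]] := chart_gen Hxy z => fz.
have [H' [h [HH' h0 _]]] := norm_ev H0.
have h0' : ev1 h != 0 by rewrite (eval1_eq0 Hxy).
have H'0 : ev H' != 0 by apply: contraNneq h0' => e; rewrite -HH' e mulr0.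
have zE : ev G / ev H = ev (G * H') / ev1 h.
  by rewrite -HH' eval2M -mulf_div divff // mulr1.
have [g gE] : exists g, ev (G * H') = ev1 g.
  apply: fixed_ev; have -> : ev (G * H') = ev G / ev H * ev1 h by rewrite zE divfK.
  by rewrite rmorphM fz sigma_ev1.
by exists g, h; rewrite zE gE.
Qed.

(** The eigenfunctions of sigma are the products of a rational function of x
    and a power of y. *)
Lemma eigen_part_form j z : exists g h, h != 0 /\ eigen_part j z = ev1 g / ev1 h * y ^+ j.
Proof.
have yj : y ^+ j != 0 by rewrite expf_neq0 // (y_neq0 Hxy).
have [|g [h [h0 e]]] := @sigma_fixed (eigen_part j z / y ^+ j); last first.
  by exists g, h; rewrite -e divfK.
rewrite rmorphM fmorphV rmorphXn sigma_y sigma_eigen_part exprMn rmorphXn.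
rewrite -mulf_div divff ?mul1r // expf_neq0 // fmorph_eq0; exact: z0.
Qed.

End Twist.

Lemma prim_root_exists : exists zeta : k, N.-primitive_root zeta.
Proof.
have [s [us ss ms _]] := nth_roots Nk (oner_neq0 k).
have : has N.-primitive_root s.
  apply: has_prim_root => //; rewrite ?ss //.
  by apply/allP => z; rewrite ms unity_rootE.
by case/hasP => z _ ?; exists z.
Qed.

(** An algebraically closed field has no algebraic extension. *)
Lemma eval1_not_const (x : K) g : (forall a, x - iota a != 0) -> eval1 iota x g = 0 -> g = 0.
Proof.
move=> xN g0; apply/eqP; apply: contraTT isT => gN0.
have [s gE] := closed_field_poly_normal g.
move/eqP: g0; rewrite gE eval1Z eval1_prod mulf_eq0 fmorph_eq0 lead_coef_eq0 (negPf gN0) /=.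
rewrite prodf_seq_eq0 => /hasP[a _ /=]; rewrite eval1_XsubC (negPf (xN a)) //.
Qed.

(** The coordinates 1/x, y/x^c present the same curve: they are the
    coordinates near the points at infinity. *)
Lemma chart_inv (x y : K) : chart x y -> chart x^-1 (y / x ^+ c).
Proof.
move=> Hxy; have x0 := x_neq0 Hxy.
have [zeta zP] := prim_root_exists.
have [sigma [s_iota s_x s_y]] := twist_exists Hxy (prim_expr_order zP).
have xc0 : x ^+ c != 0 by rewrite expf_neq0.
have x'N a : x^-1 - iota a != 0.
  have [->|a0] := eqVneq a 0; first by rewrite rmorph0 subr0 invr_eq0.
  rewrite subr_eq0 -[iota a]invrK (inj_eq invr_inj) -fmorphV -subr_eq0.
  exact: x_not_const Hxy _.
have y'0 : y / x ^+ c != 0 by rewrite mulf_neq0 ?invr_eq0 // (y_neq0 Hxy).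
split.
- rewrite expr_div_n (chart_eq Hxy) -exprM exprVn mulrDl divff ?expf_neq0 //.
  by rewrite mul1r addrC.
- move=> C C0 j jN; apply: (eval1_not_const x'N); apply/eqP.
  have : eval1 iota x^-1 (C j) * (y / x ^+ c) ^+ j == 0; last first.
    by rewrite mulf_eq0 expf_eq0 (negPf y'0) andbF orbF.
  rewrite -(eigen_sum zP s_iota jN (F := fun j => eval1 iota x^-1 (C j) * (y / x ^+ c) ^+ j)).
    by rewrite C0 (eigen_part0 zeta sigma).
  move=> i iN; rewrite rmorphM /= sigma_ev1 ?fmorphV ?s_x //.
  by rewrite rmorphXn rmorphM fmorphV rmorphXn s_x s_y -mulrA exprMn rmorphXn mulrCA.
move=> z; have fx : fgen iota x^-1 (y / x ^+ c) x.
  by rewrite -[X in fgen _ _ _ X]invrK; apply: fgenV; exact: fgen_x.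
apply: fgen_trans (chart_gen Hxy z) => //.
have yE : y / x ^+ c * x ^+ c = y by rewrite divfK.
rewrite -[X in fgen _ _ _ X]yE.
apply: fgenM; first exact: fgen_y.
have fX n : fgen iota x^-1 (y / x ^+ c) (x ^+ n).
  elim: n => [|n IH]; last by rewrite exprS; exact: fgenM.
  by rewrite expr0 -(rmorph1 iota); exact: fgen_iota.
exact: fX.
Qed.

End Field.
End Chart.

(** * Centers of places *)

Lemma reg_prime (k K : fieldType) (iota : {rmorphism k -> K}) (P : place iota) u v :
  reg P 0 u -> reg P 0 v -> reg P 1 (u * v) -> reg P 1 u \/ reg P 1 v.
Proof.
have [->|u0] := eqVneq u 0; first by left; exact: reg0.
have [->|v0] := eqVneq v 0; first by right; exact: reg0.
rewrite !regE ?mulf_neq0 // ord_mul //; move: (P u) (P v) => m n; lia.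
Qed.

Lemma reg_eval1 (k K : fieldType) (iota : {rmorphism k -> K}) (P : place iota) z g :
  reg P 0 z -> reg P 0 (eval1 iota z g).
Proof.
move=> z0; rewrite (eval1_coef _ _ (leqnn _)); apply: reg_sum => i _.
by apply: reg0M; [exact: reg_iota | exact: reg0X].
Qed.

Lemma reg_eval2 (k K : fieldType) (iota : {rmorphism k -> K}) (P : place iota) z w G :
  reg P 0 z -> reg P 0 w -> reg P 0 (eval2 iota z w G).
Proof.
move=> z0 w0; rewrite (eval2_coef _ _ _ (leqnn _)); apply: reg_sum => i _.
by apply: reg0M; [exact: reg_eval1 | exact: reg0X].
Qed.

(** A polynomial in z that vanishes at P has a linear factor that does. *)
Lemma reg_root (k : closedFieldType) (K : fieldType) (iota : {rmorphism k -> K})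
    (P : place iota) z (g : {poly k}) :
  g != 0 -> reg P 0 z -> reg P 1 (eval1 iota z g) ->
  exists2 a, root g a & reg P 1 (z - iota a).
Proof.
move=> g0 rz; have [s gE] := closed_field_poly_normal g.
have lg : lead_coef g != 0 by rewrite lead_coef_eq0.
have rs a : a \in s -> root g a.
  by move=> sa; rewrite gE rootZ // root_prod_XsubC.
rewrite {1}gE eval1Z => /reg_prime[||/const_reg1/eqP|]; first exact: reg_iota.
- by rewrite reg_eval1.
- by rewrite (negPf lg).
elim: s {gE} rs => [|a s IH] rs.
  by rewrite big_nil eval1_1 -(rmorph1 iota) => /const_reg1/eqP; rewrite oner_eq0.
rewrite big_cons eval1M eval1_XsubC => /reg_prime[||ra|].
- by apply: regB => //; exact: reg_iota.
- exact: reg_eval1.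
- by exists a => //; apply: rs; rewrite inE eqxx.
- by apply: IH => b sb; apply: rs; rewrite inE sb orbT.
Qed.

(** * The places of the curve *)
Section Places.
Variables (k : closedFieldType) (N c : nat).
Local Notation M := (c * N)%N.
Hypotheses (Nk : N%:R != 0 :> k) (Mk : M%:R != 0 :> k).
Variables (K : fieldType) (iota : {rmorphism k -> K}) (x y : K).
Hypothesis Hxy : chart N c iota x y.
Local Notation ev := (eval2 iota x y).
Local Notation ev1 := (eval1 iota x).

Let N_gt0 : (0 < N)%N.
Proof. by rewrite lt0n; apply: contraNneq Nk => ->. Qed.
Let M_gt0 : (0 < M)%N.
Proof. by rewrite lt0n; apply: contraNneq Mk => ->. Qed.

Section Point.
Variables a b : k.
Hypothesis Hab : b ^+ N = a ^+ M + 1.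

Definition at_point (G : {poly {poly k}}) : k := (G.[b%:P]).[a].

Let atR : {rmorphism {poly {poly k}} -> k} := horner_eval a \o horner_eval b%:P.

Let atM G H : at_point (G * H) = at_point G * at_point H. Proof. exact: rmorphM atR G H. Qed.
Let atB G H : at_point (G - H) = at_point G - at_point H. Proof. exact: rmorphB atR G H. Qed.
Let atX G n : at_point (G ^+ n) = at_point G ^+ n. Proof. exact: rmorphXn atR n G. Qed.
Let at1 : at_point 1 = 1. Proof. exact: rmorph1 atR. Qed.
Let atC g : at_point g%:P = g.[a]. Proof. by rewrite /at_point hornerC. Qed.

Let at_ker G : ev G = 0 -> at_point G = 0.
Proof.
have [ker _] := (chartP c Nk iota x y).2 Hxy.
move/ker => [H ->]; rewrite atM.
suff -> : at_point (fermat_eq k N M) = 0 by rewrite mulr0.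
rewrite atB atX atC /at_point !hornerE.
by rewrite Hab subrr.
Qed.

Let at_eq G H : ev G = ev H -> at_point G = at_point H.
Proof. by move/eqP; rewrite -subr_eq0 -eval2B => /eqP/at_ker/eqP; rewrite atB subr_eq0 => /eqP. Qed.

(** A uniformizer: y at the ramified points of the projection to the x-line *)
Definition unif_poly : {poly {poly k}} := if b == 0 then 'X else ('X - a%:P)%:P.
Definition unif : K := if b == 0 then y else x - iota a.

Let ev_unif : ev unif_poly = unif.
Proof. by rewrite /unif_poly /unif; case: eqP => _; rewrite ?eval2X // eval2C eval1_XsubC. Qed.

Let at_unif : at_point unif_poly = 0.
Proof.
rewrite /unif_poly; case: eqP => [b0|_]; last by rewrite atC !hornerE subrr.
by rewrite /at_point hornerX b0 hornerC.
Qed.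

Let unif0 : unif != 0.
Proof.
by rewrite /unif; case: (b == 0); [exact: (y_neq0 Nk Mk Hxy) | exact: (x_not_const Nk Hxy a)].
Qed.

(** The cofactor of x - a in x^M - a^M; it does not vanish at a. *)
Let W : {poly k} := \sum_(i < M) 'X^(M.-1 - i) * a%:P ^+ i.

Let WE : (x - iota a) * ev1 W = y ^+ N - iota b ^+ N.
Proof.
rewrite (chart_eq Hxy) -rmorphXn Hab rmorphD rmorph1 rmorphXn opprD addrACA subrr addr0.
rewrite subrXX eval1_sum; congr (_ * _); apply: eq_bigr => i _.
by rewrite eval1M !eval1Xn eval1X eval1C.
Qed.

Let sum_pow (n : nat) (z : k) : \sum_(i < n) z ^+ (n.-1 - i) * z ^+ i = z ^+ n.-1 *+ n.
Proof.
rewrite (eq_bigr (fun=> z ^+ n.-1)) ?sumr_const ?card_ord // => i _.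
by rewrite -exprD subnK // -ltnS prednK //; apply: leq_trans (ltn_ord i).
Qed.

Let a_neq0 : b = 0 -> a != 0.
Proof.
move=> b0; apply: contra_eq_neq Hab => ->; rewrite b0 !expr0n !gtn_eqF //.
by rewrite add0r eq_sym oner_neq0.
Qed.

Let Wa : b = 0 -> W.[a] != 0.
Proof.
move=> b0; rewrite horner_sum (eq_bigr (fun i : 'I_M => a ^+ (M.-1 - i) * a ^+ i)).
  by rewrite sum_pow -mulr_natr mulf_neq0 // expf_neq0 // a_neq0.
by move=> i _; rewrite hornerM hornerXn horner_exp hornerC.
Qed.

(** The functions that vanish at (a, b) are multiples of the uniformizer in the
    local ring: the equation of the curve gives (x - a) W = y^N - b^N, which
    expresses x - a through y - b if b = 0, and y - b through x - a otherwise. *)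
Let maximal G : at_point G = 0 ->
  exists U G', at_point U != 0 /\ ev U * ev G = unif * ev G'.
Proof.
move=> G0; set g := G.[b%:P].
have /factor_theorem[Q QE] : root (G - g%:P) b%:P.
  by rewrite rootE hornerD hornerN hornerC subrr.
have /factor_theorem[g1 g1E] : root g a by apply/rootP.
have GE : ev G = ev Q * (y - iota b) + ev1 g1 * (x - iota a).
  rewrite -[G](subrK g%:P) QE g1E eval2D eval2M eval2B eval2X !eval2C !eval1M eval1C eval1_XsubC.
  by [].
rewrite /unif GE; case: eqVneq => [b0|b0].
  exists W%:P, (W%:P * Q + g1%:P * 'X ^+ N.-1); rewrite atC Wa //; split=> //.
  rewrite eval2D !eval2M eval2Xn eval2X !eval2C b0 rmorph0 subr0.
  have := WE; rewrite b0 rmorph0 expr0n gtn_eqF // subr0 => WE0.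
  transitivity (ev1 W * ev Q * y + ev1 g1 * ((x - iota a) * ev1 W)); first by ring.
  by rewrite WE0 -[in y ^+ N](prednK N_gt0) exprS; ring.
pose V : {poly {poly k}} := \sum_(i < N) 'X^(N.-1 - i) * b%:P%:P ^+ i.
have VE : (y - iota b) * ev V = y ^+ N - iota b ^+ N.
  rewrite subrXX eval2_sum; congr (_ * _); apply: eq_bigr => i _.
  by rewrite eval2M !eval2Xn eval2X eval2CC.
exists V, (Q * W%:P + V * g1%:P); split.
  rewrite [at_point V](_ : _ = \sum_(i < N) b ^+ (N.-1 - i) * b ^+ i).
    by rewrite sum_pow -mulr_natr mulf_neq0 // expf_neq0.
  rewrite -[at_point V]/(atR V) raddf_sum; apply: eq_bigr => i _.
  by rewrite [LHS]atM !atX atC /at_point !hornerE.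
rewrite eval2D !eval2M !eval2C.
transitivity (ev Q * ((y - iota b) * ev V) + ev1 g1 * (x - iota a) * ev V); first by ring.
by rewrite VE -WE; ring.
Qed.

(** x - a is a power of the uniformizer, up to a unit. *)
Let x_sub_a : exists2 V, at_point V != 0 & exists n, ev V * (x - iota a) = unif ^+ n.
Proof.
rewrite /unif; have := WE; case: eqVneq => [b0|b0] e; last first.
  by exists 1; rewrite ?at1 ?oner_neq0 //; exists 1%N; rewrite eval2_1 mul1r.
exists W%:P; first by rewrite atC Wa.
by exists N; rewrite eval2C mulrC e b0 rmorph0 expr0n gtn_eqF // subr0.
Qed.

Let ev_neq0 U : at_point U != 0 -> ev U != 0.
Proof. by apply: contra_neq => /at_ker. Qed.

(** Every function has a polynomial multiple in k[x], whose order at the point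
    is visible; this bounds the divisibility by the uniformizer. *)
Let divisibility_bound G : ev G != 0 -> exists e G' U V,
  [/\ at_point U != 0, at_point V != 0 & ev V * (ev G * ev G') = unif ^+ e * ev U].
Proof.
move=> G0; have [zeta zP] := prim_root_exists Nk.
have [sigma [s_iota s_x s_y]] := twist_exists Nk Hxy (prim_expr_order zP).
have [G' [g [GG' g0 _]]] := norm_ev Nk Hxy zP s_iota s_x s_y G0.
have [n [q]] := multiplicity_XsubC g a; rewrite g0 /= => qa gE.
have [V V0 [m VE]] := x_sub_a.
exists (m * n)%N, G', q%:P, (V ^+ n); split; rewrite ?atX ?expf_neq0 // ?atC //.
rewrite GG' gE eval1M eval1Xn eval1_XsubC eval2Xn eval2C mulrCA -exprMn VE -exprM.
by rewrite mulrC.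
Qed.

(** Divide G by the uniformizer as long as it vanishes at the point. *)
Let local_form_ev G : ev G != 0 -> exists (m : nat) U V,
  [/\ at_point U != 0, at_point V != 0 & ev G = unif ^+ m * (ev U / ev V)].
Proof.
move=> G0; apply: contrapT => /forallNP noform.
have div n : exists U G', at_point U != 0 /\ ev U * ev G = unif ^+ n * ev G'.
  elim: n => [|n [U [G' [U0 e]]]].
    by exists 1, G; rewrite at1 oner_neq0 eval2_1 expr0.
  have [G'0|G'0] := eqVneq (at_point G') 0; last first.
    case: (noform n); exists G', U; split=> //.
    by rewrite mulrA -e mulrC mulKf // ev_neq0.
  have [U' [G'' [U'0 e']]] := maximal G'0.
  exists (U' * U), G''; rewrite atM mulf_neq0 //; split=> //.
  by rewrite eval2M -mulrA e mulrCA e' exprS; ring.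
have [e [G' [U [V [U0 V0 e1]]]]] := divisibility_bound G0.
have [U1 [G1 [U10 e2]]] := div e.+1.
have : ev (U * U1) = ev (unif_poly * (G1 * G' * V)).
  apply: (mulfI (expf_neq0 e unif0)).
  rewrite !eval2M ev_unif [LHS]mulrA -e1.
  transitivity (ev V * ev G' * (ev U1 * ev G)); first by ring.
  by rewrite e2 exprSr; ring.
move/at_eq; rewrite !atM at_unif mul0r => /eqP.
by rewrite mulf_eq0 (negPf U0) (negPf U10).
Qed.

Lemma local_form z : z != 0 -> exists (m : int) U V,
  [/\ at_point U != 0, at_point V != 0 & z = unif ^ m * (ev U / ev V)].
Proof.
have [G [H [H0 ->]]] := chart_gen Hxy z => z0.
have G0 : ev G != 0 by apply: contraNneq z0 => ->; rewrite mul0r.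
have [m [U [V [U0 V0 ->]]]] := local_form_ev G0.
have [n [U' [V' [U'0 V'0 ->]]]] := local_form_ev H0.
exists (m%:Z - n%:Z), (U * V'), (V * U'); rewrite !atM !mulf_neq0 //; split=> //.
rewrite expfzDr // -exprnP -exprnN !eval2M.
by field; rewrite !ev_neq0 //= expf_neq0.
Qed.

Let local_form_le (m m' : int) U V U' V' :
  at_point U != 0 -> at_point V != 0 -> at_point U' != 0 -> at_point V' != 0 ->
  unif ^ m * (ev U / ev V) = unif ^ m' * (ev U' / ev V') -> m' <= m.
Proof.
move=> U0 V0 U'0 V'0 e; rewrite leNgt; apply/negP => mm'.
have [n m'E] : exists n : nat, m' = m + n.+1%:Z.
  by exists `|m' - m|.-1%N; lia.
have : ev (U * V') = ev (unif_poly * (unif_poly ^+ n * U' * V)).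
  apply: (mulfI (_ : unif ^ m / (ev V * ev V') != 0)).
    by rewrite mulf_neq0 ?expfz_neq0 // invr_eq0 mulf_neq0 ?ev_neq0.
  rewrite !eval2M eval2Xn ev_unif.
  transitivity (unif ^ m * (ev U / ev V)); first by field; rewrite !ev_neq0.
  rewrite e m'E expfzDr // -exprnP exprS.
  by field; rewrite !ev_neq0.
move/at_eq; rewrite !atM at_unif mul0r => /eqP.
by rewrite mulf_eq0 (negPf U0) (negPf V'0).
Qed.

(** The exponent is therefore an invariant of z: it defines the valuation at the
    point (a, b). *)
Lemma local_form_uniq (m m' : int) U V U' V' :
  at_point U != 0 -> at_point V != 0 -> at_point U' != 0 -> at_point V' != 0 ->
  unif ^ m * (ev U / ev V) = unif ^ m' * (ev U' / ev V') -> m = m'.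
Proof.
move=> U0 V0 U'0 V'0 e; apply/eqP; rewrite eq_le.
by rewrite (local_form_le U0 V0 U'0 V'0 e) (local_form_le U'0 V'0 U0 V0 (esym e)).
Qed.

Lemma local_form_poly G : ev G != 0 -> exists (m : nat) U V,
  [/\ at_point U != 0, at_point V != 0, ev G = unif ^ m * (ev U / ev V) &
      at_point G = 0 -> (0 < m)%N].
Proof.
move=> G0; have [m [U [V [U0 V0 e]]]] := local_form_ev G0.
exists m, U, V; split=> //; case: m e => // e /eqP; apply: contraTT => _.
have : ev (G * V) = ev U by rewrite eval2M e expr0 mul1r divfK ?ev_neq0.
by move/at_eq; rewrite atM => e1; apply: contraNneq U0 => G00; rewrite -e1 G00 mul0r.
Qed.

Definition centered (P : place iota) := reg P 1 (x - iota a) /\ reg P 1 (y - iota b).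

Lemma at_point_residue (P : place iota) G : centered P -> reg P 1 (ev G - iota (at_point G)).
Proof.
move=> [Px Py].
have rx : reg P 0 x by rewrite -[x](subrK (iota a)) regD ?reg_iota // (reg_le _ Px).
have ry : reg P 0 y by rewrite -[y](subrK (iota b)) regD ?reg_iota // (reg_le _ Py).
set g := G.[b%:P].
have /factor_theorem[Q QE] : root (G - g%:P) b%:P.
  by rewrite rootE hornerD hornerN hornerC subrr.
have /factor_theorem[g1 g1E] : root (g - (g.[a])%:P) a.
  by rewrite rootE hornerD hornerN hornerC subrr.
have -> : ev G - iota (at_point G) = ev Q * (y - iota b) + ev1 g1 * (x - iota a).
  have -> : ev G = ev Q * (y - iota b) + ev1 g.
    by rewrite -[G](subrK g%:P) QE eval2D eval2M eval2B eval2X !eval2C !eval1C.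
  by rewrite -addrA -(eval1_XsubC iota x) -[ev1 g1 * _]eval1M -g1E eval1B eval1C.
by rewrite -[1]add0r; apply: regD; apply: regM => //; [exact: reg_eval2|exact: reg_eval1].
Qed.

Lemma centered_unit (P : place iota) U : centered P -> at_point U != 0 -> P (ev U) = 0.
Proof. by move=> /(@at_point_residue _ U) PU /ord_unit -/(_ K iota P _ PU)[]. Qed.

(** Every order at P is a multiple of that of [unif], and some order is 1. *)
Lemma centered_unif (P : place iota) : centered P -> P unif = 1.
Proof.
move=> PC; have [t t1] := ord_uniformizer P.
have t0 : t != 0 by apply: contra_eq_neq t1 => ->; rewrite ord_zero.
have u1 : 1 <= P unif.
  rewrite -regE // /unif; case: eqP => b0; last by case: PC.
  by case: PC => _; rewrite b0 rmorph0 subr0.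
have [m [U [V [U0 V0 e]]]] := local_form t0.
move: t1; rewrite e ord_mul ?mulf_neq0 ?invr_eq0 ?expfz_neq0 ?ev_neq0 //.
rewrite ord_div ?ev_neq0 // !centered_unit // subrr addr0 ordXz.
move: (P unif) u1 => n n1 nm; apply/eqP; rewrite eq_le n1 andbT -nm ler_peMr ?(le_trans _ n1) //.
have n0 : 0 < n by apply: lt_le_trans n1.
by have : 0 < m; [rewrite -(pmulr_rgt0 _ n0) nm | move: (m); lia].
Qed.

Lemma centered_ord (P : place iota) (m : int) U V : centered P ->
  at_point U != 0 -> at_point V != 0 -> P (unif ^ m * (ev U / ev V)) = m.
Proof.
move=> PC U0 V0.
rewrite ord_mul ?mulf_neq0 ?invr_eq0 ?expfz_neq0 ?ev_neq0 //.
by rewrite ord_div ?ev_neq0 // !centered_unit // subrr addr0 ordXz centered_unif ?mul1r.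
Qed.

Lemma centered_uniq (P P' : place iota) : centered P -> centered P' -> P = P'.
Proof.
move=> PC P'C; apply: place_eq => z; have [->|z0] := eqVneq z 0; first by rewrite !ord_zero.
by have [m [U [V [U0 V0 ->]]]] := local_form z0; rewrite !centered_ord.
Qed.

Lemma centered_exists : exists P, centered P.
Proof.
have /choice[f fP] : forall z, exists m : int, z != 0 ->
    exists U V, [/\ at_point U != 0, at_point V != 0 & z = unif ^ m * (ev U / ev V)].
  move=> z; have [->|z0] := eqVneq z 0; first by exists 0.
  by have [m H] := local_form z0; exists m.
pose v z := if z == 0 then 0 else f z.
have vE m U V : at_point U != 0 -> at_point V != 0 -> v (unif ^ m * (ev U / ev V)) = m.
  move=> U0 V0; have z0 : unif ^ m * (ev U / ev V) != 0.
    by rewrite !mulf_neq0 ?invr_eq0 ?expfz_neq0 ?ev_neq0.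
  rewrite /v (negPf z0); have [U' [V' [U'0 V'0 e]]] := fP _ z0.
  exact/esym/(local_form_uniq U0 V0 U'0 V'0 e).
have vev G : ev G != 0 -> 0 <= v (ev G) /\ (at_point G = 0 -> 1 <= v (ev G)).
  move=> G0; have [m [U [V [U0 V0 e H]]]] := local_form_poly G0.
  by rewrite e (vE m) //; split=> // /H; rewrite -lez_nat.
have v0 : v 0 = 0 by rewrite /v eqxx.
have vM z w : z != 0 -> w != 0 -> v (z * w) = v z + v w.
  move=> /local_form[m [U [V [U0 V0 ->]]]] /local_form[n [U' [V' [U'0 V'0 ->]]]].
  rewrite mulrACA -expfzDr // mulf_div -!eval2M vE ?atM ?mulf_neq0 //.
  by rewrite vE // vE ?atM ?mulf_neq0.
have vD z w : z != 0 -> w != 0 -> z + w != 0 -> Num.min (v z) (v w) <= v (z + w).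
  wlog : z w / v z <= v w.
    move=> H z0 w0 zw0; have [le|/ltW le] := leP (v z) (v w).
      by rewrite -(min_l le); exact: H.
    rewrite -(min_r le) minC addrC; apply: H => //; by rewrite addrC.
  move=> + z0 w0; move/local_form: (z0) => [m [U [V [U0 V0 zE]]]].
  move/local_form: (w0) => [n [U' [V' [U'0 V'0 wE]]]].
  rewrite zE wE !vE // => mn zw0; rewrite min_l //.
  have [l nE] : exists l : nat, n = m + l%:Z by exists `|n - m|%N; lia.
  pose G := U * V' + unif_poly ^+ l * U' * V.
  have e : unif ^ m * (ev U / ev V) + unif ^ n * (ev U' / ev V') = unif ^ m * (ev 1 / ev (V * V')) * ev G.
    rewrite nE expfzDr // -exprnP eval2D !eval2M eval2Xn ev_unif eval2_1.
    by field; rewrite !ev_neq0.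
  have G0 : ev G != 0 by apply: contraNneq zw0 => G0; rewrite e G0 mulr0.
  have VV : at_point (V * V') != 0 by rewrite atM mulf_neq0.
  have one0 : at_point 1 != 0 by rewrite at1 oner_neq0.
  have T0 : unif ^ m * (ev 1 / ev (V * V')) != 0.
    by rewrite !mulf_neq0 ?invr_eq0 ?expfz_neq0 ?ev_neq0.
  by rewrite e (vM _ _ T0 G0) vE // lerDl (vev G G0).1.
have vC a' : a' != 0 -> v (iota a') = 0.
  move=> a'0; have := vE 0 a'%:P%:P 1; rewrite expr0z mul1r eval2_1 divr1 eval2CC.
  by apply; rewrite ?at1 ?oner_neq0 // atC hornerC.
have vU : exists t, v t = 1.
  exists unif; have := vE 1 1 1; rewrite eval2_1 divr1 mulr1 expr1z at1 oner_neq0.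
  exact.
pose P := Place v0 vM vD vC vU.
have PG G : at_point G = 0 -> reg P 1 (ev G).
  by move=> G0; rewrite /reg; case: eqVneq => //= z0; exact: (vev G z0).2.
exists P; split.
  by rewrite -(eval1_XsubC iota x) -(eval2C _ _ y); apply: PG; rewrite atC !hornerE subrr.
have -> : y - iota b = ev ('X - b%:P%:P) by rewrite eval2B eval2X eval2CC.
by apply: PG; rewrite atB /at_point hornerX !hornerC subrr.
Qed.

(** Where y vanishes, x - a is y^N up to a unit. *)
Lemma centered_coords (P : place iota) : centered P ->
  if b == 0 then P y = 1 /\ P (x - iota a) = N else P y = 0 /\ P (x - iota a) = 1.
Proof.
move=> PC; have := centered_unif PC; rewrite /unif.
case: eqVneq => b0 Pu; split=> //.
  have W0 : at_point W%:P != 0 by rewrite atC Wa.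
  have xa := x_not_const Nk Hxy a.
  have := congr1 P WE; rewrite b0 rmorph0 expr0n gtn_eqF // subr0.
  rewrite ord_mul // -?(eval2C iota x y) ?centered_unit // ?ev_neq0 // ordX Pu addr0 => ->.
  by rewrite natz.
by have [_ ->] := ord_unit b0 PC.2.
Qed.

End Point.

Lemma reg_y (P : place iota) : reg P 0 x -> reg P 0 y.
Proof.
have y0 := y_neq0 Nk Mk Hxy; move=> rx.
have : reg P 0 (y ^+ N) by rewrite (chart_eq Hxy) regD ?reg1 // reg0X.
by rewrite !regE ?expf_neq0 // ordX pmulrn_lge0.
Qed.

(** If no x - a vanished at P, then no polynomial function would, since its norm
    is a product of such factors, and P would take the value 0 only. *)
Lemma center_exists (P : place iota) : reg P 0 x ->
  exists a b, b ^+ N = a ^+ M + 1 /\ centered a b P.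
Proof.
move=> rx; have ry := reg_y rx.
have [a xa] : exists a, reg P 1 (x - iota a).
  apply: contrapT => /forallNP Na.
  have ord_ev1 g : g != 0 -> P (ev1 g) = 0.
    move=> g0; have gx : ev1 g != 0 by rewrite (eval1_eq0 Nk Hxy).
    have : reg P 0 (ev1 g) by exact: reg_eval1.
    have : ~~ reg P 1 (ev1 g) by apply/negP => /(reg_root g0 rx)[a _ /Na].
    by rewrite !regE //; move: (P _) => n; lia.
  have ord_ev G : ev G != 0 -> P (ev G) = 0.
    move=> G0; have [zeta zP] := prim_root_exists Nk.
    have [sigma [s_iota s_x s_y]] := twist_exists Nk Hxy (prim_expr_order zP).
    have [G' [g [GG' g0 _]]] := norm_ev Nk Hxy zP s_iota s_x s_y G0.
    have := ord_ev1 g g0; rewrite -GG'.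
    have G'0 : ev G' != 0.
      by apply: contraNneq g0 => e; rewrite -(eval1_eq0 Nk Hxy) -GG' e mulr0.
    have : reg P 0 (ev G) by exact: reg_eval2.
    have : reg P 0 (ev G') by exact: reg_eval2.
    by rewrite !regE // ord_mul //; move: (P _) (P _) => m n; lia.
  have [t t1] := ord_uniformizer P.
  have t0 : t != 0 by apply: contra_eq_neq t1 => ->; rewrite ord_zero.
  have [G [H [H0 tE]]] := chart_gen Hxy t; move: t1 t0; rewrite tE.
  have [->|G0] := eqVneq (ev G) 0; first by rewrite mul0r eqxx.
  by rewrite ord_div // !ord_ev.
pose g : {poly k} := 'X^N - (a ^+ M + 1)%:P.
have g0 : g != 0 by rewrite -size_poly_gt0 size_XnsubC.
have gE : eval1 iota y g = (x - iota a) * ev1 (\sum_(i < M) 'X^(M.-1 - i) * a%:P ^+ i).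
  rewrite eval1B eval1Xn eval1X eval1C (chart_eq Hxy) rmorphD rmorph1 rmorphXn.
  rewrite opprD addrACA subrr addr0 subrXX eval1_sum; congr (_ * _).
  by apply: eq_bigr => i _; rewrite eval1M !eval1Xn eval1X eval1C.
have [|b gb yb] := @reg_root _ _ _ P y g g0 ry.
  by rewrite gE -[1]addr0 regM // reg_eval1.
exists a, b; split=> //; apply/eqP; rewrite -subr_eq0.
by move: gb; rewrite rootE !hornerE.
Qed.

End Places.

(** * Divisors *)

Lemma sum_const_seq (I : Type) (r : seq I) (n : int) : \sum_(i <- r) n = n *+ size r.
Proof. by elim: r => [|i r IH]; rewrite ?big_nil // big_cons IH mulrS. Qed.

Lemma divisor_of (K : choiceType) (s : seq K) (n : K -> int) : uniq s ->
  exists D : {freeg K}, (forall P, coeff P D = if P \in s then n P else 0) /\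
    deg D = \sum_(P <- s) n P.
Proof.
move=> us; exists (\sum_(P <- s) << n P *g P >>); split=> [P|]; last first.
  by rewrite raddf_sum; apply: eq_bigr => P _; exact: degU.
rewrite raddf_sum /=; case: ifP => Ps.
  rewrite (bigD1_seq P) //= coeffU eqxx mulr1 big1 ?addr0 // => Q QP.
  by rewrite coeffU (negPf QP) mulr0.
rewrite big_seq big1 // => Q Qs; rewrite coeffU; case: eqVneq => [e|_]; last by rewrite mulr0.
by rewrite -e Qs in Ps.
Qed.

Section Fibers.
Variables (k : closedFieldType) (N c : nat).
Local Notation M := (c * N)%N.
Hypotheses (Nk : N%:R != 0 :> k) (Mk : M%:R != 0 :> k).
Variables (K : fieldType) (iota : {rmorphism k -> K}).

Let N_gt0 : (0 < N)%N.
Proof. by rewrite lt0n; apply: contraNneq Nk => ->. Qed.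
Let M_gt0 : (0 < M)%N.
Proof. by rewrite lt0n; apply: contraNneq Mk => ->. Qed.

Lemma const_uniq (P : place iota) z a a' :
  reg P 1 (z - iota a) -> reg P 1 (z - iota a') -> a = a'.
Proof.
move=> Ra Ra'; apply/eqP; rewrite -subr_eq0; apply/eqP/(@const_reg1 _ _ _ P).
have -> : iota (a - a') = (z - iota a') - (z - iota a) by rewrite rmorphB; ring.
exact: regB.
Qed.

Section OneFiber.
Variables x y : K.
Hypothesis Hxy : chart N c iota x y.

Lemma reg0_of (P : place iota) z a : reg P 1 (z - iota a) -> reg P 0 z.
Proof. by move=> Pz; rewrite -[z](subrK (iota a)) regD ?reg_iota // (reg_le _ Pz). Qed.

Lemma place_inhabited : exists P : place iota, centered x y 0 1 P.
Proof.
by apply: (centered_exists Nk Mk Hxy); rewrite expr1n expr0n gtn_eqF // add0r.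
Qed.

(** There are N places over x = a, one for each root b of b^N = a^M + 1, except
    that they collapse to a single one of ramification index N if b = 0. *)
Lemma fiber_exists a : exists s : seq (place iota), [/\ uniq s,
  forall P, (P \in s) = reg P 1 (x - iota a) & \sum_(P <- s) P (x - iota a) = N%:Z].
Proof.
have center (P : place iota) : reg P 1 (x - iota a) -> exists2 b, b ^+ N = a ^+ M + 1 & centered x y a b P.
  move=> Pa; have [a' [b [Hb PC]]] := center_exists Nk Mk Hxy (reg0_of Pa).
  by rewrite (const_uniq Pa PC.1); exists b.
have [d0|d0] := eqVneq (a ^+ M + 1) 0.
  have H0 : (0 : k) ^+ N = a ^+ M + 1 by rewrite d0 expr0n gtn_eqF.
  have [P PC] := centered_exists Nk Mk Hxy H0.
  exists [:: P]; split=> // [P'|]; last first.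
    by rewrite big_seq1; have := centered_coords Nk Mk Hxy H0 PC; rewrite eqxx => -[_ ->].
  rewrite inE; apply/eqP/idP => [->|/center[b Hb P'C]]; first by case: PC.
  apply: (centered_uniq Nk Mk Hxy H0 _ PC).
  by move: Hb; rewrite d0 => /eqP; rewrite expf_eq0 N_gt0 => /eqP b0; rewrite -b0.
have [rs [urs srs mrs _]] := nth_roots Nk d0.
have [P0 _] := place_inhabited.
have /boolp.choice[f fP] : forall b, exists P : place iota, b \in rs -> centered x y a b P.
  move=> b; have [brs|_] := boolP (b \in rs); last by exists P0.
  by move: brs; rewrite mrs => /eqP/(centered_exists Nk Mk Hxy)[P PC]; exists P.
exists (map f rs); split.
- rewrite map_inj_in_uniq // => b b' /fP[_ Pb] /fP[_ Pb'] e.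
  by rewrite e in Pb; exact: const_uniq Pb Pb'.
- move=> P; apply/mapP/idP => [[b /fP[Pa _] -> //]|/center[b Hb PC]].
  have brs : b \in rs by rewrite mrs Hb.
  by exists b => //; apply: (centered_uniq Nk Mk Hxy Hb PC); exact: fP.
- rewrite big_map (eq_big_seq (fun=> 1)) ?sum_const_seq ?srs ?natz // => b brs.
  have Hb : b ^+ N = a ^+ M + 1 by apply/eqP; rewrite -mrs.
  have := centered_coords Nk Mk Hxy Hb (fP b brs); case: eqVneq => [b0|_ [_ -> //]].
  by case/eqP: d0; rewrite -Hb b0 expr0n gtn_eqF.
Qed.

End OneFiber.

Variables x y : K.
Hypothesis Hxy : chart N c iota x y.
Let Hinv := chart_inv Nk Mk Hxy.
Local Notation ev := (eval2 iota x y).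
Local Notation ev1 := (eval1 iota x).

Let x0 : x != 0 := x_neq0 Nk Hxy.

Lemma reg_or_inv (P : place iota) : reg P 0 x \/ reg P 1 x^-1.
Proof.
rewrite !regE ?invr_eq0 // ordV; move: (P x) => n.
by have [?|?] := lerP 0 n; [left | right; lia].
Qed.

(** The fibers of x, [None] standing for the point at infinity of the x-line *)
Lemma fibers_exist : exists fib : option k -> seq (place iota),
  [/\ forall o, uniq (fib o),
    forall a P, (P \in fib (Some a)) = reg P 1 (x - iota a),
    forall P, (P \in fib None) = reg P 1 x^-1,
    forall a, \sum_(P <- fib (Some a)) P (x - iota a) = N%:Z &
    \sum_(P <- fib None) P x^-1 = N%:Z].
Proof.
have /boolp.choice[f fP] := fiber_exists Hxy.
have [s [us ms ss]] := fiber_exists Hinv 0.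
exists (fun o => if o is Some a then f a else s); split=> //.
- by case=> [a|] //; case: (fP a).
- by move=> a; case: (fP a).
- by move=> P; rewrite ms rmorph0 subr0.
- by move=> a; case: (fP a).
- by rewrite -[RHS]ss; apply: eq_bigr => P _; rewrite rmorph0 subr0.
Qed.

Section Degree.
Variable fib : option k -> seq (place iota).
Hypotheses (uniq_fib : forall o, uniq (fib o))
  (fibS : forall a P, (P \in fib (Some a)) = reg P 1 (x - iota a))
  (fibN : forall P, (P \in fib None) = reg P 1 x^-1)
  (sumS : forall a, \sum_(P <- fib (Some a)) P (x - iota a) = N%:Z)
  (sumN : \sum_(P <- fib None) P x^-1 = N%:Z).

Let S o f := \sum_(P <- fib o) P f.

Let SM o f g : f != 0 -> g != 0 -> S o (f * g) = S o f + S o g.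
Proof.
by move=> f0 g0; rewrite /S -big_split; apply: eq_bigr => P _; exact: ord_mul.
Qed.

Let reg1_not0 (P : place iota) : reg P 0 x -> reg P 1 x^-1 -> False.
Proof. by rewrite !regE ?invr_eq0 // ordV; move: (P x) => n; lia. Qed.

Let fib_disjoint o o' P : P \in fib o -> P \in fib o' -> o = o'.
Proof.
case: o o' => [a|] [a'|] //; rewrite ?fibS ?fibN.
- by move=> Pa Pa'; rewrite (const_uniq Pa Pa').
- by move=> /reg0_of Pa /(reg1_not0 Pa).
- by move=> Pi /reg0_of /reg1_not0 -/(_ Pi).
Qed.

Let S_linear o a : S o (x - iota a) = if o == Some a then N%:Z else if o == None then - N%:Z else 0.
Proof.
have xa := x_not_const Nk Hxy a.
case: o => [a'|] /=; last first.
  rewrite -sumN /S -sumrN; apply: eq_big_seq => P; rewrite fibN => Pi.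
  rewrite ordV opprK; apply: (ord_dominant x0 _).2.
  rewrite regN; apply: reg_le (reg_iota P a).
  by move: Pi; rewrite regE ?invr_eq0 // ordV; move: (P x) => n; lia.
case: eqVneq => [[->]|ne]; first exact: sumS.
rewrite /S big_seq big1 // => P; rewrite fibS => Pa'.
have aa : a' - a != 0 by apply: contra_neq ne => /eqP; rewrite subr_eq0 => /eqP->.
have : reg P 1 (x - iota a - iota (a' - a)) by rewrite rmorphB opprB addrA subrK.
by case/(ord_unit aa).
Qed.

(** Conjugation by the roots of unity permutes the places of a fiber. *)
Section Conjugation.
Variables (zeta : k) (sigma : {rmorphism K -> K}).
Hypotheses (zP : N.-primitive_root zeta) (s_iota : forall a, sigma (iota a) = iota a)
  (s_x : sigma x = x) (s_y : sigma y = iota zeta * y).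

Let itN := iter_sigma_N Hxy zP s_iota s_x s_y.

Lemma place_twist : exists tw : place iota -> place iota,
  (forall P z, tw P z = P (sigma z)) /\ injective tw.
Proof.
have /boolp.choice[tw twE] : forall P : place iota, exists Q : place iota, forall z, Q z = P (sigma z).
  move=> P.
  have o0 : P (sigma 0) = 0 by rewrite rmorph0 ord_zero.
  have oM f g : f != 0 -> g != 0 -> P (sigma (f * g)) = P (sigma f) + P (sigma g).
    by move=> f0 g0; rewrite rmorphM ord_mul ?fmorph_eq0.
  have oD f g : f != 0 -> g != 0 -> f + g != 0 ->
      Num.min (P (sigma f)) (P (sigma g)) <= P (sigma (f + g)).
    by move=> f0 g0 fg0; rewrite rmorphD ord_add ?fmorph_eq0 // -rmorphD fmorph_eq0.
  have oC a : a != 0 -> P (sigma (iota a)) = 0 by move=> a0; rewrite s_iota ord_const.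
  have oU : exists t, P (sigma t) = 1.
    have [t t1] := ord_uniformizer P; exists (iter N.-1 sigma t).
    by rewrite -iterS prednK // itN.
  by exists (Place o0 oM oD oC oU).
exists tw; split=> // P Q e; apply: place_eq => z.
by rewrite -(itN z) -(prednK N_gt0) iterS -!twE e.
Qed.

Lemma sum_conj o f : S o (sigma f) = S o f.
Proof.
have [tw [twE tw_inj]] := place_twist.
rewrite /S (eq_bigr (fun P => (tw P) f)) => [|P _]; last by rewrite twE.
rewrite -(big_map tw xpredT (fun P : place iota => P f)); apply: perm_big.
have sx' : sigma x^-1 = x^-1 by rewrite fmorphV s_x.
have reg_tw (P : place iota) n z : sigma z = z -> reg (tw P) n z = reg P n z.
  by move=> fz; rewrite /reg twE fz.
have sub : {subset map tw (fib o) <= fib o}.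
  move=> Q /mapP[P Po ->]; case: o Po => [a|]; rewrite ?fibS ?fibN reg_tw //.
  by rewrite rmorphB s_x s_iota.
have u : uniq (map tw (fib o)) by rewrite map_inj_uniq.
apply: uniq_perm => //.
by apply: (uniq_min_size u sub _).2; rewrite size_map.
Qed.

Lemma sum_norm o f : f != 0 -> S o (norm N sigma f) = S o f *+ N.
Proof.
move=> f0; have it0 i : iter i sigma f != 0 by elim: i => // i IH; rewrite iterS fmorph_eq0.
have H n : S o (\prod_(i < n) iter i sigma f) = S o f *+ n.
  elim: n => [|n IH]; first by rewrite big_ord0 /S big1 // => P _; exact: ord_1.
  rewrite big_ord_recr /= SM ?IH ?mulrSr //; last by apply/prodf_neq0.
  by congr (_ + _); elim: n {IH} => // n IH; rewrite iterS sum_conj.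
exact: H.
Qed.

End Conjugation.

(** Let g be the norm of G.  The zeros of G at finite distance lie over the roots
    of g, and since conjugation preserves the degree over each fiber, N times the
    degree of G is the degree of g, which is 0 because g is a product of linear
    factors, each with N zeros and N poles.  L lists the fibers in play. *)
Lemma degree_ev G : ev G != 0 -> exists2 g : {poly k}, g != 0 & 
  (forall P : place iota, reg P 0 x -> P (ev G) != 0 -> exists2 a, root g a & reg P 1 (x - iota a)) /\
  forall L : seq (option k), uniq L -> None \in L -> (forall a, root g a -> Some a \in L) ->
  \sum_(o <- L) S o (ev G) = 0.
Proof.
move=> G0; have [zeta zP] := prim_root_exists Nk.
have [sigma [s_iota s_x s_y]] := twist_exists Nk Hxy (prim_expr_order zP).
have [G' [g [GG' g0 nG]]] := norm_ev Nk Hxy zP s_iota s_x s_y G0.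
have g10 : ev1 g != 0 by rewrite (eval1_eq0 Nk Hxy).
have G'0 : ev G' != 0 by apply: contraNneq g10 => e; rewrite -GG' e mulr0.
exists g => //; split=> [P Px PG | L uL NL gL].
  have Py := reg_y Nk Mk Hxy Px.
  apply: (reg_root g0 Px); rewrite -GG'.
  have := reg_eval2 G Px Py; have := reg_eval2 G' Px Py.
  rewrite (regE _ _ G0) (regE _ _ G'0) (regE _ _ (mulf_neq0 G0 G'0)) ord_mul //.
  by move: PG; move: (P (ev G)) (P (ev G')) => m n; lia.
have SL z : z != 0 -> \sum_(o <- L) S o (norm N sigma z) = (\sum_(o <- L) S o z) *+ N.
  by move=> z0; rewrite -sumrMnl; apply: eq_bigr => o _; exact: (sum_norm zP s_iota s_x s_y).
have : (\sum_(o <- L) S o (ev G)) *+ N = 0.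
  rewrite -SL // nG; have [s gE] := closed_field_poly_normal g.
  have lg : lead_coef g != 0 by rewrite lead_coef_eq0.
  have rs a : a \in s -> Some a \in L.
    by move=> sa; apply: gL; rewrite gE rootZ // root_prod_XsubC.
  rewrite gE eval1Z (eq_bigr (fun o => S o (ev1 (\prod_(z <- s) ('X - z%:P))))) => [|o _]; last first.
    rewrite SM ?fmorph_eq0 // ?(eval1_eq0 Nk Hxy) ?monic_neq0 ?monic_prod_XsubC //.
    by rewrite /S big1 ?add0r // => P _; rewrite ord_const.
  elim: s rs {gE} => [|a s IH] rs.
    by rewrite big_nil eval1_1 big1 // => o _; rewrite /S big1 // => P _; exact: ord_1.
  rewrite big_cons eval1M eval1_XsubC.
  rewrite (eq_bigr (fun o => S o (x - iota a) + S o (ev1 (\prod_(z <- s) ('X - z%:P))))) => [|o _]; last first.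
    by rewrite SM // ?(x_not_const Nk Hxy) ?(eval1_eq0 Nk Hxy) ?monic_neq0 ?monic_prod_XsubC.
  rewrite big_split /= IH ?addr0 => [|b bs]; last by apply: rs; rewrite inE bs orbT.
  have delta o0 (n : int) : o0 \in L -> \sum_(o <- L) (if o == o0 then n else 0) = n.
    by move=> o0L; rewrite (bigD1_seq o0) //= eqxx big1 ?addr0 // => o /negPf->.
  rewrite (eq_bigr (fun o => (if o == Some a then N%:Z else 0) + (if o == None then - N%:Z else 0))).
    by rewrite big_split /= !delta ?subrr // rs // inE eqxx.
  by move=> o _; rewrite S_linear; case: o => [a'|] /=; rewrite ?addr0 ?add0r.
move/eqP; rewrite mulrn_eq0 => /orP[/eqP e|/eqP //].
by move: N_gt0; rewrite e.
Qed.

Lemma uniq_fibers L : uniq L -> uniq (flatten (map fib L)).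
Proof.
elim: L => //= o L IH /andP[oL /IH uL]; rewrite cat_uniq uniq_fib uL andbT /=.
apply/hasPn => P /flattenP[_ /mapP[o' o'L ->] Po']; apply/negP => Po.
by case/negP: oL; rewrite (fib_disjoint Po Po').
Qed.

End Degree.

(** A nonzero function has finitely many zeros and poles, and the degree of its
    divisor is 0.  The degree is computed through the norm to k(x), since the
    fibers of x are stable under conjugation. *)
Lemma degree_zero f : f != 0 -> exists s : seq (place iota),
  [/\ uniq s, forall P : place iota, P f != 0 -> P \in s & \sum_(P <- s) P f = 0].
Proof.
have [fib [uF fS fN sS sN]] := fibers_exist.
have [G [H [H0 ->]]] := chart_gen Hxy f => f0.
have G0 : ev G != 0 by apply: contraNneq f0 => ->; rewrite mul0r.
have [g g0 [gP gL]] := degree_ev uF fS fN sS sN G0.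
have [h h0 [hP hL]] := degree_ev uF fS fN sS sN H0.
have roots (q : {poly k}) : q != 0 -> exists s : seq k, forall a, root q a -> a \in s.
  move=> q0; have [s qE] := closed_field_poly_normal q; exists s => a; rewrite {1}qE.
  by rewrite rootZ ?lead_coef_eq0 // root_prod_XsubC.
have [sg sgP] := roots g g0; have [sh shP] := roots h h0.
pose L : seq (option k) := None :: map Some (undup (sg ++ sh)).
have uL : uniq L.
  rewrite /= map_inj_uniq ?undup_uniq ?andbT => [|? ? [] //].
  by apply/mapP => -[].
have inL a : root g a \/ root h a -> Some a \in L.
  by move=> r; rewrite inE /= map_f // mem_undup mem_cat; case: r => [/sgP->|/shP->]; rewrite ?orbT.
exists (flatten (map fib L)); split.
- exact: uniq_fibers.
- move=> P Pf; apply/flattenP.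
  have [Px|Pi] := reg_or_inv P; last by exists (fib None); rewrite ?map_f ?fN.
  have [a ra Pa] : exists2 a, root g a \/ root h a & reg P 1 (x - iota a).
    have [PG|PG] := eqVneq (P (ev G)) 0; last first.
      by have [a ? ?] := gP P Px PG; exists a => //; left.
    have [PH|PH] := eqVneq (P (ev H)) 0; last first.
      by have [a ? ?] := hP P Px PH; exists a => //; right.
    by move: Pf; rewrite ord_div // PG PH subrr eqxx.
  by exists (fib (Some a)); [apply: map_f; exact: inL | rewrite fS].
- rewrite big_flatten big_map /=.
  rewrite (eq_bigr (fun o => \sum_(P <- fib o) P (ev G) - \sum_(P <- fib o) P (ev H))); last first.
    by move=> o _; rewrite -sumrB; apply: eq_bigr => P _; rewrite ord_div.
  rewrite sumrB gL ?hL ?subrr ?inE ?eqxx // => a ra; apply: inL; [by right | by left].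
Qed.

(** A function without zeros and poles is constant: subtract its value at some
    place. *)
Lemma no_poles_const g : g != 0 -> (forall P : place iota, P g = 0) -> exists a, g = iota a.
Proof.
move=> g0 Pg; have H01 : (1 : k) ^+ N = 0 ^+ M + 1.
  by rewrite expr1n expr0n gtn_eqF // add0r.
have [P PC] := place_inhabited Hxy.
have [m [U [V [U0 V0 gE]]]] := local_form Nk Mk Hxy H01 g0.
have m0 : m = 0 by rewrite -(centered_ord Nk Mk Hxy H01 m PC U0 V0) -gE Pg.
pose a := at_point 0 1 U / at_point 0 1 V; exists a; apply/eqP; rewrite -subr_eq0.
apply: contraT => ga0.
have rP : reg P 1 (g - iota a).
  have RU := at_point_residue U PC; have RV := at_point_residue V PC.
  have [V0' PV] := ord_unit V0 RV.
  have -> : g - iota a = ((ev U - iota (at_point 0 1 U)) - iota a * (ev V - iota (at_point 0 1 V))) / ev V.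
    rewrite gE m0 expr0z mul1r /a fmorph_div; field.
    by rewrite V0' fmorph_eq0.
  rewrite -[1]addr0; apply: regM; last by rewrite regE ?invr_eq0 // ordV PV.
  by apply: regB => //; rewrite -[1]add0r; apply: regM => //; exact: reg_iota.
have [s [us sP]] := degree_zero ga0.
have Ps : P \in s by apply: sP; move: rP; rewrite regE //; move: (P _) => n; lia.
rewrite (bigD1_seq P) //= => e.
have : 0 <= \sum_(Q <- s | Q != P) Q (g - iota a).
  apply: sumr_ge0 => Q _; rewrite -regE // regB ?reg_iota // regE // Pg.
  by [].
move: rP e; rewrite regE //; move: (P _) (\sum_(Q <- s | _) _) => n l; lia.
Qed.

End Fibers.

(** * p-th powers in the function field *)
Section Span.
Variables (K : fieldType) (p : nat) (t : K).
Hypothesis chp : p \in [pchar K].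

(** K^p[t], which is a field when p is the characteristic *)
Definition pspan z := exists w : nat -> K, z = \sum_(i < p) w i ^+ p * t ^+ i.

Let p_gt0 : (0 < p)%N := prime_gt0 (pcharf_prime chp).

Lemma pspanD z w : pspan z -> pspan w -> pspan (z + w).
Proof.
move=> [a ->] [b ->]; exists (fun i => a i + b i); rewrite -big_split.
by apply: eq_bigr => i _; rewrite (exprDp chp) mulrDl.
Qed.

Lemma pspan_pow w n : pspan (w ^+ p * t ^+ n).
Proof.
have np : (n %% p < p)%N by rewrite ltn_mod.
exists (fun i => if i == (n %% p)%N then w * t ^+ (n %/ p) else 0).
rewrite (bigD1 (Ordinal np)) //= eqxx big1 ?addr0 => [|i].
  by rewrite exprMn -exprM -mulrA -exprD -divn_eq.
by rewrite -val_eqE /= => /negPf->; rewrite expr0n gtn_eqF // mul0r.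
Qed.

Lemma pspan_pth w : pspan (w ^+ p).
Proof. by have := pspan_pow w 0; rewrite expr0 mulr1. Qed.

Lemma pspan_t : pspan t.
Proof. by have := pspan_pow 1 1; rewrite expr1n mul1r. Qed.

Lemma pspan_sum (I : Type) (r : seq I) (F : I -> K) :
  (forall i, pspan (F i)) -> pspan (\sum_(i <- r) F i).
Proof.
move=> HF; apply: big_ind => // [|z w]; last exact: pspanD.
by have := pspan_pth 0; rewrite expr0n gtn_eqF.
Qed.

Lemma pspanM z w : pspan z -> pspan w -> pspan (z * w).
Proof.
move=> [a ->] [b ->]; rewrite big_distrlr; apply: pspan_sum => i; apply: pspan_sum => j.
by rewrite /= mulrACA -exprMn -exprD; exact: pspan_pow.
Qed.

Lemma pspanX z n : pspan z -> pspan (z ^+ n).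
Proof.
move=> Hz; elim: n => [|n IH]; last by rewrite exprS; exact: pspanM.
by have := pspan_pth 1; rewrite expr1n.
Qed.

(** z^-1 = (z^-1)^p z^(p-1) *)
Lemma pspanV z : z != 0 -> pspan z -> pspan z^-1.
Proof.
move=> z0 Hz; have -> : z^-1 = z^-1 ^+ p * z ^+ p.-1.
  by rewrite -{1}(prednK p_gt0) exprS exprVn mulfVK // expf_neq0.
by apply: pspanM; [exact: pspan_pth | exact: pspanX].
Qed.

End Span.

Lemma pchar_field (k K : fieldType) (iota : {rmorphism k -> K}) p :
  p \in [pchar k] -> p \in [pchar K].
Proof.
by rewrite !inE => /andP[-> /eqP e] /=; rewrite -(rmorph_nat iota) e rmorph0.
Qed.

Section ChartSpan.
Variables (k : closedFieldType) (p h N c d : nat).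
Local Notation M := (c * N)%N.
Hypotheses (chp : p \in [pchar k]) (h_gt0 : (0 < h)%N).
Hypotheses (qN : (p ^ h = (N * 2).+1)%N) (dc : (d * c = 2)%N).

Let two_N : (N%:R * 2%:R = -1 :> k).
Proof.
have : (p ^ h)%:R = 0 :> k.
  by apply/eqP; rewrite -(dvdn_pcharf chp) dvdn_exp.
by rewrite qN -natr1 natrM => /eqP; rewrite addr_eq0 => /eqP.
Qed.

Lemma N_unit : N%:R != 0 :> k.
Proof.
by have := oner_neq0 k; rewrite -oppr_eq0 -two_N mulf_eq0 negb_or => /andP[].
Qed.

Lemma M_unit : M%:R != 0 :> k.
Proof.
have : (d * c * N)%:R != 0 :> k by rewrite dc mulnC natrM two_N oppr_eq0 oner_neq0.
by rewrite -mulnA natrM mulf_eq0 negb_or => /andP[].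
Qed.

Let Nk := N_unit.
Let Mk := M_unit.

Variables (K : fieldType) (iota : {rmorphism k -> K}).
Let chK := pchar_field iota chp.

Lemma pth_root (a : k) : exists b, a = b ^+ p.
Proof.
have [b] := solve_monicpoly (fun i => if i == 0%N then a else 0) (prime_gt0 (pcharf_prime chp)).
rewrite (bigD1 (Ordinal (prime_gt0 (pcharf_prime chp)))) //= expr0 mulr1 big1 ?addr0.
  by move=> <-; exists b.
by move=> i; rewrite -val_eqE /= => /negPf->; rewrite mul0r.
Qed.

Section OneChart.
Variables x y : K.
Hypothesis Hxy : chart N c iota x y.

Lemma pspan_iota t a : pspan p t (iota a).
Proof. by have [b ->] := pth_root a; rewrite rmorphXn; exact: pspan_pth. Qed.

Lemma pspan_all t : pspan p t x -> pspan p t y -> forall z, pspan p t z.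
Proof.
move=> tx ty; apply: (chart_ind Hxy) => //.
- exact: pspan_iota.
- by move=> z w; exact: pspanD.
- by move=> z w; exact: pspanM.
- by move=> z z0; exact: pspanV.
Qed.

Let pE (z : K) : z ^+ (p ^ h) = (z ^+ (p ^ h.-1)) ^+ p.
Proof. by rewrite -exprM -expnSr prednK. Qed.

(** y^q = y (x^M + 1)^2 and x^q = x (y^N - 1)^d, so that k(x, y) is generated
    over its p-th powers by x, and also by y. *)
Lemma pspan_x z : pspan p x z.
Proof.
move: z; apply: pspan_all; first exact: pspan_t.
have y0 := y_neq0 Nk Mk Hxy.
have -> : y = (y ^+ (p ^ h.-1)) ^+ p * (y ^+ N ^+ 2)^-1.
  by rewrite -pE qN exprS -exprM mulfK // expf_neq0.
apply: pspanM => //; first exact: pspan_pth.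
apply: pspanV; rewrite ?expf_neq0 //; apply: pspanX => //; rewrite (chart_eq Hxy).
apply: pspanD => //; first by apply: pspanX => //; exact: pspan_t.
by rewrite -(rmorph1 iota); exact: pspan_iota.
Qed.

Lemma pspan_xa a z : pspan p (x - iota a) z.
Proof.
have X : pspan p (x - iota a) x.
  by rewrite -[X in pspan _ _ X](subrK (iota a)); apply: pspanD => //; [exact: pspan_t|exact: pspan_iota].
move: z; apply: pspan_all => //.
have [w ->] := pspan_x y; apply: pspan_sum => // i; apply: pspanM => //.
  exact: pspan_pth.
exact: pspanX.
Qed.

Lemma pspan_y z : pspan p y z.
Proof.
move: z; apply: pspan_all; last exact: pspan_t.
have x0 := x_neq0 Nk Hxy.
have -> : x = (x ^+ (p ^ h.-1)) ^+ p * (x ^+ M ^+ d)^-1.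
  have -> : (x ^+ M) ^+ d = x ^+ (N * 2) by rewrite -exprM -dc; congr (_ ^+ _); lia.
  by rewrite -pE qN exprS mulfK // expf_neq0.
apply: pspanM => //; first exact: pspan_pth.
apply: pspanV; rewrite ?expf_neq0 //; apply: pspanX => //.
have -> : x ^+ M = y ^+ N + iota (-1) by rewrite (chart_eq Hxy) rmorphN1 addrK.
apply: pspanD => //; last exact: pspan_iota.
by apply: pspanX => //; exact: pspan_t.
Qed.

(** There is a place where x is a uniformizer, whence the powers of x are
    independent over the p-th powers. *)
Lemma pspan_free (w : nat -> K) : \sum_(i < p) w i ^+ p * x ^+ i = 0 ->
  forall i, (i < p)%N -> w i = 0.
Proof.
move=> w0 i ip; apply/eqP; apply: contraTT isT => wi.
have [P PC] := place_inhabited Nk Mk Hxy.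
have H01 : (1 : k) ^+ N = 0 ^+ M + 1.
  by rewrite expr1n expr0n gtn_eqF ?add0r // lt0n; apply: contraNneq Mk => ->.
have := centered_coords Nk Mk Hxy H01 PC; rewrite oner_eq0 rmorph0 subr0 => -[_ Px].
have [] := @power_basis_min _ _ iota p P x w (prime_gt0 (pcharf_prime chp)) Px (Ordinal ip) wi.
by rewrite w0 eqxx.
Qed.

(** * Logarithmic differentials *)
Variable D : K -> K.
Hypotheses (HD : derivation D) (Dx : D x = 1).

Let D_iota a : D (iota a) = 0.
Proof. by have [b ->] := pth_root a; rewrite rmorphXn (der_pth HD chK). Qed.

(** The differential dt y^(N-1) / dx of a uniformizer t is a unit. *)
Let der_unif a b (P : place iota) : b ^+ N = a ^+ M + 1 -> centered x y a b P ->
  D (unif iota x y a b) * y ^+ N.-1 != 0 /\ P (D (unif iota x y a b) * y ^+ N.-1) = 0.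
Proof.
move=> Hab PC; have y0 := y_neq0 Nk Mk Hxy; have x0 := x_neq0 Nk Hxy.
have := centered_coords Nk Mk Hxy Hab PC; rewrite /unif; case: eqVneq => b0 [Py Px]; last first.
  rewrite HD.1 (derN HD) D_iota Dx subr0 mul1r expf_neq0 //.
  by rewrite ordX Py mul0rn.
have N0 : (0 < N)%N by rewrite lt0n; apply: contraNneq Nk => ->.
have M0 : (0 < M)%N by rewrite lt0n; apply: contraNneq Mk => ->.
have a0 : a != 0.
  apply: contra_eq_neq Hab => ->; rewrite b0 !expr0n !gtn_eqF //.
  by rewrite add0r eq_sym oner_neq0.
have Dy : D y * y ^+ N.-1 = iota (M%:R / N%:R) * x ^+ M.-1.
  have := congr1 D (chart_eq Hxy); rewrite HD.1 (der1 HD) addr0 !(derX HD) Dx mulr1.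
  rewrite -mulr_natr -[RHS]mulr_natr => e.
  have NK : N%:R != 0 :> K by rewrite -(rmorph_nat iota) fmorph_eq0.
  apply: (mulIf NK); rewrite [D y * _]mulrC e fmorph_div !rmorph_nat.
  by field.
rewrite Dy; have MN : M%:R / N%:R != 0 :> k by rewrite mulf_neq0 ?invr_eq0.
have c0 : iota (M%:R / N%:R) != 0 by rewrite fmorph_eq0.
rewrite mulf_neq0 ?expf_neq0 //; split=> //.
rewrite ord_mul ?expf_neq0 // ord_const // add0r ordX.
by have [_ ->] := ord_unit a0 PC.1; rewrite mul0rn.
Qed.

(** Expand f over the p-th powers in a uniformizer t: df/dt has order at least
    that of f if p divides the latter, and one less otherwise, while dt/dx is
    y^(1-N) up to a unit. *)
Lemma dlog_reg (P : place iota) f : f != 0 -> reg P 0 x ->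
  (p %| P f)%Z = reg P 0 (D f / f * y ^+ N.-1).
Proof.
move=> f0 Px; have [a [b [Hab PC]]] := center_exists Nk Mk Hxy Px.
have ut := centered_unif Nk Mk Hxy Hab PC.
have [w fE] : pspan p (unif iota x y a b) f.
  by rewrite /unif; case: eqP => _; [exact: pspan_y | exact: pspan_xa].
have [u0 Pu] := der_unif Hab PC.
set t := unif iota x y a b in ut fE u0 Pu *.
pose g := \sum_(i < p) (w i ^+ p * t ^+ i.-1) *+ i.
have -> : D f / f * y ^+ N.-1 = g / f * (D t * y ^+ N.-1).
  by rewrite {1}fE (der_expansion HD chK) -/g; field; exact: f0.
have p0 := prime_gt0 (pcharf_prime chp).
have f0' : \sum_(i < p) w i ^+ p * t ^+ i != 0 by rewrite -fE.
apply/idP/idP => [pf | rg].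
  have := reg_deriv p0 ut f0'; rewrite -fE => /(_ pf) rg.
  rewrite -[0]addr0; apply: regM; last by rewrite regE // Pu.
  by rewrite -(subrr (P f)); apply: regM => //; rewrite regE ?invr_eq0 // ordV.
apply: contraTT rg => pf; have := ord_deriv p0 ut chK f0'; rewrite -fE => /(_ pf)[g0 Pg].
have gf : g / f != 0 by rewrite mulf_neq0 ?invr_eq0.
rewrite (regE _ _ (mulf_neq0 gf u0)) (ord_mul _ gf u0) ord_div // Pu Pg.
by move: (P f) => n; lia.
Qed.

End OneChart.
End ChartSpan.

(** * Functions and differentials without poles *)
Section Regular.
Variables (k : closedFieldType) (N c : nat).
Local Notation M := (c * N)%N.
Hypotheses (Nk : N%:R != 0 :> k) (Mk : M%:R != 0 :> k).
Variables (K : fieldType) (iota : {rmorphism k -> K}).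

Let N_gt0 : (0 < N)%N.
Proof. by rewrite lt0n; apply: contraNneq Nk => ->. Qed.
Let M_gt0 : (0 < M)%N.
Proof. by rewrite lt0n; apply: contraNneq Mk => ->. Qed.

Section OneChart.
Variables x y : K.
Hypothesis Hxy : chart N c iota x y.
Local Notation ev1 := (eval1 iota x).

(** The affine coordinate ring is integrally closed.  By conjugation the
    components r y^j of w, with r in k(x), have no pole at finite distance
    either; a pole of r would have an order at least that of x - a, which
    exceeds the order of y^j as j < N. *)
Lemma integrally_closed w : (forall P : place iota, reg P 0 x -> reg P 0 w) ->
  exists G : nat -> {poly k}, w = \sum_(j < N) ev1 (G j) * y ^+ j.
Proof.
move=> Hw; have [zeta zP] := prim_root_exists Nk.
have [sigma [s_iota s_x s_y]] := twist_exists Nk Hxy (prim_expr_order zP).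
have [tw [twE _]] := place_twist Nk Hxy zP s_iota s_x s_y.
have it_reg i (P : place iota) : reg P 0 x -> reg P 0 (iter i sigma w).
  elim: i P => [|i IH] P Px; first exact: Hw.
  have : reg (tw P) 0 (iter i sigma w) by apply: IH; rewrite /reg twE s_x.
  by rewrite iterS /reg twE fmorph_eq0.
have comp_reg j (P : place iota) : reg P 0 x -> reg P 0 (eigen_part N iota zeta sigma j w).
  move=> Px; apply: reg0M; first exact: reg_iota.
  by apply: reg_sum => i _; apply: reg0M; [exact: reg_iota | exact: it_reg].
have /choice[G GP] : forall j, exists g, (j < N)%N -> eigen_part N iota zeta sigma j w = ev1 g * y ^+ j.
  move=> j; have [jN|_] := boolP (j < N)%N; last by exists 0.
  have [g [h [h0 e]]] := eigen_part_form Nk Mk Hxy zP s_iota s_x s_y j w.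
  have [g0|g0] := eqVneq g 0.
    by exists 0; rewrite e g0 eval1_0 !mul0r.
  pose l := gcdp g h; pose g1 := g %/ l; pose h1 := h %/ l.
  have gE : g = g1 * l by rewrite divpK // dvdp_gcdl.
  have hE : h = h1 * l by rewrite divpK // dvdp_gcdr.
  have l0 : l != 0 by rewrite gcdp_eq0 negb_and g0.
  have h10 : h1 != 0 by apply: contraNneq h0 => h10; rewrite hE h10 mul0r.
  have g10 : g1 != 0 by apply: contraNneq g0 => g10; rewrite gE g10 mul0r.
  have ghE : ev1 g / ev1 h = ev1 g1 / ev1 h1.
    by rewrite gE hE !eval1M -mulf_div divff ?mulr1 // (eval1_eq0 Nk Hxy).
  have cop : coprimep g1 h1 by apply: coprimep_div_gcd; rewrite g0.
  have /eqP/size_poly1P[a a0 h1E] : size h1 = 1%N.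
    apply: contrapT => s1; have [a ra] : exists a, root h1 a by apply/closed_rootP/eqP.
    have ga : g1.[a] != 0 by apply: (coprimep_root (p := h1)); rewrite // coprimep_sym.
    have [s [us ms ss]] := fiber_exists Nk Mk Hxy a.
    have [P Ps] : exists P, P \in s.
      case: s us ms ss => [_ _|P s _ _ _]; last by exists P; rewrite inE eqxx.
      by rewrite big_nil => e0; move: N_gt0; rewrite -ltz_nat -e0.
    rewrite ms in Ps; have Px := reg0_of Ps.
    have [a' [b [Hab PC]]] := center_exists Nk Mk Hxy Px.
    have aa := const_uniq Ps PC.1; rewrite -aa in Hab PC.
    have y0 := y_neq0 Nk Mk Hxy.
    have e1 : ev1 g1 != 0 by rewrite (eval1_eq0 Nk Hxy).
    have e2 : ev1 h1 != 0 by rewrite (eval1_eq0 Nk Hxy).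
    have Pg : P (ev1 g1) = 0.
      have /factor_theorem[q qE] : root (g1 - (g1.[a])%:P) a.
        by rewrite rootE hornerD hornerN hornerC subrr.
      have [//|_ ->//] := @ord_unit _ _ _ P g1.[a] (ev1 g1) ga.
      rewrite -(eval1C iota x) -eval1B qE eval1M eval1_XsubC -[1]add0r.
      by apply: regM => //; exact: reg_eval1.
    have Ph : P (x - iota a) <= P (ev1 h1).
      have /factor_theorem[q qE] := ra.
      have q0 : ev1 q != 0.
        by apply: contraNneq e2 => q0; rewrite qE eval1M q0 mul0r.
      rewrite qE eval1M eval1_XsubC ord_mul ?(x_not_const Nk Hxy) // lerDr -regE //.
      exact: reg_eval1.
    have := comp_reg j P Px; rewrite e ghE.
    rewrite regE ?mulf_neq0 ?invr_eq0 ?expf_neq0 // ord_mul ?mulf_neq0 ?invr_eq0 ?expf_neq0 //.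
    rewrite ord_div // Pg ordX sub0r.
    have := centered_coords Nk Mk Hxy Hab PC; case: eqVneq => _ [Py Pxa].
      by move: Ph; rewrite Py Pxa natz addrC subr_ge0 => /le_trans H /H; rewrite lez_nat leqNgt jN.
    by move: Ph; rewrite Py Pxa mul0rn addr0 oppr_ge0 => /le_trans H /H.
  exists (a^-1 *: g1) => _; rewrite e ghE h1E eval1C eval1Z fmorphV.
  by rewrite [_ / _]mulrC.
exists G; rewrite -[LHS](sum_eigen_part Nk iota sigma zP); by apply: eq_bigr => j _; exact: GP.
Qed.

Lemma sum_coords_inj (G G' : nat -> {poly k}) :
  \sum_(j < N) ev1 (G j) * y ^+ j = \sum_(j < N) ev1 (G' j) * y ^+ j ->
  forall j, (j < N)%N -> G j = G' j.
Proof.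
move=> e j jN; apply/eqP; rewrite -subr_eq0; apply/eqP.
have [_ free _] := Hxy; apply: (free (fun j => G j - G' j)) => //.
rewrite -[RHS](subrr (\sum_(j < N) ev1 (G j) * y ^+ j)) {2}e -sumrB.
by apply: eq_bigr => i _; rewrite eval1B mulrBl.
Qed.

End OneChart.

Variables x y : K.
Hypothesis Hxy : chart N c iota x y.
Let Hinv := chart_inv Nk Mk Hxy.
Local Notation ev1 := (eval1 iota x).
Let x0 := x_neq0 Nk Hxy.
Let y0 := y_neq0 Nk Mk Hxy.

(** The differential u dx has no pole: where x is finite, dx is y^(N-1) dt up to
    a unit for a uniformizer t.  Both charts are treated alike, since
    dx = - x^2 d(1/x). *)
Definition regular u :=
  (forall P : place iota, reg P 0 x -> reg P 0 (u * y ^+ N.-1)) /\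
  (forall P : place iota, reg P 0 x^-1 -> reg P 0 (- x ^+ 2 * u * (y / x ^+ c) ^+ N.-1)).

Let pole_x : exists P : place iota, P x = -1.
Proof.
have [P PC] := place_inhabited Nk Mk Hinv.
have H01 : (1 : k) ^+ N = 0 ^+ M + 1 by rewrite expr1n expr0n gtn_eqF ?add0r.
have := centered_coords Nk Mk Hinv H01 PC; rewrite oner_eq0 rmorph0 subr0 ordV => -[_ e].
by exists P; rewrite -e opprK.
Qed.

Let ord_ev1 (P : place iota) g : P x = -1 -> g != 0 -> P (ev1 g) = - (size g).-1%:Z.
Proof.
move=> Px g0; have [s gE] := closed_field_poly_normal g.
have lg : lead_coef g != 0 by rewrite lead_coef_eq0.
rewrite {1}gE {2}gE size_scale // size_prod_XsubC eval1Z.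
rewrite ord_mul ?fmorph_eq0 // ?(eval1_eq0 Nk Hxy) ?monic_neq0 ?monic_prod_XsubC //.
rewrite ord_const // add0r /=; elim: s {gE} => [|a s IH].
  by rewrite big_nil eval1_1 ord_1.
rewrite big_cons eval1M eval1_XsubC ord_mul ?(x_not_const Nk Hxy) //; last first.
  by rewrite (eval1_eq0 Nk Hxy) monic_neq0 ?monic_prod_XsubC.
rewrite IH; have -> : P (x - iota a) = -1.
  rewrite -[RHS]Px; apply: (ord_dominant x0 _).2.
  by rewrite regN Px addNr reg_iota.
by rewrite /= -opprD; lia.
Qed.

(** The regular differentials are spanned by the x^(i-1) y^(-s) dx with
    0 < i < c s and s < N; here s = N - 1 - j. *)
Lemma regular_coords u : regular u -> exists G : nat -> {poly k},
  u * y ^+ N.-1 = \sum_(j < N) ev1 (G j) * y ^+ j /\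
  forall j, (j < N)%N -> (size (G j) <= (c * (N.-1 - j)).-1)%N.
Proof.
move=> [R1 R2]; have [G GE] := integrally_closed Hxy R1; exists G; split=> // j jN.
have [G' GE'] := integrally_closed Hinv R2.
have [P Px] := pole_x.
have [zeta zP] := prim_root_exists Nk.
have [sigma [s_iota s_x s_y]] := twist_exists Nk Hxy (prim_expr_order zP).
have s_x' : sigma x^-1 = x^-1 by rewrite fmorphV s_x.
pose F j := ev1 (G j) * y ^+ j.
pose F' j := - x ^- 2 * eval1 iota x^-1 (G' j) * x ^+ (c * (N.-1 - j)) * y ^+ j.
have FF : \sum_(j < N) F j = \sum_(j < N) F' j.
  rewrite -GE; apply: (mulfI (_ : - x ^+ 2 / (x ^+ c) ^+ N.-1 != 0)).
    by rewrite mulf_neq0 ?invr_eq0 ?oppr_eq0 ?expf_neq0.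
  transitivity (- x ^+ 2 * u * (y / x ^+ c) ^+ N.-1).
    by rewrite expr_div_n; ring.
  rewrite GE' mulr_sumr; apply: eq_bigr => i _; rewrite /F' expr_div_n.
  have -> : x ^+ (c * (N.-1 - i)) = (x ^+ c) ^+ N.-1 / (x ^+ c) ^+ i.
    have iN : (i <= N.-1)%N by rewrite -ltnS prednK.
    by rewrite exprM -{2}(subnK iN) exprD mulfK // !expf_neq0.
  by field; rewrite x0 !expf_neq0.
have eF : forall i, (i < N)%N -> sigma (F i) = iota (zeta ^+ i) * F i.
  by move=> i _; rewrite rmorphM /= sigma_ev1 // rmorphXn s_y exprMn -rmorphXn mulrCA.
have eF' : forall i, (i < N)%N -> sigma (F' i) = iota (zeta ^+ i) * F' i.
  move=> i _; rewrite /F' !rmorphM /= sigma_ev1 // rmorphN fmorphV !rmorphXn s_x s_y exprMn.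
  by ring.
have : F j = F' j by rewrite -(eigen_sum Nk zP s_iota jN eF) FF (eigen_sum Nk zP s_iota jN eF').
rewrite /F /F' => /(mulIf (expf_neq0 j y0)) e.
have [->|Gj] := eqVneq (G j) 0; first by rewrite size_poly0.
have e0 : ev1 (G j) != 0 by rewrite (eval1_eq0 Nk Hxy).
have G'0 : eval1 iota x^-1 (G' j) != 0.
  by apply: contraNneq e0 => G'0; rewrite e G'0 mulr0 mul0r.
have := congr1 P e; rewrite ord_ev1 // !ord_mul ?mulf_neq0 ?oppr_eq0 ?invr_eq0 ?expf_neq0 //.
rewrite ordN ordV !ordX Px.
have : reg P 0 (eval1 iota x^-1 (G' j)).
  by apply: reg_eval1; rewrite regE ?invr_eq0 // ordV Px.
rewrite regE //; move: (P _) => m m0.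
have : (0 < size (G j))%N by rewrite size_poly_gt0.
move: (size _) (c * _)%N => a b a0; rewrite !mulNrn !natz; lia.
Qed.

Lemma regularD u v : regular u -> regular v -> regular (u + v).
Proof.
move=> [u1 u2] [v1 v2]; split=> P Px; first by rewrite mulrDl regD ?u1 ?v1.
by rewrite mulrDr mulrDl regD ?u2 ?v2.
Qed.

Lemma regularZ a u : regular u -> regular (iota a * u).
Proof.
move=> [u1 u2]; split=> P Px.
  by rewrite -mulrA; apply: reg0M; [exact: reg_iota | exact: u1].
have -> : - x ^+ 2 * (iota a * u) * (y / x ^+ c) ^+ N.-1 =
  iota a * (- x ^+ 2 * u * (y / x ^+ c) ^+ N.-1) by ring.
by apply: reg0M; [exact: reg_iota | exact: u2].
Qed.

Lemma regular0 : regular 0.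
Proof. by split=> P _; rewrite ?mulr0 mul0r reg0. Qed.

Lemma regular_sum (I : Type) (r : seq I) (Q : pred I) (F : I -> K) :
  (forall i, Q i -> regular (F i)) -> regular (\sum_(i <- r | Q i) F i).
Proof. by move=> H; apply: big_ind => //; [exact: regular0 | exact: regularD]. Qed.

Lemma regular_monomial i s : (0 < i < c * s)%N -> (s < N)%N ->
  regular (x ^+ i.-1 * y ^- s).
Proof.
move=> /andP[i0 ic] sN; have sN' : (s <= N.-1)%N by rewrite -ltnS prednK.
split=> P Px.
  have -> : x ^+ i.-1 * y ^- s * y ^+ N.-1 = x ^+ i.-1 * y ^+ (N.-1 - s).
    by rewrite -{1}(subnK sN') exprD; field; rewrite expf_neq0.
  by apply: reg0M; apply: reg0X => //; exact: (reg_y Nk Mk Hxy).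
have -> : - x ^+ 2 * (x ^+ i.-1 * y ^- s) * (y / x ^+ c) ^+ N.-1 =
    - (x^-1 ^+ (c * s - i).-1 * (y / x ^+ c) ^+ (N.-1 - s)).
  have e : x ^+ (c * s) = x ^+ (c * s - i).-1 * x ^+ 2 * x ^+ i.-1.
    by rewrite -!exprD; congr (_ ^+ _); lia.
  rewrite -{1}(subnK sN') exprD [(y / _) ^+ s]expr_div_n -exprM e exprVn.
  by field; rewrite x0 !expf_neq0.
rewrite regN; apply: reg0M; apply: reg0X => //; exact: (reg_y Nk Mk Hinv).
Qed.

(** A logarithmic derivative is regular when all orders are multiples of p. *)
Lemma dlog_regular (p h d : nat) (D : K -> K) f :
  p \in [pchar k] -> (0 < h)%N -> (p ^ h = (N * 2).+1)%N -> (d * c = 2)%N ->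
  derivation D -> D x = 1 -> f != 0 ->
  (forall P : place iota, (p %| P f)%Z) <-> regular (D f / f).
Proof.
move=> chp h0 qN dc HD Dx f0.
have HD2 : derivation (fun z => - x ^+ 2 * D z).
  by split=> z w; rewrite ?HD.1 ?HD.2; ring.
have Dx2 : - x ^+ 2 * D x^-1 = 1 by rewrite (derV HD) // Dx; field.
have E1 P := dlog_reg chp h0 qN dc Hxy HD Dx f0 (P := P).
have E2 P := dlog_reg chp h0 qN dc Hinv HD2 Dx2 f0 (P := P).
split=> [pf | [R1 R2] P].
  split=> P Px; first by rewrite -E1.
  by have := E2 P Px; rewrite pf mulrA => <-.
have [Px|Px] := reg_or_inv Nk Mk Hxy P; first by rewrite E1 // R1.
have Px' : reg P 0 x^-1 by apply: reg_le Px.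
by rewrite E2 //; have := R2 P Px'; rewrite mulrA.
Qed.

End Regular.

Lemma prime_dvd_fact p n : prime p -> (p %| n`!)%N -> (p <= n)%N.
Proof.
move=> p_pr; elim: n => [|n IH]; first by rewrite fact0 dvdn1 => /eqP e; rewrite e in p_pr.
rewrite factS Euclid_dvdM // => /orP[/dvdn_leq -> //|/IH]; exact: leqW.
Qed.

Lemma digit_bin (R : nzRingType) p m l : p \in [pchar R] -> (m < p)%N ->
  ('C(m, l)%:R != 0 :> R) = (l <= m)%N.
Proof.
move=> chp mp; rewrite -(dvdn_pcharf chp); case: leqP => [lm|/bin_small->]; last by rewrite dvdn0.
apply/negP => pC; have := prime_dvd_fact (n := m) (pcharf_prime chp).
by rewrite -(bin_fact lm) dvdn_mulr // leqNgt mp => /(_ isT).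
Qed.

(** * Rotation of the indices *)
Section Rotation.
Variables (p h e A : nat).
Hypotheses (p_gt0 : (0 < p)%N) (h_gt0 : (0 < h)%N).
Hypotheses (e_gt0 : (0 < e)%N) (ep : coprime e p) (qA : (p ^ h = (e * A).+1)%N).

(** The rotation of digits on the multiples of e, divided by e: it is the
    division by p modulo A. *)
Definition rotq i := (rot_digits p h (e * i) %/ e)%N.

Let e_rot i : (e %| rot_digits p h (e * i))%N.
Proof.
rewrite -(Gauss_dvdr _ ep) rot_digitsP // qA subn1 /=.
by apply: dvdn_add; [exact: dvdn_mulr | apply: dvdn_mull; exact: dvdn_mulr].
Qed.

Lemma rotqE i : (e * rotq i = rot_digits p h (e * i))%N.
Proof. by rewrite /rotq mulnC divnK. Qed.

Lemma p_rotq i : (p * rotq i = i + (e * i) %% p * A)%N.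
Proof.
apply/eqP; rewrite -(eqn_pmul2l e_gt0) mulnCA rotqE rot_digitsP // qA subn1 /=.
by rewrite mulnDr [(e * (_ * A))%N]mulnCA.
Qed.

Let lt_q i : (i <= A)%N -> (e * i < p ^ h)%N.
Proof. by move=> iA; rewrite qA ltnS leq_mul2l iA orbT. Qed.

Lemma rotq_le i : (i <= A)%N -> (rotq i <= A)%N.
Proof.
by move=> iA; rewrite -(leq_pmul2l e_gt0) rotqE -ltnS -qA rot_digits_lt ?lt_q.
Qed.

Lemma rotq_inj i j : (i <= A)%N -> (j <= A)%N -> rotq i = rotq j -> i = j.
Proof.
move=> iA jA ij; apply/eqP; rewrite -(eqn_pmul2l e_gt0); apply/eqP.
by apply: (rot_digits_inj p_gt0 h_gt0); rewrite ?lt_q // -!rotqE ij.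
Qed.

Lemma iter_rotq t i : (e * iter t rotq i = iter t (rot_digits p h) (e * i))%N.
Proof. by elim: t => //= t IH; rewrite rotqE IH. Qed.

Lemma iter_rotq_full i : (i <= A)%N -> iter h rotq i = i.
Proof.
move=> iA; apply/eqP; rewrite -(eqn_pmul2l e_gt0) iter_rotq.
by rewrite iter_rot_digits_full ?lt_q.
Qed.

Lemma rotq_gt0 i : (0 < i)%N -> (0 < rotq i)%N.
Proof.
move=> i0; have : (0 < p * rotq i)%N by rewrite p_rotq addn_gt0 i0.
by rewrite muln_gt0 => /andP[].
Qed.

End Rotation.

(** * The Cartier operator on monomial differentials *)
Section CartierAction.
Variables (k : closedFieldType) (p h N c d : nat).
Local Notation M := (c * N)%N.
Hypotheses (chp : p \in [pchar k]) (h_gt0 : (0 < h)%N) (p_gt2 : (2 < p)%N).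
Hypotheses (qN : (p ^ h = (N * 2).+1)%N) (dc : (d * c = 2)%N).

Let p_pr := pcharf_prime chp.
Let p_gt0 : (0 < p)%N := prime_gt0 p_pr.

Let d_gt0 : (0 < d)%N.
Proof. by rewrite lt0n; apply/eqP => d0; move: dc; rewrite d0. Qed.
Let dle : (d <= 2)%N. Proof. by apply: dvdn_leq => //; rewrite -dc dvdn_mulr. Qed.
Let small_coprime e : (0 < e)%N -> (e <= 2)%N -> coprime e p.
Proof.
move=> e0 e2; rewrite coprime_sym prime_coprime //; apply/negP => /dvdn_leq -/(_ e0).
by rewrite leqNgt (leq_ltn_trans e2).
Qed.
Let d_coprime : coprime d p := small_coprime d_gt0 dle.
Let two_coprime : coprime 2 p := small_coprime (isT : 0 < 2)%N (leqnn 2).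
Let qd : (p ^ h = (d * M).+1)%N. Proof. by rewrite mulnA dc qN mulnC. Qed.
Let q2 : (p ^ h = (2 * N).+1)%N. Proof. by rewrite qN mulnC. Qed.

(** The pair (i, s) stands for the differential x^(i-1) y^(-s) dx. *)
Definition form_index := ('I_M.+1 * 'I_N.+1)%type.

Implicit Types m : form_index.

Definition rot_form m : form_index := (inord (rotq p h d m.1), inord (rotq p h 2 m.2)).

Lemma rot_form1 m : (rot_form m).1 = rotq p h d m.1 :> nat.
Proof. by rewrite inordK // ltnS (rotq_le p_gt0 h_gt0 d_gt0 d_coprime qd) // -ltnS. Qed.

Lemma rot_form2 m : (rot_form m).2 = rotq p h 2 m.2 :> nat.
Proof. by rewrite inordK // ltnS (rotq_le p_gt0 h_gt0 _ two_coprime q2) // -ltnS. Qed.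

Lemma rot_form_inj : injective rot_form.
Proof.
move=> [i s] [i' s'] e; congr (_, _); apply: val_inj => /=.
  apply: (rotq_inj p_gt0 h_gt0 d_gt0 d_coprime qd); rewrite 1?leq_ord //.
  by rewrite -(rot_form1 (i, s)) -(rot_form1 (i', s')) e.
apply: (rotq_inj p_gt0 h_gt0 _ two_coprime q2); rewrite 1?leq_ord //.
by rewrite -(rot_form2 (i, s)) -(rot_form2 (i', s')) e.
Qed.

Lemma iter_rot1 t m : (iter t rot_form m).1 = iter t (rotq p h d) m.1 :> nat.
Proof. by elim: t => //= t IH; rewrite rot_form1 IH. Qed.

Lemma iter_rot2 t m : (iter t rot_form m).2 = iter t (rotq p h 2) m.2 :> nat.
Proof. by elim: t => //= t IH; rewrite rot_form2 IH. Qed.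

Lemma iter_rot_full m : iter h rot_form m = m.
Proof.
case: m => i s; rewrite [iter _ _ _]surjective_pairing; congr (_, _); apply: val_inj => /=.
  by rewrite iter_rot1 (iter_rotq_full p_gt0 h_gt0 d_gt0 d_coprime qd) // -ltnS.
by rewrite iter_rot2 (iter_rotq_full p_gt0 h_gt0 _ two_coprime q2) // -ltnS.
Qed.

(** The factor that appears when the Cartier operator is applied to the
    differential of index m *)
Definition cartier_coef m : nat := 'C((2 * m.2) %% p, (d * m.1) %% p).

Definition holomorphic m := (0 < m.1 < c * m.2)%N && (m.2 < N)%N.

Definition good_index m := good_pair p d h (d * m.1) (2 * m.2).

Lemma cartier_coef_neq0 m : ((cartier_coef m)%:R != 0 :> k) = ((d * m.1) %% p <= (2 * m.2) %% p)%N.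
Proof. by rewrite (digit_bin _ chp) ?ltn_mod. Qed.

(** The last digits of the iterates of the rotation are all the digits. *)
Lemma goodP m : reflect (holomorphic m /\ forall t, (t < h)%N -> (cartier_coef (iter t rot_form m))%:R != 0 :> k) (good_index m).
Proof.
have m1 : (d * m.1 < p ^ h)%N by rewrite qd ltnS leq_mul2l -ltnS ltn_ord orbT.
have m2 : (2 * m.2 < p ^ h)%N by rewrite q2 ltnS leq_mul2l -ltnS ltn_ord orbT.
have -> : good_index m = holomorphic m && dominated p h (d * m.1) (2 * m.2).
  rewrite /good_index /good_pair /holomorphic !dvdn_mulr //= muln_gt0 d_gt0 /=.
  rewrite q2 /= ltn_pmul2l // -dc -mulnA ltn_pmul2l // andbC -!andbA.
  by [].
apply: (iffP andP) => [[H /(dominated_iter p_gt0 m1 m2) dom]|[H dom]]; split=> //.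
  move=> t th; rewrite cartier_coef_neq0 iter_rot1 iter_rot2.
  by rewrite (iter_rotq p_gt0 h_gt0 d_coprime qd) (iter_rotq p_gt0 h_gt0 two_coprime q2) dom.
apply/(dominated_iter p_gt0 m1 m2) => t th; have := dom t th.
by rewrite cartier_coef_neq0 iter_rot1 iter_rot2 (iter_rotq p_gt0 h_gt0 d_coprime qd) (iter_rotq p_gt0 h_gt0 two_coprime q2).
Qed.

(** The Cartier operator preserves the regular differentials. *)
Lemma holomorphic_rot m : holomorphic m -> (cartier_coef m)%:R != 0 :> k -> holomorphic (rot_form m).
Proof.
rewrite cartier_coef_neq0 => /andP[/andP[i0 ic] sN] lm; rewrite /holomorphic rot_form1 rot_form2.
rewrite (rotq_gt0 p_gt0 h_gt0 d_gt0 d_coprime qd) //=.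
have e1 := p_rotq p_gt0 h_gt0 d_gt0 d_coprime qd m.1.
have e2 := p_rotq p_gt0 h_gt0 (isT : (0 < 2)%N) two_coprime q2 m.2.
apply/andP; split.
  rewrite -(ltn_pmul2l p_gt0) mulnCA e1 e2 mulnDr.
  rewrite [(c * (_ * N))%N]mulnCA -addSn leq_add // leq_mul2r lm orbT //.
rewrite -(ltn_pmul2l p_gt0) e2.
have : ((2 * m.2) %% p < p)%N by rewrite ltn_mod.
move: (_ %% p)%N => l lp; apply: (@leq_trans (l.+1 * N)); first by rewrite mulSn ltn_add2r.
by rewrite leq_mul2r lp orbT.
Qed.

Lemma good_rot m : good_index (rot_form m) = good_index m.
Proof.
have H m' : good_index m' -> good_index (rot_form m').
  move=> /goodP[hm lm]; apply/goodP; split; first exact: (holomorphic_rot hm (lm 0%N h_gt0)).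
  move=> t th; rewrite -iterSr; have [th'|] := ltnP t.+1 h; first exact: lm.
  rewrite leq_eqVlt ltnNge th orbF => /eqP e; rewrite -e iter_rot_full.
  exact: (lm 0%N h_gt0).
apply/idP/idP; last exact: H.
have Hi t m' : good_index m' -> good_index (iter t rot_form m') by elim: t => //= t IH /IH; exact: H.
move/(Hi h.-1); rewrite -iterSr prednK // iter_rot_full; exact.
Qed.

Variables (K : fieldType) (iota : {rmorphism k -> K}) (x y : K).
Hypothesis Hxy : chart N c iota x y.
Let Nk := N_unit chp h_gt0 qN.
Let Mk := M_unit chp h_gt0 qN dc.
Let chK := pchar_field iota chp.
Let x0 : x != 0 := x_neq0 Nk Hxy.
Let y0 : y != 0 := y_neq0 Nk Mk Hxy.

Definition monomial_form m : K := x ^+ (m.1).-1 * y ^- m.2.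

Let spanx : forall z, exists w : nat -> K, z = \sum_(i < p) w i ^+ p * x ^+ i :=
  pspan_x chp h_gt0 qN dc Hxy.
Let freex := pspan_free chp h_gt0 qN dc Hxy.
Local Notation C := (cartier spanx).

Let C_power l n : (l < p)%N -> (n < p)%N ->
  C (x ^+ (p.-1 + M * (n + p.-1 * l))) = if n == l then x ^+ (M * l) else 0.
Proof.
move=> lp np; rewrite (cartier_monom chK spanx freex).
have Mp : coprime p M.
  by rewrite prime_coprime // (dvdn_pcharf chp).
have p1 : (p.-1 < p)%N by rewrite prednK.
have pl : (p.-1 * l + l = l * p)%N by rewrite addnC -mulSn prednK // mulnC.
have -> : ((p.-1 + M * (n + p.-1 * l)) %% p == p.-1)%N = (n == l).
  rewrite -[X in (_ == X)%N](modn_small p1) -[X in (_ == X %% _)%N]addn0 eqn_modDl mod0n.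
  rewrite -/(dvdn p _) Gauss_dvdr // /dvdn -[0%N in LHS](mod0n p) -(eqn_modDr l) add0n.
  by rewrite -addnA pl addnC modnMDl !modn_small.
case: eqP => // ->; congr (_ ^+ _).
by rewrite addnC [(l + _)%N]addnC pl mulnA divnMDl // divn_small ?addn0.
Qed.

(** With p i' = i + l M and p s' = s + m N, where l and m are the last digits
    of d i and 2 s, the function x^(i-1) y^(-s) is a p-th power times
    x^(p-1-lM) (1 + x^M)^m; the operator extracts the term x^(p-1). *)
Lemma cartier_monomial m : (0 < m.1)%N -> C (monomial_form m) = monomial_form (rot_form m) *+ cartier_coef m.
Proof.
move=> i0; set l := ((d * m.1) %% p)%N; set n := ((2 * m.2) %% p)%N.
have e1 : (p * (rot_form m).1 = m.1 + l * M)%N.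
  by rewrite rot_form1 (p_rotq p_gt0 h_gt0 d_gt0 d_coprime qd).
have e2 : (p * (rot_form m).2 = m.2 + n * N)%N.
  by rewrite rot_form2 (p_rotq p_gt0 h_gt0 (isT : (0 < 2)%N) two_coprime q2).
have i'0 : (0 < (rot_form m).1)%N.
  by rewrite rot_form1 (rotq_gt0 p_gt0 h_gt0 d_gt0 d_coprime qd).
have lp : (l < p)%N by rewrite ltn_mod.
have np : (n < p)%N by rewrite ltn_mod.
have yE : y ^- m.2 = (y ^- (rot_form m).2) ^+ p * (x ^+ M + 1) ^+ n.
  rewrite -(chart_eq Hxy) -exprM exprVn -exprM [((rot_form m).2 * p)%N]mulnC e2.
  by rewrite [(n * N)%N]mulnC exprD invfM mulfVK // expf_neq0.
have xE : x ^+ (m.1).-1 = (x ^+ ((rot_form m).1).-1 * x ^- (M * l)) ^+ p * x ^+ (p.-1 + M * (p.-1 * l)).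
  have xl : x ^+ (M * l) ^+ p != 0 by rewrite !expf_neq0.
  rewrite exprMn exprVn mulrAC; apply: (mulIf xl); rewrite mulfVK //.
  rewrite -!exprM -!exprD; congr (_ ^+ _).
  have : (p * (rot_form m).1 = ((rot_form m).1).-1 * p + p)%N by rewrite -{1}(prednK i'0) mulnSr mulnC.
  have : (M * l * p = M * (p.-1 * l) + M * l)%N.
    by rewrite -mulnDr addnC -mulSn prednK // mulnA mulnAC.
  move: (((rot_form m).1).-1 * p)%N (M * (p.-1 * l))%N (M * l * p)%N e1 => a b b' e1 -> e3.
  by move: e1; rewrite e3 [(l * M)%N]mulnC; move: (M * l)%N; lia.
pose z := x ^+ ((rot_form m).1).-1 * x ^- (M * l) * y ^- (rot_form m).2.
have -> : monomial_form m = z ^+ p * \sum_(j < n.+1) x ^+ (p.-1 + M * (j + p.-1 * l)) *+ 'C(n, j).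
  rewrite /monomial_form yE xE exprD1n.
  rewrite [z ^+ p]exprMn [LHS]mulrACA; congr (_ * _).
  rewrite mulr_sumr; apply: eq_bigr => j _; rewrite mulrnAr -exprM -exprD.
  by rewrite -addnA -mulnDr [(j + _)%N]addnC.
rewrite (cartierM chK spanx freex) (cartier_sum chK spanx freex).
have CMn u a : C (u *+ a) = C u *+ a.
  elim: a => [|a IH]; first by rewrite !mulr0n (cartier0 chK spanx freex).
  by rewrite !mulrS (cartierD chK spanx freex) IH.
rewrite (eq_bigr (fun j : 'I_n.+1 => (if j == l :> nat then x ^+ (M * l) else 0) *+ 'C(n, j))).
  have -> : \sum_(j < n.+1) (if j == l :> nat then x ^+ (M * l) else 0) *+ 'C(n, j) =
      x ^+ (M * l) *+ 'C(n, l).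
    have [ln|nl] := ltnP l n.+1.
      rewrite (bigD1 (Ordinal ln)) //= eqxx big1 ?addr0 // => j.
      by rewrite -val_eqE /= => /negPf->; rewrite mul0rn.
    rewrite bin_small // mulr0n big1 // => j _.
    by rewrite ltn_eqF ?mul0rn // (leq_trans (ltn_ord j)).
  by rewrite mulrnAr /z mulrAC mulfVK // expf_neq0.
move=> j _; rewrite CMn C_power //; exact: leq_ltn_trans (leq_ord j) np.
Qed.

(** * Differentials fixed by the Cartier operator *)

(** The coordinates are given by their p-th roots a m, because the Cartier
    operator is linear in these. *)
Definition diff_of (a : {ffun form_index -> k}) : K := \sum_m iota (a m) ^+ p * monomial_form m.

Lemma diff_of_regular (a : {ffun form_index -> k}) : (forall m, ~~ holomorphic m -> a m = 0) ->
  regular N c iota x y (diff_of a).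
Proof.
move=> a0; apply: regular_sum => m _; have [hm|/a0->] := boolP (holomorphic m); last first.
  by rewrite rmorph0 expr0n gtn_eqF // mul0r; exact: regular0.
rewrite -rmorphXn; apply: regularZ; case/andP: hm => ? ?.
exact: regular_monomial.
Qed.

Lemma cartier_diff_of (a : {ffun form_index -> k}) : (forall m, ~~ holomorphic m -> a m = 0) ->
  C (diff_of a) = \sum_m iota (a m * (cartier_coef m)%:R) * monomial_form (rot_form m).
Proof.
move=> a0; rewrite (cartier_sum chK spanx freex); apply: eq_bigr => m _.
rewrite (cartierM chK spanx freex); have [hm|/a0->] := boolP (holomorphic m); last first.
  by rewrite mul0r rmorph0 !mul0r.
rewrite cartier_monomial; last by case/andP: hm => /andP[].
by rewrite rmorphM rmorph_nat -[RHS]mulrA mulr_natl mulrnAr.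
Qed.

Let N_gt0 : (0 < N)%N.
Proof. by rewrite lt0n; apply: contraNneq Nk => ->. Qed.

Let expp0 : (0 : k) ^+ p = 0.
Proof. by rewrite expr0n gtn_eqF. Qed.

Definition form_coords (a : {ffun form_index -> k}) j : {poly k} :=
  \poly_(t < M) a (inord t.+1, inord (N.-1 - j)) ^+ p.

Lemma diff_of_coords (a : {ffun form_index -> k}) : (forall m, ~~ holomorphic m -> a m = 0) ->
  diff_of a * y ^+ N.-1 = \sum_(j < N) eval1 iota x (form_coords a j) * y ^+ j.
Proof.
move=> a0; have -> : diff_of a = \sum_i \sum_s iota (a (i, s)) ^+ p * monomial_form (i, s).
  by rewrite pair_bigA; apply: eq_bigr => -[i s] _.
rewrite exchange_big big_ord_recr /= [X in _ + X]big1 ?addr0 => [|i _]; last first.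
  by rewrite a0 ?rmorph0 ?expr0n ?gtn_eqF ?mul0r // /holomorphic /= ltnn andbF.
rewrite [RHS](reindex_inj rev_ord_inj) mulr_suml; apply: eq_bigr => s _ /=.
have sN : (s <= N.-1)%N by rewrite -ltnS prednK.
have Ns : (N.-1 - (N - s.+1) = s)%N by rewrite subnS -subn1 -subnDA; lia.
rewrite (eval1_coef _ _ (size_poly _ _)) !mulr_suml big_ord_recl /= a0; last first.
  by rewrite /holomorphic.
rewrite rmorph0 expr0n gtn_eqF // !mul0r add0r; apply: eq_bigr => t _.
rewrite coef_poly ltn_ord Ns rmorphXn /monomial_form /=.
have -> : fintype.lift fintype.ord0 t = inord t.+1 :> 'I_M.+1.
  by apply: val_inj; rewrite /= inordK // ltnS.
have -> : widen_ord (leqnSn N) s = inord s :> 'I_N.+1.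
  by apply: val_inj; rewrite /= inordK // ltnS ltnW.
have -> : (N - s.+1 = N.-1 - s)%N by lia.
by rewrite add0n -{1}(subnK sN) exprD; field; rewrite expf_neq0.
Qed.

Lemma diff_of_inj (a b : {ffun form_index -> k}) : (forall m, ~~ holomorphic m -> a m = 0) ->
  (forall m, ~~ holomorphic m -> b m = 0) -> diff_of a = diff_of b -> a = b.
Proof.
move=> a0 b0 ab; apply/ffunP => m; have [hm|hm] := boolP (holomorphic m); last by rewrite a0 ?b0.
have := diff_of_coords b0; rewrite -ab (diff_of_coords a0) => /(sum_coords_inj Hxy) e.
case: m hm => i s hm; have /andP[/andP[/= i0 ic] sN] := hm.
have sN' : (s <= N.-1)%N by rewrite -ltnS prednK.
have /polyP/(_ i.-1) : form_coords a (N.-1 - s) = form_coords b (N.-1 - s) by apply: e; lia.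
have iM : (i.-1 < M)%N by rewrite prednK // -ltnS.
rewrite !coef_poly iM prednK // subKn // !inord_val; exact: (expIp chp).
Qed.

Lemma regular_diff_of u : regular N c iota x y u -> exists2 a : {ffun form_index -> k},
  forall m, ~~ holomorphic m -> a m = 0 & u = diff_of a.
Proof.
move=> /(regular_coords Nk Mk Hxy)[G [uE sG]].
have /choice[rt rtP] := pth_root chp.
pose a : {ffun form_index -> k} := [ffun m : form_index =>
  if holomorphic m then rt ((G (N.-1 - m.2)%N)`_(m.1).-1) else 0].
have a0 m : ~~ holomorphic m -> a m = 0 by move=> hm; rewrite ffunE (negPf hm).
exists a => //; apply: (mulIf (expf_neq0 N.-1 y0)); rewrite uE diff_of_coords //.
apply: eq_bigr => j _; congr (eval1 _ _ _ * _); apply/polyP => t; rewrite coef_poly.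
have jN : (j <= N.-1)%N by rewrite -ltnS prednK.
have sj := sG j (ltn_ord j).
have jN' : (N.-1 - j < N)%N by rewrite (leq_ltn_trans (leq_subr _ _)) // prednK.
have cM : (c * (N.-1 - j) <= M)%N by rewrite leq_mul2l ltnW ?orbT.
case: ifP => [tM|/negbT]; last first.
  rewrite -leqNgt => Mt; apply: nth_default; apply: leq_trans sj (leq_trans (leq_pred _) _).
  exact: leq_trans cM Mt.
rewrite ffunE /holomorphic /= !inordK ?ltnS // ?(ltnW jN') // jN' andbT subKn // -ltn_predRL.
case: ifP => [_|/negbT]; first exact: rtP.
by rewrite -leqNgt expp0 => le; rewrite nth_default // (leq_trans sj).
Qed.

(** A differential fixed by the Cartier operator is supported on the good
    monomials, those which no power of the operator kills, and its coordinates
    there satisfy a cyclic system. *)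
Lemma fixed_system (a : {ffun form_index -> k}) : (forall m, ~~ holomorphic m -> a m = 0) ->
  C (diff_of a) = diff_of a <->
  frob_system p (enum good_index) rot_form (fun=> 1%N) (fun m => (cartier_coef m)%:R^-1) a.
Proof.
move=> a0.
have holomorphic_rot0 m : ~~ holomorphic (rot_form m) -> a m * (cartier_coef m)%:R = 0.
  have [hm|/a0->] := boolP (holomorphic m); last by rewrite mul0r.
  by apply: contraNeq; rewrite mulf_eq0 negb_or => /andP[_ lm]; exact: holomorphic_rot.
have key : C (diff_of a) = diff_of a <-> forall m, a (rot_form m) ^+ p = a m * (cartier_coef m)%:R.
  have /choice[rt rtP] := pth_root chp.
  have [g gK Kg] := injF_bij rot_form_inj.
  pose b : {ffun form_index -> k} := [ffun m => rt (a (g m) * (cartier_coef (g m))%:R)].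
  have bE m : b (rot_form m) ^+ p = a m * (cartier_coef m)%:R by rewrite ffunE gK -rtP.
  have CE : C (diff_of a) = diff_of b.
    rewrite cartier_diff_of // /diff_of [RHS](reindex_inj rot_form_inj); apply: eq_bigr => m _.
    by rewrite -rmorphXn bE.
  have b0 m : ~~ holomorphic m -> b m = 0.
    rewrite -{1}(Kg m) => /holomorphic_rot0; rewrite -bE Kg => /eqP.
    by rewrite expf_eq0 p_gt0 => /eqP.
  rewrite CE; split=> [/(diff_of_inj b0 a0) ba m | e]; first by rewrite -{1}ba bE.
  congr diff_of; apply/ffunP => m.
  by apply: (expIp chp); rewrite -(Kg m) bE e.
apply: (iff_trans key).
split=> [e | [e a00] m]; last first.
  have [gm|gm] := boolP (good_index m); last first.
    have gm' : ~~ good_index (rot_form m) by rewrite good_rot.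
    by rewrite !a00 ?mem_enum // mul0r expp0.
  rewrite (e m) ?mem_enum // expn1 mulrAC mulVf ?mul1r //.
  by have /goodP[_ /(_ 0%N h_gt0)] := gm.
have ne m : a (rot_form m) != 0 -> a m != 0 /\ (cartier_coef m)%:R != 0 :> k.
  move=> am; apply/andP; rewrite -negb_or -mulf_eq0 -e expf_eq0 p_gt0 //.
have ne_iter t m : (t <= h)%N -> a m != 0 -> a (iter (h - t) rot_form m) != 0.
  elim: t => [|t IH] th am; first by rewrite subn0 iter_rot_full.
  have := IH (ltnW th) am; rewrite -(subnSK th) iterS => /ne[].
  by [].
have good_supp m : a m != 0 -> good_index m.
  move=> am; apply/goodP; split; first by apply: contraNT am => /a0->.
  move=> t th; have := @ne_iter (h - t.+1)%N m (leq_subr _ _) am.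
  by rewrite subKn // iterS => /ne[].
split=> m; rewrite mem_enum => gm; last by apply/eqP; apply: contraNT gm => /good_supp.
rewrite expn1 e mulrC mulfK //.
by have /goodP[_ /(_ 0%N h_gt0)] := gm.
Qed.

End CartierAction.

(** * The p-torsion of the Jacobian *)
Section Classes.
Variables (k K : fieldType) (iota : {rmorphism k -> K}).

Definition div_class (D : divisor0 iota) : jacobian iota := \pi_(jacobian iota)%qT D.

Lemma div_class_eq (D E : divisor0 iota) : div_class D = div_class E <->
  exists f, f != 0 /\ forall P : place iota, coeff P D - coeff P E = P f.
Proof.
have dB : divisor (D - E) = divisor D - divisor E.
  by rewrite -[divisor (D - E)]/(val (D - E)) raddfB.
have -> : (div_class D = div_class E) <-> (D - E \in @principal k K iota).
  by rewrite Quotient.idealrBE; split=> [e|/eqP //]; apply/eqP; exact: e.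
rewrite inE; split=> [/asboolP|]; last move=> H; last apply/asboolP; last case: H.
  by move=> [f [f0 fE]]; exists f; split=> // P; rewrite -fE dB coeffB.
by move=> f [f0 fE]; exists f; split=> // P; rewrite -fE dB coeffB.
Qed.

Lemma div_classMn (D : divisor0 iota) n : div_class (D *+ n) = div_class D *+ n.
Proof. exact: raddfMn. Qed.

Lemma div_class_surj (a : jacobian iota) : exists D, a = div_class D.
Proof. by exists (repr a); rewrite /div_class reprK. Qed.

Lemma div_class0 : div_class 0 = 0.
Proof. exact: raddf0. Qed.

Lemma coeff_divisorMn (D : divisor0 iota) n P : coeff P (D *+ n) = coeff P D *+ n.
Proof. by rewrite -[divisor (D *+ n)]/(val (D *+ n)) raddfMn coeffMn. Qed.

End Classes.

Section Torsion.
Variables (k : closedFieldType) (p h N c d : nat).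
Local Notation M := (c * N)%N.
Hypotheses (chp : p \in [pchar k]) (h_gt0 : (0 < h)%N) (p_gt2 : (2 < p)%N).
Hypotheses (qN : (p ^ h = (N * 2).+1)%N) (dc : (d * c = 2)%N).
Variables (K : fieldType) (iota : {rmorphism k -> K}) (x y : K).
Hypothesis Hxy : chart N c iota x y.

Let Nk := N_unit chp h_gt0 qN.
Let Mk := M_unit chp h_gt0 qN dc.
Let chK := pchar_field iota chp.
Let p_gt0 : (0 < p)%N := prime_gt0 (pcharf_prime chp).
Let spanx : forall z, exists w : nat -> K, z = \sum_(i < p) w i ^+ p * x ^+ i :=
  pspan_x chp h_gt0 qN dc Hxy.
Let freex := pspan_free chp h_gt0 qN dc Hxy.
Local Notation D := (pder spanx).
Local Notation C := (cartier spanx).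
Let HD : derivation D := pder_derivation chK spanx freex.
Let Dx : D x = 1 := pder_x chK spanx freex.

(** The class of E and the differential u dx correspond to each other if
    p E is the divisor of some f with df/f = u dx. *)
Definition log_class (u : K) (a : jacobian iota) := exists f (E : divisor0 iota),
  [/\ f != 0, D f = u * f, forall P : place iota, coeff P E *+ p = P f & a = div_class E].

Let pmul_inj (m n : int) : m *+ p = n *+ p -> m = n.
Proof. by move/eqP; rewrite eqr_pMn2r // => /eqP. Qed.

Lemma log_class_total u : regular N c iota x y u -> C u = u ->
  exists2 a, log_class u a & a *+ p = 0.
Proof.
move=> ru /(cartier_fixP chK spanx freex)[f f0 Df].
have uE : u = D f / f by rewrite Df mulfK.
have pf := (dlog_regular Nk Mk Hxy chp h_gt0 qN dc HD Dx f0).2; rewrite -uE in pf.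
have {pf} pf (P : place iota) : P f = (P f %/ p)%Z *+ p.
  by rewrite -mulr_natr natz divzK // (pf ru).
have [s [us sP s0]] := degree_zero Nk Mk Hxy f0.
have [E [cE dE]] := divisor_of (fun P : place iota => (P f %/ p)%Z) us.
have cE' P : coeff P E *+ p = P f.
  rewrite cE; case: ifP => [_|/negbT Ps]; first by rewrite -pf.
  by rewrite mul0rn; apply/esym/eqP; apply: contraNT Ps; exact: sP.
have dE0 : E \in @degree0 k K iota.
  rewrite inE dE; apply/eqP/pmul_inj; rewrite mul0rn -sumrMnl -[RHS]s0.
  by apply: eq_bigr => P _; rewrite -pf.
pose E0 := Divisor0 dE0; exists (div_class E0); first by exists f, E0.
rewrite -div_classMn -(div_class0 iota); apply/div_class_eq; exists f; split=> // P.
by rewrite coeff_divisorMn coeff0 subr0 cE'.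
Qed.

Lemma log_class_surj a : a *+ p = 0 ->
  exists u, [/\ log_class u a, regular N c iota x y u & C u = u].
Proof.
have [E ->] := div_class_surj a; rewrite -div_classMn -(div_class0 iota) => /div_class_eq[f [f0 fE]].
have cE P : coeff P E *+ p = P f by rewrite -fE coeff_divisorMn coeff0 subr0.
have Df : D f = D f / f * f by rewrite divfK.
exists (D f / f); split.
- by exists f, E.
- apply/(dlog_regular Nk Mk Hxy chp h_gt0 qN dc HD Dx f0) => P.
  by rewrite -cE -mulr_natr natz dvdz_mull.
- by apply/(cartier_fixP chK spanx freex); exists f.
Qed.

(** Functions with the same logarithmic derivative differ by a p-th power. *)
Lemma log_class_fun u a b : log_class u a -> log_class u b -> a = b.
Proof.
move=> [f [E [f0 Df cE ->]]] [g [F [g0 Dg cF ->]]]; apply/div_class_eq.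
have [w wE] : exists w, f / g = w ^+ p.
  apply: (pder_eq0 chK (spanx := spanx) freex).
  by rewrite HD.2 (derV HD) // Df Dg; field.
have fg0 : f / g != 0 by rewrite mulf_neq0 ?invr_eq0.
have w0 : w != 0 by apply: contraNneq fg0 => w0; rewrite wE w0 expr0n gtn_eqF.
exists w; split=> // P; apply: pmul_inj.
by rewrite mulrnBl cE cF -ordX -wE ord_div.
Qed.

(** A p-th power does not change the logarithmic derivative, nor does a function
    with trivial divisor, which is a constant. *)
Lemma log_class_inj u v a : log_class u a -> log_class v a -> u = v.
Proof.
move=> [f [E [f0 Df cE ->]]] [g [F [g0 Dg cF /div_class_eq[w [w0 wE]]]]].
have wp0 : w ^+ p != 0 by rewrite expf_neq0.
have [b bE] : exists b, f / (g * w ^+ p) = iota b.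
  apply: (no_poles_const Nk Mk Hxy).
    by rewrite mulf_neq0 ?invr_eq0 ?mulf_neq0.
  move=> P; rewrite ord_div ?mulf_neq0 // ord_mul // ordX -wE -cE -cF mulrnBl.
  by rewrite addrCA subrr addr0 subrr.
have fE : f = iota b * (g * w ^+ p) by rewrite -bE divfK // mulf_neq0.
have [b' b'E] := pth_root chp b.
apply: (mulIf f0); rewrite -Df {1}fE b'E rmorphXn.
have -> : iota b' ^+ p * (g * w ^+ p) = g * (iota b' * w) ^+ p by rewrite exprMn; ring.
rewrite HD.2 (der_pth HD chK) mulr0 addr0 Dg -mulrA; congr (_ * _).
by rewrite fE b'E rmorphXn exprMn; ring.
Qed.

(** By [log_class_total] and the three other properties of [log_class], the
    p-torsion classes correspond to the regular differentials fixed by the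
    Cartier operator, which are counted by [card_frob_system]. *)
Lemma card_torsion : exists s : seq (torsion (jacobian iota) p),
  [/\ uniq s, size s = (p ^ #|@good_index p h N c d|)%N & forall a, a \in s].
Proof.
have [|||||s [us ss sP]] := @card_frob_system k p _ chp
    (enum (@good_index p h N c d)) (@rot_form p h N c d) (fun=> 1%N)
    (fun m : form_index N c => (cartier_coef p d m)%:R^-1).
- exact: enum_uniq.
- by move=> m; rewrite !mem_enum => gm; rewrite [_ \in _](good_rot chp h_gt0 p_gt2 qN dc).
- move=> m m' _ _; exact: (rot_form_inj chp h_gt0 p_gt2 qN dc).
- by [].
- move=> m; rewrite mem_enum => /(goodP chp h_gt0 p_gt2 qN dc)[_ /(_ 0%N h_gt0)].
  by rewrite invr_eq0.
have supp (b : {ffun form_index N c -> k}) m : b \in s -> ~~ holomorphic m -> b m = 0.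
  move=> /sP[_ b0] hm; apply: b0; rewrite mem_enum; apply: contraNN hm.
  by case/(goodP chp h_gt0 p_gt2 qN dc).
have /boolp.choice[F FP] : forall b : {ffun form_index N c -> k}, exists a : torsion (jacobian iota) p,
    b \in s -> log_class (diff_of p iota x y b) (torsion_val a).
  move=> b; have [bs|_] := boolP (b \in s); last by exists 0.
  have b0 m := supp b m bs.
  have [|a ua pa] := log_class_total (diff_of_regular chp h_gt0 qN dc Hxy b0).
    by apply/(fixed_system chp h_gt0 p_gt2 qN dc Hxy b0)/sP.
  have ta : a \in @ntorsion (jacobian iota) p by rewrite inE pa.
  by exists (Torsion ta).
exists (map F s); split.
- rewrite map_inj_in_uniq // => b b' bs b's e.
  have := FP b' b's; rewrite -e => /(log_class_inj (FP b bs)).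
  exact: (diff_of_inj chp h_gt0 p_gt2 qN dc Hxy (supp b ^~ bs) (supp b' ^~ b's)).
- by rewrite size_map ss big_const_seq count_predT iter_addn_0 mul1n -cardE.
- move=> a; have /eqP pa := torsionP a.
  have [u [ua ru Cu]] := log_class_surj pa.
  have [b b0 uE] := regular_diff_of chp h_gt0 p_gt2 qN dc Hxy ru.
  have bs : b \in s.
    by apply/sP/(fixed_system chp h_gt0 p_gt2 qN dc Hxy b0); rewrite -uE.
  apply/mapP; exists b => //; apply: val_inj.
  by apply: log_class_fun ua _; rewrite uE; exact: FP.
Qed.

Lemma torsion_iso : exists phi :
  {additive torsion (jacobian iota) p -> 'rV['F_p]_#|@good_index p h N c d|}, bijective phi.
Proof.
have [s [us ss sP]] := card_torsion.
apply: elementary_abelian us ss sP; first exact: pcharf_prime chp.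
move=> a; apply: val_inj; rewrite raddfMn /=.
by have /eqP := torsionP a.
Qed.

End Torsion.

(** * Existence of the function field *)

Lemma fraction_repr (R : idomainType) (e : {fraction R}) :
  exists u v : R, v != 0 /\ e = FracField.tofrac u / FracField.tofrac v.
Proof.
elim/quotW: e => r; have d0 := denom_ratioP r.
exists (frac r).1, (frac r).2; split=> //.
apply: (@mulIf _ (FracField.tofrac (frac r).2)); first by rewrite tofrac_eq0.
rewrite divfK ?tofrac_eq0 //; unlock FracField.tofrac.
rewrite -[LHS]FracField.pi_mul /FracField.mulf; apply/eqmodP.
by rewrite /= FracField.equivfE !numden_Ratio ?mulf_neq0 ?oner_neq0 // !mulr1 mulrC.
Qed.

Lemma irreducible_factor (F : fieldType) (q : {poly F}) : (1 < size q)%N ->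
  exists2 a, irreducible_poly a & a %| q.
Proof.
move=> sq; pose P n := `[< exists2 a : {poly F}, size a = n & (1 < n)%N /\ a %| q >].
have exP : exists n, P n by exists (size q); apply/asboolP; exists q.
case: (ex_minnP exP) => n /asboolP[a sa [n1 aq]] min_n; exists a => //.
split; first by rewrite sa.
move=> b sb ba; have a0 : a != 0 by rewrite -size_poly_gt0 sa ltnW.
have b0 : b != 0 by apply: contraNneq a0 => b0; move: ba; rewrite b0 dvd0p.
rewrite -dvdp_size_eqp // eqn_leq dvdp_leq //= sa; apply: min_n.
apply/asboolP; exists b => //; split; last exact: dvdp_trans aq.
by rewrite ltn_neqAle eq_sym sb size_poly_gt0.
Qed.

Section Existence.
Variables (k : closedFieldType) (N c : nat).
Local Notation M := (c * N)%N.
Hypotheses (Nk : N%:R != 0 :> k) (Mk : M%:R != 0 :> k).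

Let N_gt0 : (0 < N)%N.
Proof. by rewrite lt0n; apply: contraNneq Nk => ->. Qed.
Let M_gt0 : (0 < M)%N.
Proof. by rewrite lt0n; apply: contraNneq Mk => ->. Qed.

Local Notation E := {fraction {poly k}}.
Local Notation "g %:F" := (FracField.tofrac g).

Let g : {poly k} := 'X^M - (-1)%:P.

Let g0 : g != 0.
Proof. by rewrite -size_poly_gt0 size_XnsubC. Qed.

Let simple_root : exists a, mup a g = 1%N.
Proof.
have m10 : -1 != 0 :> k by rewrite oppr_eq0 oner_neq0.
have [s [us ss _ gE]] := nth_roots Mk m10.
case: s us ss gE => [|a s] us ss gE; first by have := M_gt0; rewrite -ss.
by exists a; rewrite /g gE mu_prod_XsubC count_uniq_mem // inE eqxx.
Qed.

(** Y^N - g is irreducible over k(x).  A factor of degree n is, up to sign and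
    roots of unity, of constant term z^n with z^N = g; so g^n is the N-th power
    of a rational function, and looking at a simple root of g, N divides n. *)
Let factor_degree (L : fieldType) (j : {rmorphism E -> L}) (z : L) (A : {poly E}) :
  z ^+ N = j g%:F -> (1 < size A)%N -> A %| 'X^N - (g%:F)%:P -> (N < size A)%N.
Proof.
move=> zN sA AP; have [zeta zP] := prim_root_exists Nk.
pose i : {rmorphism k -> L} := j \o (@FracField.tofrac {poly k}) \o polyC.
have z0 : z != 0.
  by apply: contraTneq isT => z0; move/eqP: zN; rewrite z0 expr0n gtn_eqF // eq_sym fmorph_eq0 tofrac_eq0 (negPf g0).
have iP : N.-primitive_root (i zeta) by rewrite fmorph_primitive_root.
have PE : map_poly j ('X^N - (g%:F)%:P) = \prod_(l < N) ('X - (i zeta ^+ l * z)%:P).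
  rewrite rmorphB /= map_polyXn map_polyC /= -zN.
  pose rs := [seq i zeta ^+ l * z | l : 'I_N].
  have := @all_roots_prod_XsubC _ ('X^N - (z ^+ N)%:P) rs.
  rewrite size_XnsubC // /rs size_map size_enum_ord /= => -> //.
  - rewrite lead_coefE size_XnsubC //= coefB coefXn coefC eqxx gtn_eqF // subr0 scale1r.
    by rewrite big_image.
  - apply/allP => _ /mapP[l _ ->]; rewrite rootE !hornerE exprMn -exprM mulnC exprM.
    by rewrite (prim_expr_order iP) expr1n mul1r subrr.
  - rewrite uniq_rootsE map_inj_uniq ?enum_uniq // => l l' /(mulIf z0)/eqP.
    rewrite (eq_prim_root_expr iP) !modn_small // => /eqP; exact: val_inj.
have : map_poly j A %| \prod_(l <- enum 'I_N) ('X - (i zeta ^+ l * z)%:P).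
  by rewrite big_enum -PE dvdp_map.
move=> /dvdp_prod_XsubC[m /eqpf_eq[b b0 AE]].
pose l := mask m (enum 'I_N).
have sAl : size A = (size l).+1.
  by rewrite -(size_map_poly j) AE size_scale // size_prod_XsubC.
have Alead : j (lead_coef A) = b.
  by rewrite -lead_coef_map AE lead_coefZ (monicP _) ?mulr1 ?monic_prod_XsubC.
have A0 : j A.[0] = b * ((-1) ^+ size l * \prod_(e <- l) (i zeta ^+ e * z)).
  rewrite -horner_map rmorph0 AE hornerZ horner_prod; congr (_ * _).
  have -> : (-1) ^+ size l = \prod_(e <- l) (-1 : L).
    by rewrite big_const_seq count_predT; elim: (size l) => //= n IH; rewrite exprS IH.
  by rewrite -big_split; apply: eq_bigr => e _; rewrite hornerXsubC sub0r -[LHS]mulN1r.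
have AN : A.[0] ^+ N = lead_coef A ^+ N * ((-1) ^+ (size l * N) * g%:F ^+ size l).
  apply: (fmorph_inj j); rewrite rmorphXn A0 !rmorphM !rmorphXn rmorphN1 Alead exprMn exprMn -exprM.
  congr (_ * (_ * _)); rewrite -zN -prodrXl.
  rewrite (eq_bigr (fun=> z ^+ N)) => [|e _].
    by rewrite big_const_seq count_predT; elim: (size l) => //= n IH; rewrite exprS IH.
  by rewrite exprMn -exprM mulnC exprM (prim_expr_order iP) expr1n mul1r.
have A0' : A != 0 by rewrite -size_poly_gt0 ltnW.
have [u [v [v0 uv]]] := fraction_repr (A.[0] / lead_coef A).
have lA : lead_coef A != 0 by rewrite lead_coef_eq0.
have uvN : u ^+ N = v ^+ N * ((-1) ^+ (size l * N) * g ^+ size l).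
  apply/eqP; rewrite -tofrac_eq; apply/eqP.
  rewrite !tofracM !tofracXn tofracN tofrac1.
  have vF : v%:F != 0 by rewrite tofrac_eq0.
  have -> : u%:F = A.[0] / lead_coef A * v%:F by rewrite uv divfK.
  by rewrite exprMn expr_div_n AN [lead_coef A ^+ N * _]mulrC mulfK ?expf_neq0 // mulrC.
have [a ga] := simple_root.
have muX (q : {poly k}) n : q != 0 -> mup a (q ^+ n) = (n * mup a q)%N.
  move=> q0; elim: n => [|n IH]; first by rewrite expr0 mul0n mupNroot // root1.
  by rewrite exprS mupM ?expf_neq0 // IH mulSn.
have u0 : u != 0.
  have : u ^+ N != 0.
    by rewrite uvN !mulf_neq0 ?expf_neq0 // oppr_eq0 oner_neq0.
  by rewrite expf_eq0 N_gt0.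
have := congr1 (mup a) uvN.
rewrite muX // mupM ?expf_neq0 ?mulf_neq0 ?expf_neq0 ?oppr_eq0 ?oner_neq0 //.
rewrite mupM ?expf_neq0 ?oppr_eq0 ?oner_neq0 // !muX // ?oppr_eq0 ?oner_neq0 //.
have -> : mup a (-1 : {poly k}) = 0%N by rewrite mupNroot // rootN root1.
rewrite ga muln0 add0n muln1 => e.
have Nl : (N %| size l)%N.
  have : (N %| N * mup a v + size l)%N by rewrite -e dvdn_mulr.
  by rewrite dvdn_addr // dvdn_mulr.
rewrite sAl ltnS; apply: dvdn_leq Nl.
by rewrite -ltnS -sAl.
Qed.

(** Adjoin a root of an irreducible factor A of Y^N - g to k(x); as A has degree
    at least N, the powers of the root below N are independent. *)
Lemma function_field_exists : exists (K : fieldType) (iota : {rmorphism k -> K}) (x y : K),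
  is_function_field iota x y (fermat_eq k N M).
Proof.
have sP : size ('X^N - (g%:F)%:P : {poly E}) = N.+1 by rewrite size_XnsubC.
have [|A irrA AP] := @irreducible_factor _ ('X^N - (g%:F)%:P : {poly E}); first by rewrite sP.
have [L _ [z rz genz]] := irredp_FAdjoin irrA.
pose j : {rmorphism E -> L} := in_alg L.
have zN : z ^+ N = j g%:F.
  apply/eqP; rewrite -subr_eq0; have /dvdpP[B PE] := AP.
  have := congr1 (fun q => (map_poly j q).[z]) PE.
  rewrite rmorphB /= map_polyXn map_polyC /= !hornerE rmorphM hornerM => ->.
  by rewrite (rootP rz) mulr0.
have sA : (N < size A)%N by apply: (factor_degree zN _ AP); case: irrA.
pose iota : {rmorphism k -> L} := j \o (@FracField.tofrac {poly k}) \o polyC.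
pose x := j ('X%:F).
have evE q : eval1 iota x q = j q%:F.
  rewrite (eval1_coef _ _ (leqnn _)) -[in RHS](coefK q) poly_def !rmorph_sum; apply: eq_bigr => l _.
  by rewrite -mul_polyC !rmorphM !rmorphXn.
exists L, iota, x, z; apply/(chartP c Nk); split.
- rewrite zN -[x]/(j 'X%:F) -rmorphXn -tofracXn -(rmorph1 j) -tofrac1 -rmorphD -tofracD.
  by rewrite /g polyCN opprK.
- move=> C C0 l lN; pose Q : {poly E} := \poly_(l < N) (C l)%:F.
  have sQ : (size Q <= N)%N by exact: size_poly.
  have rQ : root (map_poly j Q) z.
    apply/rootP; rewrite (horner_coef_wide _ (leq_trans (size_poly _ _) sQ)) -[RHS]C0.
    by apply: eq_bigr => i _; rewrite coef_map evE coef_poly ltn_ord.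
  have AQ : A %| Q.
    apply: contraT => nAQ; have : coprimep A Q by rewrite irreducible_poly_coprime.
    move/Bezout_coprimepP => [[u v] /= /eqpf_eq[b b0 /(congr1 (fun q => (map_poly j q).[z]))]].
    rewrite rmorphD !rmorphM hornerD !hornerM (rootP rz) (rootP rQ) !mulr0 addr0.
    by rewrite map_polyZ rmorph1 hornerZ hornerC mulr1 => /esym/eqP; rewrite fmorph_eq0 (negPf b0).
  have Q0 : Q = 0.
    apply/eqP; apply: contraT => Q0; have := dvdp_leq Q0 AQ.
    by rewrite leqNgt (leq_ltn_trans sQ sA).
  apply/eqP; rewrite -tofrac_eq0; have := congr1 (fun q : {poly E} => q`_l) Q0.
  by rewrite /Q coef_poly lN coef0 => ->.
- have fE e : fgen iota x z (j e).
    have [u [v [v0 ->]]] := fraction_repr e; rewrite fmorph_div -!evE -!(eval2C _ _ z).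
    by apply: fgenM; [exact: fgen_ev | apply: fgenV; exact: fgen_ev].
  move=> w; have /Fadjoin_polyP[q /polyOverP q1 ->] : w \in <<1; z>>%VS by rewrite genz memvf.
  rewrite horner_coef; apply: big_ind => [||i _].
  - by rewrite -(rmorph0 iota); exact: fgen_iota.
  - exact: fgenD.
  - apply: fgenM; first by have /vlineP[e ->] := q1 i; exact: fE.
    elim: (nat_of_ord i) => [|n IH]; first by rewrite expr0 -(rmorph1 iota); exact: fgen_iota.
    by rewrite exprS; apply: fgenM; first exact: fgen_y.
Qed.
End Existence.

(** * The p-rank *)
Lemma sum_multiples e A (F : nat -> nat) : (0 < e)%N -> (forall n, ~~ (e %| n)%N -> F n = 0%N) ->
  (\sum_(n < (e * A).+1) F n = \sum_(s < A.+1) F (e * s)%N)%N.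
Proof.
move=> e0 F0; rewrite (bigID (fun n : 'I__ => (e %| n)%N)) /= [X in (_ + X)%N]big1 ?addn0 => [|n]; last exact: F0.
have sE (s : 'I_A.+1) : nat_of_ord (inord (e * s) : 'I_(e * A).+1) = (e * s)%N.
  by rewrite inordK // ltnS leq_pmul2l // -ltnS.
rewrite (reindex_onto (fun s : 'I_A.+1 => inord (e * s) : 'I_(e * A).+1) (fun n => inord (n %/ e))) /=.
  apply: eq_big => [s|s _]; rewrite sE // dvdn_mulr // mulKn //.
  by apply/eqP; rewrite inord_val.
move=> n en; apply: val_inj; rewrite /= sE inordK ?[(e * _)%N]mulnC ?divnK // ltnS.
by rewrite leq_divLR // [(A * e)%N]mulnC -ltnS; exact: ltn_ord.
Qed.

(** The index (i, s) corresponds to the pair (d i, 2 s). *)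
Lemma card_good_index p h d c N : (p ^ h = (N * 2).+1)%N -> (d * c = 2)%N ->
  #|@good_index p h N c d| = good_count p d h.
Proof.
move=> qN dc; have d0 : (0 < d)%N by case: d dc.
have dM : (d * (c * N) = N * 2)%N by rewrite mulnA dc mulnC.
rewrite /good_count qN -[in RHS](mulnC 2).
rewrite (@sum_multiples 2 N (fun n => \sum_(E < (2 * N).+1) good_pair p d h E n)%N) //; last first.
  by move=> n n2; rewrite big1 // => E _; rewrite /good_pair (negPf n2) andbF.
rewrite -sum1_card big_mkcond /= -(pair_bigA_idem _ (fun i j => if @good_index p h N c d (i, j) then 1 else 0)%N) //=.
rewrite exchange_big; apply: eq_bigr => s _; rewrite -[in RHS](mulnC N) -dM.
rewrite (@sum_multiples d (c * N) (fun E => good_pair p d h E (2 * s))) //=.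
by move=> E dE; rewrite /good_pair (negPf dE).
Qed.

Lemma fermat_p_rank (k : closedFieldType) p h d c N : p \in [pchar k] -> (0 < h)%N -> (2 < p)%N ->
  (p ^ h = (N * 2).+1)%N -> (d * c = 2)%N ->
  has_p_rank p (fermat_eq k N (c * N)) (good_count p d h).
Proof.
move=> chp h0 p2 qN dc; have Nk := N_unit chp h0 qN; have Mk := M_unit chp h0 qN dc.
split; first exact: (function_field_exists Nk Mk).
move=> K iota x y /(chartP c Nk) Hxy; rewrite -(card_good_index qN dc).
exact: (torsion_iso chp h0 p2 qN dc Hxy).
Qed.

Theorem theorem4p4 (h p : nat) (h_gt0 : (0 < h)%N) (p_prime : prime p)
    (p_neq2 : (p != 2)%N)
    (k : closedFieldType) (j : {rmorphism 'F_p -> k})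
    (k_algebraic : integralRange j) :
  (exists r : nat,
     has_p_rank p (fermat_eq k ((p ^ h - 1) %/ 2) ((p ^ h - 1) %/ 2)) r /\
     r%:R = ((p%:R + 1) ^+ h * (p%:R ^+ h + 3)) / 2 ^+ (h + 2)
            - 3 * (p%:R ^+ h - 1) / 2 :> rat) /\
  (exists r : nat,
     has_p_rank p (fermat_eq k ((p ^ h - 1) %/ 2) (p ^ h - 1)) r /\
     r%:R = ((p%:R + 1) ^+ h * (p%:R ^+ h + 1)) / 2 ^+ (h + 1)
            - 2 * (p%:R ^+ h - 1) :> rat).
Proof.
have p_gt2 : (2 < p)%N by rewrite ltn_neqAle eq_sym p_neq2 prime_gt1.
have p_odd : odd p by case: (even_prime p_prime) => // p2; rewrite p2 in p_neq2.
have p_gt0 := prime_gt0 p_prime.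
have chp : p \in [pchar k] by rewrite (pcharf_eq (rmorph_pchar j (pchar_Fp p_prime))) inE.
have [N qN] : exists N, (p ^ h = (N * 2).+1)%N.
  by exists (p ^ h)./2; rewrite muln2 -[LHS]odd_double_half oddX p_odd orbT.
rewrite qN subn1 /= mulnK //; split.
  exists (good_count p 2 h); split; last by rewrite (card_good_pair p_gt0) //; right.
  by have := @fermat_p_rank k p h 2 1 N chp h_gt0 p_gt2 qN erefl; rewrite mul1n.
exists (good_count p 1 h); split; last by rewrite (card_good_pair p_gt0) //; left.
by rewrite mulnC; exact: (@fermat_p_rank k p h 1 2 N).
Qed.
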